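(* Let $k$ be an algebraically closed field, let $G$, $G'$, $G''$ be algebraic groups over $k$, let $H$ be a closed subgroup of $G$ and $H'$ a closed subgroup of $G'$, and let $F:\mathrm{Mod}(G)\to\mathrm{Mod}(G')$ and $F':\mathrm{Mod}(G')\to\mathrm{Mod}(G'')$ be additive left exact covariant functors. Suppose that $F$ maps $(G,H)$-injective modules to modules that are $(G',H')$-acyclic for $F'$, and that $F$ is $(H,H')$-split. Then for every $G$-module $M$ there exists a spectral sequence $$E_2^{i,j}=\mathrm{R}^{i}_{(G',H')}F'\left(\mathrm{R}^{j}_{(G,H)}F(M)\right)\Rightarrow\left(\mathrm{R}^{i+j}_{(G,H)}(F'\circ F)\right)(M).$$
   Context: $\mathrm{Mod}(G)$ is the category of rational $G$-modules. For a closed subgroup $H\le G$, an exact sequence of $G$-modules $\cdots\to M_{i-1}\xrightarrow{d_{i-1}}M_i\xrightarrow{d_i}M_{i+1}\to\cdots$ is $(G,H)$-exact if $\mathrm{Ker}(d_i)$ is a direct $H$-module summand of $M_i$ for all $i$. A $G$-module $I$ is $(G,H)$-injective if for every $(G,H)$-exact sequence $0\to M_1\xrightarrow{d_1}M_2\to M_3\to0$ and every $G$-homomorphism $f:M_1\to I$ there is a $G$-homomorphism $h:M_2\to I$ with $f=h\circ d_1$. A $(G,H)$-injective resolution of $M$ is a $(G,H)$-exact sequence $0\to M\to I_0\to I_1\to\cdots$ with every $I_j$ being $(G,H)$-injective; every $G$-module has one. For an additive left exact covariant functor $F$ on $\mathrm{Mod}(G)$, $\mathrm{R}^i_{(G,H)}F(M)$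 is the $i$-th cohomology of the complex $0\to F(I_0)\to F(I_1)\to\cdots$ (independent of the choice of $(G,H)$-injective resolution). A $G'$-module $X$ is $(G',H')$-acyclic for $F'$ if $\mathrm{R}^i_{(G',H')}F'(X)=0$ for all $i>0$. The functor $F:\mathrm{Mod}(G)\to\mathrm{Mod}(G')$ is $(H,H')$-split if for every $(G,H)$-exact sequence $\cdots\to M_{i-1}\xrightarrow{d_{i-1}}M_i\xrightarrow{d_i}M_{i+1}\to\cdots$ the sequences $$0\to\mathrm{Ker}(F(d_j))\to F(M_j)\to\mathrm{Im}(F(d_j))\to0,$$ $$0\to\mathrm{Im}(F(d_j))\to\mathrm{Ker}(F(d_{j+1}))\to H^{j+1}(F(M_\bullet))\to0$$ are $(G',H')$-exact for all $j$. *)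

(* Defs.v *)
From HB Require Import structures.
From mathcomp Require Import all_boot all_order all_algebra.
From mathcomp Require Import boolp classical_sets.

Set Implicit Arguments.
Unset Strict Implicit.
Unset Printing Implicit Defensive.

Import GRing.Theory.
Local Open Scope ring_scope.
Local Open Scope quotient_scope.

Section LinOf.
Variables (k : fieldType) (U V : lmodType k) (f : U -> V) (lf : linear f).
Definition lin_of_fun (_ : linear f) := f.
HB.instance Definition _ :=
  GRing.isLinear.Build k U V *:%R (lin_of_fun lf) lf.
Definition lin_of : {linear U -> V} := lin_of_fun lf.
Lemma lin_ofE x : lin_of x = f x. Proof. by []. Qed.
End LinOf.
Arguments lin_of : simpl never.

Section Tensor.
Variables (k : fieldType) (U V : lmodType k).

Definition bilin (W : lmodType k) (f : U -> V -> W) : Prop :=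
  (forall v, linear (f^~ v)) /\ (forall u, linear (f u)).

Definition teval (W : lmodType k) (f : U -> V -> W) (s : seq (U * V)) : W :=
  \sum_(p <- s) f p.1 p.2.

(** The formal sum [:: (u1, v1); ...; (un, vn)] stands for the tensor
    u1 (x) v1 + ... + un (x) vn; two formal sums are identified when no
    bilinear map separates them. *)
Definition teq (s t : seq (U * V)) : bool :=
  `[< forall (W : lmodType k) (f : U -> V -> W), bilin f ->
        teval f s = teval f t >].

Lemma teq_refl : reflexive teq.
Proof. by move=> s; apply/asboolP. Qed.

Lemma teq_sym : symmetric teq.
Proof. by move=> s t; apply: asbool_equiv_eq; split=> h W f bf; rewrite h. Qed.

Lemma teq_trans : transitive teq.
Proof.
move=> s t r /asboolP h1 /asboolP h2; apply/asboolP => W f bf.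
by rewrite h1 // h2.
Qed.

Canonical teq_equiv := EquivRel teq teq_refl teq_sym teq_trans.

Definition tens_sort : Type := {eq_quot teq_equiv}.
HB.instance Definition _ := Choice.on tens_sort.
HB.instance Definition _ := EqQuotient.on tens_sort.

Lemma pi_tensP (s t : seq (U * V)) : \pi_tens_sort s = \pi_tens_sort t <-> teq s t.
Proof. by split=> [/eqmodP|/eqmodP]. Qed.

Definition tlift (W : lmodType k) (f : U -> V -> W) (x : tens_sort) : W :=
  teval f (repr x).

Definition pure (u : U) (v : V) : tens_sort := \pi_tens_sort [:: (u, v)].

Lemma tlift_pi (W : lmodType k) (f : U -> V -> W) s :
  bilin f -> tlift f (\pi_tens_sort s) = teval f s.
Proof.
move=> bf; rewrite /tlift.
have /pi_tensP/asboolP : repr (\pi_tens_sort s) = s %[mod tens_sort] by rewrite reprK.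
exact.
Qed.

Lemma tens_ext (x y : tens_sort) :
  (forall (W : lmodType k) (f : U -> V -> W), bilin f -> tlift f x = tlift f y) ->
  x = y.
Proof.
move=> h; rewrite -[x]reprK -[y]reprK; apply/pi_tensP.
by apply/asboolP => W f bf; exact: h.
Qed.

Definition tens0 : tens_sort := \pi_tens_sort [::].
Definition tens_add (x y : tens_sort) : tens_sort := \pi_tens_sort (repr x ++ repr y).
Definition tens_scale (a : k) (x : tens_sort) : tens_sort :=
  \pi_tens_sort [seq (a *: p.1, p.2) | p <- repr x].
Definition tens_opp (x : tens_sort) : tens_sort := tens_scale (-1) x.

Lemma tlift_tens0 (W : lmodType k) (f : U -> V -> W) :
  bilin f -> tlift f tens0 = 0.
Proof. by move=> bf; rewrite tlift_pi // /teval big_nil. Qed.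

Lemma tlift_add (W : lmodType k) (f : U -> V -> W) x y :
  bilin f -> tlift f (tens_add x y) = tlift f x + tlift f y.
Proof. by move=> bf; rewrite tlift_pi // /teval big_cat. Qed.

Lemma bilinZl (W : lmodType k) (f : U -> V -> W) a u v :
  bilin f -> f (a *: u) v = a *: f u v.
Proof.
case=> hl _; have h0 : f 0 v = 0.
  by have := hl v (-1) 0 0; rewrite scaler0 addr0 scaleN1r addNr.
by have := hl v a u 0; rewrite addr0 h0 addr0.
Qed.

Lemma tlift_scale (W : lmodType k) (f : U -> V -> W) a x :
  bilin f -> tlift f (tens_scale a x) = a *: tlift f x.
Proof.
move=> bf; rewrite tlift_pi // /tlift /teval big_map scaler_sumr.
by apply: eq_bigr => p _; rewrite bilinZl.
Qed.

Definition tliftE := (tlift_tens0, tlift_add, tlift_scale).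

Lemma tens_addA : associative tens_add.
Proof. by move=> x y z; apply: tens_ext => W f bf; rewrite !tliftE // addrA. Qed.
Lemma tens_addC : commutative tens_add.
Proof. by move=> x y; apply: tens_ext => W f bf; rewrite !tliftE // addrC. Qed.
Lemma tens_add0 : left_id tens0 tens_add.
Proof. by move=> x; apply: tens_ext => W f bf; rewrite !tliftE // add0r. Qed.
Lemma tens_addN : left_inverse tens0 tens_opp tens_add.
Proof.
move=> x; apply: tens_ext => W f bf.
by rewrite /tens_opp !tliftE // scaleN1r addNr.
Qed.

HB.instance Definition _ :=
  GRing.isZmodule.Build tens_sort tens_addA tens_addC tens_add0 tens_addN.

Lemma tens_scaleA a b x : tens_scale a (tens_scale b x) = tens_scale (a * b) x.
Proof. by apply: tens_ext => W f bf; rewrite !tliftE // scalerA. Qed.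
Lemma tens_scale1 : left_id 1 tens_scale.
Proof. by move=> x; apply: tens_ext => W f bf; rewrite !tliftE // scale1r. Qed.
Lemma tens_scaleDr : right_distributive tens_scale +%R.
Proof.
by move=> a x y; apply: tens_ext => W f bf; rewrite !tliftE // scalerDr.
Qed.
Lemma tens_scaleDl x : {morph tens_scale^~ x : a b / a + b}.
Proof.
by move=> a b; apply: tens_ext => W f bf; rewrite !tliftE // scalerDl.
Qed.

HB.instance Definition _ := GRing.Zmodule_isLmodule.Build k tens_sort
  tens_scaleA tens_scale1 tens_scaleDr tens_scaleDl.

Definition tens : lmodType k := tens_sort.

Lemma pure_bilin : bilin pure.
Proof.
split=> [v a u u'|u a v v']; apply: tens_ext => W f bf.
  rewrite [_ + _ in RHS]/(tens_add (tens_scale a (pure u v)) _) !tliftE //.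
  rewrite !tlift_pi // /teval !big_seq1 /=; exact: bf.1.
rewrite [_ + _ in RHS]/(tens_add (tens_scale a (pure u v)) _) !tliftE //.
rewrite !tlift_pi // /teval !big_seq1 /=; exact: bf.2.
Qed.

Section Lift.
Variables (W : lmodType k) (f : U -> V -> W) (bf : bilin f).

Lemma tlift_linear : linear (tlift f).
Proof.
move=> a x y.
by rewrite [a *: x + y]/(tens_add (tens_scale a x) y) !tliftE.
Qed.

Lemma tlift_pure u v : tlift f (pure u v) = f u v.
Proof. by rewrite tlift_pi // /teval big_seq1. Qed.

Definition tliftL : {linear tens -> W} := lin_of tlift_linear.

Lemma tliftLE x : tliftL x = tlift f x. Proof. by []. Qed.
End Lift.

Lemma tens_pi_sum s : \pi_tens_sort s = \sum_(p <- s) pure p.1 p.2.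
Proof.
apply: tens_ext => W f bf; rewrite -(tliftLE bf (\sum_(_ <- _) _)) linear_sum.
rewrite tlift_pi //; apply: eq_bigr => p _; by rewrite tliftLE tlift_pure.
Qed.

Lemma tensP (x : tens) : exists s : seq (U * V), x = \sum_(p <- s) pure p.1 p.2.
Proof. by exists (repr x); rewrite -tens_pi_sum reprK. Qed.

Lemma tens_lin_ext (W : lmodType k) (f g : {linear tens -> W}) :
  (forall u v, f (pure u v) = g (pure u v)) -> f =1 g.
Proof.
move=> h x; have [s ->] := tensP x; rewrite !linear_sum.
by apply: eq_bigr => p _; rewrite h.
Qed.

Lemma tens_fun_ext (W : lmodType k) (f g : tens -> W) : linear f -> linear g ->
  (forall u v, f (pure u v) = g (pure u v)) -> forall x, f x = g x.
Proof. by move=> lf lg; exact: (@tens_lin_ext _ (lin_of lf) (lin_of lg)). Qed.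

End Tensor.
Arguments tliftL : simpl never.

Section TensorMaps.
Variable k : fieldType.

Lemma bilin_lin (U V W W' : lmodType k) (f : U -> V -> W)
    (g : {linear W -> W'}) : bilin f -> bilin (fun u v => g (f u v)).
Proof.
case=> fl fr; split=> [v a u u'|u a v v'] /=; first by rewrite fl linearP.
by rewrite fr linearP.
Qed.

Lemma bilin_comp (U V U' V' W : lmodType k) (h : U' -> V' -> W)
    (f : {linear U -> U'}) (g : {linear V -> V'}) :
  bilin h -> bilin (fun u v => h (f u) (g v)).
Proof.
case=> hl hr; split=> [v a u u'|u a v v'] /=; first by rewrite linearP hl.
by rewrite linearP hr.
Qed.

Definition tmap (U V U' V' : lmodType k)
    (f : {linear U -> U'}) (g : {linear V -> V'}) :
    {linear tens U V -> tens U' V'} :=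
  tliftL (bilin_comp f g (@pure_bilin k U' V')).

Arguments tmap : simpl never.

Lemma tmap_pure (U V U' V' : lmodType k)
    (f : {linear U -> U'}) (g : {linear V -> V'}) u v :
  tmap f g (pure u v) = pure (f u) (g v).
Proof. by rewrite /tmap tliftLE tlift_pure //; apply/bilin_comp/pure_bilin. Qed.

Lemma tassoc_bilin1 (U V W : lmodType k) (w : W) :
  bilin (fun (u : U) (v : V) => pure u (pure v w)).
Proof.
split=> [v a u u'|u a v v'] /=; first exact: (pure_bilin _ _).1.
by rewrite (pure_bilin V W).1 (pure_bilin U _).2.
Qed.

Lemma tassoc_bilin2 (U V W : lmodType k) :
  bilin (fun (x : tens U V) (w : W) => tliftL (tassoc_bilin1 U V w) x).
Proof.
split=> [w a x x'|x a w w'] /=; first by rewrite linearP.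
have [s ->] := tensP x; rewrite !(linear_sum (tliftL _)) scaler_sumr.
rewrite -big_split; apply: eq_bigr => p _ /=; rewrite !tliftLE !tlift_pure; try exact: tassoc_bilin1.
by rewrite (pure_bilin V W).2 (pure_bilin U _).2.
Qed.

Definition tassoc (U V W : lmodType k) :
    {linear tens (tens U V) W -> tens U (tens V W)} :=
  tliftL (tassoc_bilin2 U V W).

Arguments tassoc : simpl never.

Lemma tassoc_pure (U V W : lmodType k) (u : U) (v : V) (w : W) :
  tassoc U V W (pure (pure u v) w) = pure u (pure v w).
Proof.
rewrite /tassoc tliftLE tlift_pure; last exact: tassoc_bilin2.
by rewrite tliftLE tlift_pure //; exact: tassoc_bilin1.
Qed.

(** The product of the algebra A (x) A; the value does not depend on the
    formal sums [repr x] and [repr y]. *)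
Definition tens_mul (A : algType k) (x y : tens A A) : tens A A :=
  \sum_(p <- repr x) \sum_(q <- repr y) pure (p.1 * q.1) (p.2 * q.2).

End TensorMaps.

(** An affine algebraic group (scheme) G over k, given by its coordinate ring
    k[G], a finitely generated commutative Hopf algebra.  The linear algebraic
    groups in the sense of varieties are those with k[G] reduced. *)
Record alg_group (k : fieldType) := AlgGroup {
  coord : comAlgType k;
  comul : {linear coord -> tens coord coord};
  counit : {lrmorphism coord -> k^o};
  antipode : {lrmorphism coord -> coord};
  coord_fg : exists s : seq coord, forall S : {pred coord},
    subalg_closed S -> {subset s <= S} -> forall a, a \in S;
  comul1 : comul 1 = pure 1 1;
  comulM : forall a b, comul (a * b) = tens_mul (comul a) (comul b);
  comulA : forall a,
    tassoc _ _ _ (tmap comul idfun (comul a)) = tmap idfun comul (comul a);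
  counit_mul : forall a, tlift (fun x y => counit x *: y) (comul a) = a;
  mul_counit : forall a, tlift (fun x y => counit y *: x) (comul a) = a;
  antipode_mul : forall a,
    tlift (fun x y => antipode x * y) (comul a) = (counit a)%:A;
  mul_antipode : forall a,
    tlift (fun x y => x * antipode y) (comul a) = (counit a)%:A }.

(** A closed subgroup is a group H with a surjective morphism of Hopf algebras
    k[G] -> k[H], i.e. a closed immersion of H in G. *)
Record closed_subgroup (k : fieldType) (G : alg_group k) := ClosedSubgroup {
  csg_group :> alg_group k;
  csg_res : {lrmorphism coord G -> coord csg_group};
  csg_surj : forall b, exists a, csg_res a = b;
  csg_comul : forall a,
    comul csg_group (csg_res a) = tmap csg_res csg_res (comul G a);
  csg_counit : forall a, counit csg_group (csg_res a) = counit G a;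
  csg_antipode : forall a,
    antipode csg_group (csg_res a) = csg_res (antipode G a) }.

(** Rational G-modules are the right k[G]-comodules. *)
Record gmodule (k : fieldType) (G : alg_group k) := GModule {
  gm_sort :> lmodType k;
  coact : {linear gm_sort -> tens gm_sort (coord G)};
  coactA : forall x,
    tassoc _ _ _ (tmap coact idfun (coact x)) = tmap idfun (comul G) (coact x);
  coact1 : forall x, tlift (fun m a => counit G a *: m) (coact x) = x }.

Record ghom (k : fieldType) (G : alg_group k) (M N : gmodule G) := GHom {
  ghom_fun :> {linear M -> N};
  ghom_coact : forall x, coact N (ghom_fun x) = tmap ghom_fun idfun (coact M x) }.

Section TensorLemmas.
Variable k : fieldType.

Lemma tens3_fun_ext (U V W X : lmodType k) (f g : tens (tens U V) W -> X) :
  linear f -> linear g ->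
  (forall u v w, f (pure (pure u v) w) = g (pure (pure u v) w)) ->
  forall x, f x = g x.
Proof.
move=> lf lg h; apply: tens_fun_ext => // y w; move: y.
have lp := (pure_bilin (tens U V) W).1 w.
by apply: tens_fun_ext => [a y z|a y z|u v]; rewrite ?lp ?lf ?lg //; exact: h.
Qed.

Lemma tmap_ext (U V U' V' : lmodType k) (f f' : {linear U -> U'})
    (g g' : {linear V -> V'}) :
  f =1 f' -> g =1 g' -> tmap f g =1 tmap f' g'.
Proof. by move=> ff gg; apply: tens_lin_ext => u v; rewrite !tmap_pure ff gg. Qed.

Lemma tmap_comp (U V U' V' U'' V'' : lmodType k)
    (f' : {linear U' -> U''}) (g' : {linear V' -> V''})
    (f : {linear U -> U'}) (g : {linear V -> V'}) x :
  tmap f' g' (tmap f g x) = tmap (f' \o f) (g' \o g) x.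
Proof.
move: x; apply: tens_fun_ext => [a y z|a y z|u v]; rewrite ?linearP //.
by rewrite !tmap_pure.
Qed.

Lemma tmap_id (U V : lmodType k) (x : tens U V) : tmap idfun idfun x = x.
Proof.
move: x; apply: tens_fun_ext => [a y z|a y z|u v]; rewrite ?linearP //.
by rewrite tmap_pure.
Qed.

Lemma tmap_can (U V U' : lmodType k) (f : {linear U -> U'})
    (g : {linear U' -> U}) :
  cancel f g -> cancel (tmap f (@idfun V)) (tmap g (@idfun V)).
Proof.
by move=> fK x; rewrite tmap_comp -[RHS]tmap_id; apply: tmap_ext => u /=.
Qed.

Lemma tmap0 (U V U' V' : lmodType k) (f : {linear U -> U'})
    (g : {linear V -> V'}) x : f =1 (fun=> 0) -> tmap f g x = 0.
Proof.
move=> f0; move: x; apply: tens_fun_ext => [a y z|a y z|u v].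
- by rewrite linearP.
- by rewrite scaler0 addr0.
by rewrite tmap_pure f0 -(scale0r 0) (bilinZl _ _ _ (pure_bilin _ _)) scale0r.
Qed.

Lemma tmapD (U V U' V' : lmodType k) (f f1 f2 : {linear U -> U'})
    (g : {linear V -> V'}) x :
  (forall u, f u = f1 u + f2 u) -> tmap f g x = tmap f1 g x + tmap f2 g x.
Proof.
move=> fD; move: x; apply: tens_fun_ext => [a y z|a y z|u v].
- by rewrite linearP.
- by rewrite !linearP scalerDr addrACA.
rewrite !tmap_pure fD; have := (pure_bilin U' V').1 (g v) 1 (f1 u) (f2 u).
by rewrite !scale1r.
Qed.

Lemma tassoc_nat (U V W U' V' W' : lmodType k) (f : {linear U -> U'})
    (g : {linear V -> V'}) (h : {linear W -> W'}) x :
  tassoc _ _ _ (tmap (tmap f g) h x) = tmap f (tmap g h) (tassoc _ _ _ x).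
Proof.
move: x; apply: tens3_fun_ext => [a y z|a y z|u v w]; rewrite ?linearP //.
by rewrite !(tmap_pure, tassoc_pure).
Qed.

Lemma tlift_tmap (U V U' V' W : lmodType k) (h : U' -> V' -> W)
    (f : {linear U -> U'}) (g : {linear V -> V'}) x : bilin h ->
  tlift h (tmap f g x) = tlift (fun u v => h (f u) (g v)) x.
Proof.
move=> bh; have bh' := bilin_comp f g bh.
rewrite -!tliftLE; move: x; apply: tens_fun_ext => [a y z|a y z|u v].
- by rewrite !linearP.
- by rewrite linearP.
- by rewrite tmap_pure !tliftLE !tlift_pure.
Qed.

Lemma lin_tlift (U V W W' : lmodType k) (f : {linear W -> W'})
    (h : U -> V -> W) x : bilin h ->
  f (tlift h x) = tlift (fun u v => f (h u v)) x.
Proof.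
move=> bh; have bh' := bilin_lin f bh.
rewrite -!tliftLE; move: x; apply: tens_fun_ext => [a y z|a y z|u v].
- by rewrite !linearP.
- by rewrite linearP.
- by rewrite !tliftLE !tlift_pure.
Qed.

Lemma counit_bilin (G : alg_group k) (M : lmodType k) :
  bilin (fun (m : M) (a : coord G) => counit G a *: m).
Proof.
split=> [a c m m'|m c a a'] /=; first by rewrite scalerDr !scalerA mulrC.
by rewrite linearP /= scalerDl scalerA.
Qed.

Lemma tlift_ext (U V W : lmodType k) (f g : U -> V -> W) x :
  (forall u v, f u v = g u v) -> tlift f x = tlift g x.
Proof. by move=> fg; apply: eq_bigr => p _; rewrite fg. Qed.

Lemma exists_proj (U : lmodType k) (P : {pred U}) : submod_closed P ->
  exists p : {linear U -> U}, (forall x, p x \in P) /\ {in P, p =1 id}.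
Proof.
move=> [P0 PD].
pose Q (C : set U) := (forall a x y, C x -> C y -> C (a *: x + y)) /\
  (forall x, C x -> x \in P -> x = 0).
have [|A [[AD AP] Amax]] := @Zorn_bigcup U Q.
  move=> F FQ Ftot; split=> [a x y [X FX Xx] [Y FY Yy]|x [X FX Xx]]; last first.
    exact: (FQ _ FX).2.
  case: (Ftot _ _ FX FY) => [XY|YX].
    by exists Y => //; apply: (FQ _ FY).1 => //; exact: XY.
  by exists X => //; apply: (FQ _ FX).1 => //; exact: YX.
have A0 : A 0.
  apply: contrapT => nA0; apply: (Amax (fun x => x = 0)).
    split=> [x Ax|/(_ 0 erefl)//]; case: nA0.
    by have := AD (-1) x x Ax Ax; rewrite scaleN1r addNr.
  by split=> [a x y -> ->|//]; rewrite scaler0 addr0.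
have dec u : exists p, p \in P /\ A (u - p).
  apply: contrapT => nu.
  pose B : set U := fun x => exists2 a, True & exists2 c, A c & x = c + a *: u.
  apply: (Amax B).
    split=> [x Ax|BA].
      by exists 0 => //; exists x => //; rewrite scale0r addr0.
    have Au : A u.
      by apply: BA; exists 1 => //; exists 0 => //; rewrite add0r scale1r.
    by apply: nu; exists 0; split=> //; rewrite subr0.
  split=> [a x y [b _ [c Ac ->]] [b' _ [c' Ac' ->]]|x [a _ [c Ac ->]] Px].
    exists (a * b + b') => //; exists (a *: c + c'); first exact: AD.
    by rewrite scalerDr scalerDl scalerA addrACA.
  have [a0|a0] := eqVneq a 0.
    by move: Px; rewrite a0 scale0r addr0; exact: AP.
  case: nu; exists (a^-1 *: (c + a *: u)); split.
    by have := PD a^-1 _ _ Px P0; rewrite addr0.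
  rewrite scalerDr scalerA mulVf // scale1r opprD addrCA subrr addr0 -scaleNr.
  by have := AD (- a^-1) _ _ Ac A0; rewrite addr0.
have [p pP] := choice dec.
have uniqp u q q' : q \in P -> q' \in P -> A (u - q) -> A (u - q') -> q = q'.
  move=> qP q'P Aq Aq'; apply/eqP; rewrite -subr_eq0; apply/eqP/AP; last first.
    by rewrite -scaleN1r addrC; exact: PD.
  have := AD (-1) _ _ Aq Aq'.
  by rewrite scaleN1r opprB addrA subrK.
have lp : linear p.
  move=> a x y; apply: (uniqp (a *: x + y)).
  - exact: (pP _).1.
  - by apply: PD; exact: (pP _).1.
  - exact: (pP _).2.
  - by rewrite opprD addrACA -scalerBr; apply: AD; exact: (pP _).2.
exists (lin_of lp); split=> [x|x xP]; first exact: (pP x).1.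
apply: (uniqp x) => //; [exact: (pP x).1|exact: (pP x).2|by rewrite subrr].
Qed.

Lemma exists_section (U V : lmodType k) (f : {linear U -> V}) :
  exists p : {linear U -> U}, exists s : {linear V -> U},
    (forall x, f (p x) = 0) /\ (forall x, x = p x + s (f x)).
Proof.
have [|p [pK pid]] := @exists_proj U [pred x | f x == 0].
  by split=> [|a x y]; rewrite !inE ?linear0 // linearP => /eqP -> /eqP ->;
     rewrite scaler0 addr0.
have [|q [qI qid]] := @exists_proj V [pred y | `[< exists x, f x = y >]].
  split=> [|a _ _ /asboolP[u <-] /asboolP[v <-]]; apply/asboolP.
    by exists 0; rewrite linear0.
  by exists (a *: u + v); rewrite linearP.
have /choice[t tq] : forall y, exists x, f x = q y.
  by move=> y; exact/asboolP/(qI y).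
have sE x x' : f x = f x' -> x - p x = x' - p x'.
  move=> fx; have : p (x - x') = x - x'.
    by apply: pid; rewrite inE linearB fx subrr.
  rewrite linearB => /eqP; rewrite subr_eq => /eqP ->.
  by rewrite opprD opprB addrA subrKC.
have ls : linear (fun y => t y - p (t y)).
  move=> a y y'; rewrite (sE (t (a *: y + y')) (a *: t y + t y')).
    by rewrite (linearP p) scalerBr opprD addrACA.
  by rewrite tq (linearP q) (linearP f) !tq.
exists p, (lin_of ls); split=> [x|x]; first by have := pK x; rewrite inE => /eqP.
rewrite lin_ofE (sE _ x) ?subrKC // tq qid //.
by apply/asboolP; exists x.
Qed.

End TensorLemmas.

Section Modules.
Variables (k : fieldType) (G : alg_group k).
Implicit Types L M N : gmodule G.

Lemma ghom_id_coact M x :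
  coact M ((idfun : {linear M -> M}) x) = tmap idfun idfun (coact M x).
Proof. by rewrite tmap_id. Qed.
Definition ghom_id M : ghom M M := GHom (@ghom_id_coact M).

Lemma ghom_comp_coact L M N (g : ghom M N) (f : ghom L M) x :
  coact N ((g \o f : {linear L -> N}) x) =
  tmap (g \o f : {linear L -> N}) idfun (coact L x).
Proof. by rewrite [LHS]ghom_coact ghom_coact tmap_comp; apply: tmap_ext. Qed.
Definition ghom_comp L M N (g : ghom M N) (f : ghom L M) : ghom L N :=
  GHom (ghom_comp_coact g f).

Lemma ghom_add_coact M N (f g : ghom M N) x :
  coact N ((f \+ g : {linear M -> N}) x) =
  tmap (f \+ g : {linear M -> N}) idfun (coact M x).
Proof.
rewrite (@tmapD _ _ _ _ _ _ f g) // -!ghom_coact.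
exact: (linearD (coact N)).
Qed.
Definition ghom_add M N (f g : ghom M N) : ghom M N :=
  GHom (ghom_add_coact f g).

Lemma ghom_zero_coact M N x :
  coact N ((\0 : {linear M -> N}) x) =
  tmap (\0 : {linear M -> N}) idfun (coact M x).
Proof. by rewrite tmap0 // [LHS](linear0 (coact N)). Qed.
Definition ghom_zero M N : ghom M N := GHom (@ghom_zero_coact M N).

Definition giso M N : Prop :=
  exists (f : ghom M N) (g : ghom N M), cancel f g /\ cancel g f.

Definition is_zero M : Prop := forall x : M, x = 0.

Section Zero.
Let Z : lmodType k := 'rV[k]_0.
Let c : {linear Z -> tens Z (coord G)} := \0.
Lemma gzero_coactA x :
  tassoc _ _ _ (tmap c idfun (c x)) = tmap idfun (comul G) (c x).
Proof. by rewrite [c x]/(0 : tens _ _) !linear0. Qed.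
Lemma gzero_coact1 x : tlift (fun m a => counit G a *: m) (c x) = x.
Proof. by rewrite [LHS](thinmx0) [RHS](thinmx0). Qed.
Definition gzero : gmodule G := GModule gzero_coactA gzero_coact1.
End Zero.

(** A G-submodule of M is a subspace P such that the coaction maps P into
    (the image of) P (x) k[G]. *)
Record submod M := SubMod {
  sub_pred :> {pred M};
  sub_closed : submod_closed sub_pred;
  sub_stable : forall x, x \in sub_pred ->
    exists2 s : seq (M * coord G),
      (forall p, p \in s -> p.1 \in sub_pred) &
      coact M x = \sum_(p <- s) pure p.1 p.2 }.

HB.instance Definition _ M (P : submod M) :=
  GRing.isSubmodClosed.Build k M (sub_pred P) (sub_closed P).

Section Sub.
Variables (M : gmodule G) (P : submod M).

Record sub_sort : Type := SubSort { sub_val : M; _ : sub_val \in sub_pred P }.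
HB.instance Definition _ := [isSub for sub_val].
HB.instance Definition _ := [Choice of sub_sort by <:].
HB.instance Definition _ := [SubChoice_isSubLmodule of sub_sort by <:].

Definition sub_lmod : lmodType k := sub_sort.

Lemma sub_val_linear : linear (sub_val : sub_lmod -> M).
Proof. by move=> a x y; exact: (linearP (\val : sub_sort -> M)). Qed.
Definition sub_incl_lin : {linear sub_lmod -> M} := lin_of sub_val_linear.

Lemma sub_retr_exists :
  exists r : {linear M -> sub_lmod}, cancel sub_val r.
Proof.
have [p [pP pid]] := exists_proj (sub_closed P).
have lr : linear (fun x => SubSort (pP x)).
  move=> a x y; apply: val_inj.
  have := sub_val_linear a (SubSort (pP x)) (SubSort (pP y)).
  by move=> /= ->; exact: linearP.
by exists (lin_of lr) => x; apply: val_inj => /=; exact/pid/(valP x).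
Qed.
Definition sub_retr : {linear M -> sub_lmod} := sval (cid sub_retr_exists).
Lemma sub_retrK : cancel sub_val sub_retr.
Proof. exact: (svalP (cid sub_retr_exists)). Qed.

(** The coaction of P is the restriction of that of M; it is characterised by
    [sub_coactE] and in particular does not depend on the chosen linear
    retraction of M onto P. *)
Definition sub_coact : {linear sub_lmod -> tens sub_lmod (coord G)} :=
  tmap sub_retr idfun \o coact M \o sub_incl_lin.

Lemma sub_coactE x :
  tmap sub_incl_lin idfun (sub_coact x) = coact M (sub_val x).
Proof.
have -> : sub_coact x = tmap sub_retr idfun (coact M (sub_val x)) by [].
rewrite tmap_comp.
have [s sP ->] := sub_stable (valP x).
rewrite linear_sum; apply: eq_big_seq => p /sP pP; rewrite tmap_pure /=.
by congr pure; rewrite -[p.1]/(sub_val (SubSort pP)) sub_retrK.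
Qed.

Lemma sub_tens_inj (W : lmodType k) :
  injective (tmap sub_incl_lin (@idfun W)).
Proof. exact: can_inj (tmap_can (f := sub_incl_lin) sub_retrK). Qed.

Lemma sub_coactA x : tassoc _ _ _ (tmap sub_coact idfun (sub_coact x)) =
  tmap idfun (comul G) (sub_coact x).
Proof.
apply: sub_tens_inj.
have -> y : tmap sub_incl_lin idfun (tassoc sub_lmod (coord G) (coord G) y) =
    tassoc _ _ _ (tmap (tmap sub_incl_lin idfun) idfun y).
  rewrite tassoc_nat; apply: tmap_ext => // z /=; by rewrite tmap_id.
rewrite tmap_comp.
rewrite (@tmap_ext _ _ _ _ _ _ (coact M \o sub_incl_lin) _ idfun) //; last first.
  exact: sub_coactE.
rewrite -[tmap _ _ _](@tmap_comp _ _ _ _ _ _ _ (coact M) idfun sub_incl_lin idfun).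
rewrite sub_coactE coactA -sub_coactE !tmap_comp; exact: tmap_ext.
Qed.

Lemma sub_coact1 x : tlift (fun m a => counit G a *: m) (sub_coact x) = x.
Proof.
apply: val_inj; rewrite -[LHS]/(sub_incl_lin _) lin_tlift; last first.
  exact: counit_bilin.
rewrite -[RHS](coact1 (sub_val x)) -sub_coactE.
rewrite [RHS]tlift_tmap; last exact: counit_bilin.
by apply: tlift_ext => m a; rewrite linearZ.
Qed.

Definition sub_gmodule : gmodule G := GModule sub_coactA sub_coact1.

Lemma sub_incl_coact x : coact M (sub_incl_lin x) =
  tmap sub_incl_lin idfun (coact sub_gmodule x).
Proof. by rewrite sub_coactE. Qed.
Definition sub_incl : ghom sub_gmodule M :=
  @GHom k G sub_gmodule M sub_incl_lin sub_incl_coact.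

Section Codom.
Variables (N : gmodule G) (f : ghom N M) (fP : forall x, f x \in sub_pred P).

Lemma sub_codom_linear : linear (fun x => SubSort (fP x) : sub_gmodule).
Proof.
move=> a x y; apply: val_inj.
have := sub_val_linear a (SubSort (fP x)) (SubSort (fP y)).
by move=> /= ->; exact: linearP.
Qed.

Lemma sub_codom_coact x : coact sub_gmodule (lin_of sub_codom_linear x) =
  tmap (lin_of sub_codom_linear) idfun (coact N x).
Proof.
apply: sub_tens_inj; rewrite -[LHS]sub_incl_coact tmap_comp.
rewrite -[LHS]/(coact M (f x)) ghom_coact; exact: tmap_ext.
Qed.
Definition sub_codom : ghom N sub_gmodule := GHom sub_codom_coact.
End Codom.
End Sub.

Definition sub_le_incl M (P Q : submod M)
    (PQ : {subset sub_pred P <= sub_pred Q}) :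
    ghom (sub_gmodule P) (sub_gmodule Q) :=
  sub_codom (f := sub_incl P) (fun x => PQ _ (valP x)).

Section Quotient.
Variables (M : gmodule G) (P : submod M).

Definition quo_rel (x y : M) : bool := x - y \in sub_pred P.
Lemma quo_refl : reflexive quo_rel.
Proof. by move=> x; rewrite /quo_rel subrr rpred0. Qed.
Lemma quo_sym : symmetric quo_rel.
Proof. by move=> x y; rewrite /quo_rel -opprB rpredN. Qed.
Lemma quo_trans : transitive quo_rel.
Proof.
by move=> y x z xy yz; rewrite /quo_rel -(subrK y x) -addrA; exact: rpredD.
Qed.
Canonical quo_equiv := EquivRel quo_rel quo_refl quo_sym quo_trans.

Definition quo_sort : Type := {eq_quot quo_equiv}.
HB.instance Definition _ := Choice.on quo_sort.
HB.instance Definition _ := EqQuotient.on quo_sort.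

Definition quo_pi (x : M) : quo_sort := \pi_quo_sort x.

Lemma quo_piP x y : quo_pi x = quo_pi y <-> x - y \in sub_pred P.
Proof.
have [e1 e2] : quo_pi x = quo_pi y <-> quo_rel x y.
  by rewrite /quo_pi; split=> [/eqmodP|/eqmodP].
by split.
Qed.

Lemma quo_pi_repr (x : quo_sort) : quo_pi (repr x) = x.
Proof. exact: reprK. Qed.

Lemma repr_quo_pi (x : M) : repr (quo_pi x) - x \in sub_pred P.
Proof. by apply/quo_piP; rewrite quo_pi_repr. Qed.

Definition quo_add (x y : quo_sort) : quo_sort := quo_pi (repr x + repr y).
Definition quo_opp (x : quo_sort) : quo_sort := quo_pi (- repr x).
Definition quo_scale (a : k) (x : quo_sort) : quo_sort := quo_pi (a *: repr x).

Lemma quo_addE x y : quo_add (quo_pi x) (quo_pi y) = quo_pi (x + y).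
Proof.
by apply/quo_piP; rewrite opprD addrACA; apply: rpredD; exact: repr_quo_pi.
Qed.
Lemma quo_oppE x : quo_opp (quo_pi x) = quo_pi (- x).
Proof. by apply/quo_piP; rewrite -opprD rpredN; exact: repr_quo_pi. Qed.
Lemma quo_scaleE a x : quo_scale a (quo_pi x) = quo_pi (a *: x).
Proof. by apply/quo_piP; rewrite -scalerBr rpredZ //; exact: repr_quo_pi. Qed.

Definition quoE := (quo_addE, quo_oppE, quo_scaleE).

Lemma quo_addA : associative quo_add.
Proof.
move=> x y z; rewrite -[x]quo_pi_repr -[y]quo_pi_repr -[z]quo_pi_repr.
by rewrite !quoE addrA.
Qed.
Lemma quo_addC : commutative quo_add.
Proof. by move=> x y; rewrite /quo_add addrC. Qed.
Lemma quo_add0 : left_id (quo_pi 0) quo_add.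
Proof. by move=> x; rewrite -[x]quo_pi_repr quoE add0r. Qed.
Lemma quo_addN : left_inverse (quo_pi 0) quo_opp quo_add.
Proof. by move=> x; rewrite -[x]quo_pi_repr !quoE addNr. Qed.
HB.instance Definition _ :=
  GRing.isZmodule.Build quo_sort quo_addA quo_addC quo_add0 quo_addN.

Lemma quo_scaleA a b x : quo_scale a (quo_scale b x) = quo_scale (a * b) x.
Proof. by rewrite -[x]quo_pi_repr !quoE scalerA. Qed.
Lemma quo_scale1 : left_id 1 quo_scale.
Proof. by move=> x; rewrite -[x]quo_pi_repr !quoE scale1r. Qed.
Lemma quo_scaleDr : right_distributive quo_scale +%R.
Proof.
move=> a x y; rewrite -[x]quo_pi_repr -[y]quo_pi_repr.
by rewrite -![(_ + _ : quo_sort)]/(quo_add _ _) !quoE scalerDr.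
Qed.
Lemma quo_scaleDl x : {morph quo_scale^~ x : a b / a + b}.
Proof.
move=> a b; rewrite -[x]quo_pi_repr.
by rewrite -![(_ + _ : quo_sort)]/(quo_add _ _) !quoE scalerDl.
Qed.
HB.instance Definition _ := GRing.Zmodule_isLmodule.Build k quo_sort
  quo_scaleA quo_scale1 quo_scaleDr quo_scaleDl.

Definition quo_lmod : lmodType k := quo_sort.

Lemma quo_pi_linear : linear (quo_pi : M -> quo_lmod).
Proof.
move=> a x y.
by rewrite -[RHS]/(quo_add (quo_scale a (quo_pi x)) (quo_pi y)) !quoE.
Qed.
Definition quo_pi_lin : {linear M -> quo_lmod} := lin_of quo_pi_linear.

Lemma quo_pi0 x : quo_pi x = 0 <-> x \in sub_pred P.
Proof. by rewrite -[0]/(quo_pi 0) quo_piP subr0. Qed.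

Definition quo_coact_fun (x : quo_lmod) : tens quo_lmod (coord G) :=
  tmap quo_pi_lin idfun (coact M (repr x)).

Lemma quo_coact_funE x :
  quo_coact_fun (quo_pi x) = tmap quo_pi_lin idfun (coact M x).
Proof.
apply/eqP; rewrite -subr_eq0 -!linearB; apply/eqP.
have [s sP ->] := sub_stable (repr_quo_pi x).
rewrite linear_sum big_seq big1 // => p /sP pP; rewrite tmap_pure /=.
have -> : quo_pi_lin p.1 = 0 by exact/quo_pi0.
by rewrite -(scale0r 0) (bilinZl _ _ _ (pure_bilin _ _)) scale0r.
Qed.

Lemma quo_coact_linear : linear quo_coact_fun.
Proof.
move=> a x y; rewrite -[x]quo_pi_repr -[y]quo_pi_repr -quo_pi_linear.
by rewrite !quo_coact_funE !linearP.
Qed.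
Definition quo_coact := lin_of quo_coact_linear.

Lemma quo_coactE x : quo_coact (quo_pi x) = tmap quo_pi_lin idfun (coact M x).
Proof. exact: quo_coact_funE. Qed.

Lemma quo_coactA x : tassoc _ _ _ (tmap quo_coact idfun (quo_coact x)) =
  tmap idfun (comul G) (quo_coact x).
Proof.
rewrite -[x]quo_pi_repr quo_coactE tmap_comp.
rewrite (@tmap_ext _ _ _ _ _ _ (tmap quo_pi_lin idfun \o coact M) _ idfun) //;
  last exact: quo_coactE.
rewrite -[tmap _ _ _](@tmap_comp _ _ _ _ _ _ _
  (tmap quo_pi_lin idfun) idfun (coact M) idfun).
rewrite tassoc_nat coactA !tmap_comp; apply: tmap_ext => // a /=.
by rewrite tmap_id.
Qed.

Lemma quo_coact1 x : tlift (fun m a => counit G a *: m) (quo_coact x) = x.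
Proof.
rewrite -[x]quo_pi_repr quo_coactE tlift_tmap; last first.
  exact: counit_bilin.
rewrite -[in RHS](coact1 (repr x)) -[RHS]/(quo_pi_lin _) lin_tlift; last first.
  exact: counit_bilin.
by apply: tlift_ext => m a; rewrite linearZ.
Qed.

Definition quo_gmodule : gmodule G := GModule quo_coactA quo_coact1.

Lemma quo_proj_coact x : coact quo_gmodule (quo_pi_lin x) =
  tmap quo_pi_lin idfun (coact M x).
Proof. exact: quo_coactE. Qed.
Definition quo_proj : ghom M quo_gmodule := 
  @GHom k G M quo_gmodule quo_pi_lin quo_proj_coact.
End Quotient.

Section KerIm.
Variables (M N : gmodule G) (f : ghom M N).

Lemma ker_closed : submod_closed [pred x | f x == 0].
Proof.
split=> [|a x y]; rewrite !inE ?linear0 // linearP => /eqP -> /eqP ->.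
by rewrite scaler0 addr0.
Qed.

Lemma ker_stable x : f x = 0 -> exists2 s : seq (M * coord G),
  (forall p, p \in s -> f p.1 = 0) & coact M x = \sum_(p <- s) pure p.1 p.2.
Proof.
move=> fx; have [p [s [fp ps]]] := exists_section f.
have [t tE] := tensP (coact M x).
exists [seq (p q.1, q.2) | q <- t].
  by move=> _ /mapP[q _ ->]; exact: fp.
rewrite big_map -[LHS]tmap_id.
rewrite (@tmapD _ _ _ _ _ idfun p (s \o f)) //.
rewrite -[X in _ + X](@tmap_comp _ _ _ _ _ _ _ s idfun f idfun).
rewrite -ghom_coact fx !linear0 addr0 tE linear_sum.
by apply: eq_bigr => q _; rewrite tmap_pure.
Qed.

Lemma ker_sub_stable x : x \in [pred x | f x == 0] ->
  exists2 s : seq (M * coord G),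
    (forall p, p \in s -> p.1 \in [pred x | f x == 0]) &
    coact M x = \sum_(p <- s) pure p.1 p.2.
Proof.
rewrite inE => /eqP /ker_stable[s sP ->].
by exists s => // p /sP ps; rewrite inE ps.
Qed.
Definition gker : submod M := SubMod ker_closed ker_sub_stable.

Definition im_pred : {pred N} := fun y => `[< exists x, f x = y >].

Lemma im_predP y : y \in im_pred <-> exists x, f x = y.
Proof. by split=> [/asboolP|/asboolP]. Qed.

Lemma im_closed : submod_closed im_pred.
Proof.
split=> [|a _ _ /im_predP[x <-] /im_predP[y <-]]; apply/im_predP.
  by exists 0; rewrite linear0.
by exists (a *: x + y); rewrite linearP.
Qed.

Lemma im_stable y : y \in im_pred -> exists2 s : seq (N * coord G),
  (forall p, p \in s -> p.1 \in im_pred) &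
  coact N y = \sum_(p <- s) pure p.1 p.2.
Proof.
move=> /im_predP[x <-]; have [t tE] := tensP (coact M x).
exists [seq (f q.1, q.2) | q <- t].
  by move=> _ /mapP[q _ ->]; apply/im_predP; exists q.1.
rewrite ghom_coact tE linear_sum big_map.
by apply: eq_bigr => q _; rewrite tmap_pure.
Qed.
Definition gim : submod N := SubMod im_closed im_stable.

Lemma gim_in x : f x \in sub_pred gim.
Proof. by apply/im_predP; exists x. Qed.

Definition gim_map : ghom M (sub_gmodule gim) := sub_codom gim_in.

Variable Q : submod N.

Lemma preim_closed : submod_closed [pred x | f x \in sub_pred Q].
Proof.
split=> [|a x y]; rewrite !inE ?linear0 ?rpred0 // linearP => xQ yQ.
by rewrite rpredD // rpredZ.
Qed.
End KerIm.

Lemma preim_stable M N (f : ghom M N) (Q : submod N) x :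
  x \in [pred x | f x \in sub_pred Q] ->
  exists2 s : seq (M * coord G),
    (forall p, p \in s -> p.1 \in [pred x | f x \in sub_pred Q]) &
    coact M x = \sum_(p <- s) pure p.1 p.2.
Proof.
rewrite inE => /quo_pi0 fx.
have [s sP sE] := ker_stable (f := ghom_comp (quo_proj Q) f) fx.
by exists s => // p /sP ?; rewrite inE; exact/quo_pi0.
Qed.
Definition gpreim M N (f : ghom M N) (Q : submod N) : submod M :=
  SubMod (preim_closed f Q) (@preim_stable M N f Q).

(** P / (P :&: Q), so that no inclusion of Q in P is required. *)
Definition subquo M (P Q : submod M) : gmodule G :=
  quo_gmodule (gpreim (sub_incl P) Q).

(** The cohomology Ker g / Im f of L -f-> M -g-> N. *)
Definition gcoh L M N (f : ghom L M) (g : ghom M N) : gmodule G :=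
  subquo (gker g) (gim f).

Definition gcoh_proj L M N (f : ghom L M) (g : ghom M N) :
    ghom (sub_gmodule (gker g)) (gcoh f g) :=
  quo_proj (gpreim (sub_incl (gker g)) (gim f)).

Definition exact_at L M N (f : ghom L M) (g : ghom M N) : Prop :=
  forall y, g y = 0 <-> exists x, f x = y.

End Modules.

Section Restriction.
Variables (k : fieldType) (G : alg_group k) (H : closed_subgroup G).
Variable M : gmodule G.

Definition res_coact : {linear M -> tens M (coord H)} :=
  tmap idfun (csg_res H) \o coact M.

Lemma res_coactE x : res_coact x = tmap idfun (csg_res H) (coact M x).
Proof. by []. Qed.

Lemma res_coactA x : tassoc _ _ _ (tmap res_coact idfun (res_coact x)) =
  tmap idfun (comul H) (res_coact x).
Proof.
rewrite res_coactE !tmap_comp.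
rewrite -[RHS](@tmap_ext _ _ _ _ _ idfun _
  (tmap (csg_res H) (csg_res H) \o comul G)) //; last first.
  by move=> a; exact/esym/csg_comul.
rewrite -[RHS](@tmap_comp _ _ _ _ _ _ _ idfun _ idfun (comul G)) -coactA.
rewrite -tassoc_nat tmap_comp; congr (tassoc _ _ _ _); exact: tmap_ext.
Qed.

Lemma res_coact1 x : tlift (fun m a => counit H a *: m) (res_coact x) = x.
Proof.
rewrite res_coactE tlift_tmap; last exact: counit_bilin.
rewrite -[RHS]coact1; apply: tlift_ext => m a /=.
by rewrite csg_counit.
Qed.

Definition res_gmodule : gmodule H := GModule res_coactA res_coact1.

End Restriction.

Section Relative.
Variables (k : fieldType) (G : alg_group k) (H : closed_subgroup G).

Definition is_summand (M : gmodule G) (P : submod M) : Prop :=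
  exists C : submod (res_gmodule H M),
    (forall x : M, x \in sub_pred P -> x \in sub_pred C -> x = 0) /\
    (forall x : M, exists y z : M,
       [/\ y \in sub_pred P, z \in sub_pred C & x = y + z]).

(** A sequence of G-modules is (G,H)-exact when [rel_exact_at] holds at each
    of its terms; a bounded sequence is completed by zero maps, so that all its
    terms are covered. *)
Definition rel_exact_at (L M N : gmodule G) (f : ghom L M) (g : ghom M N) :
    Prop :=
  exact_at f g /\ is_summand (gker g).

Definition rel_short_exact (M1 M2 M3 : gmodule G)
    (f : ghom M1 M2) (g : ghom M2 M3) : Prop :=
  [/\ rel_exact_at (ghom_zero (gzero G) M1) f,
      rel_exact_at f g &
      rel_exact_at g (ghom_zero M3 (gzero G))].

Definition rel_injective (I : gmodule G) : Prop :=
  forall (M1 M2 M3 : gmodule G) (d1 : ghom M1 M2) (d2 : ghom M2 M3),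
    rel_short_exact d1 d2 ->
    forall f : ghom M1 I, exists h : ghom M2 I, f = ghom_comp h d1.

Record rel_resolution (M : gmodule G) := RelResolution {
  rr_obj : nat -> gmodule G;
  rr_aug : ghom M (rr_obj 0);
  rr_d : forall n, ghom (rr_obj n) (rr_obj n.+1);
  rr_exact_M : rel_exact_at (ghom_zero (gzero G) M) rr_aug;
  rr_exact0 : rel_exact_at rr_aug (rr_d 0);
  rr_exactS : forall n, rel_exact_at (rr_d n) (rr_d n.+1);
  rr_inj : forall n, rel_injective (rr_obj n) }.

End Relative.

Record add_functor (k : fieldType) (G G' : alg_group k) := AddFunctor {
  fobj :> gmodule G -> gmodule G';
  fmap : forall M N, ghom M N -> ghom (fobj M) (fobj N);
  fmap_id : forall M, fmap (ghom_id M) = ghom_id (fobj M);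
  fmap_comp : forall L M N (g : ghom M N) (f : ghom L M),
    fmap (ghom_comp g f) = ghom_comp (fmap g) (fmap f);
  fmap_add : forall M N (f g : ghom M N),
    fmap (ghom_add f g) = ghom_add (fmap f) (fmap g) }.
Arguments fmap {k G G'} a {M N}.

Definition left_exact (k : fieldType) (G G' : alg_group k)
    (F : add_functor G G') : Prop :=
  forall (M1 M2 M3 : gmodule G) (f : ghom M1 M2) (g : ghom M2 M3),
    exact_at (ghom_zero (gzero G) M1) f -> exact_at f g ->
    exact_at (ghom_zero (gzero G') (F M1)) (fmap F f) /\
    exact_at (fmap F f) (fmap F g).

Section FunctorComp.
Variables (k : fieldType) (G G' G'' : alg_group k).
Variables (F' : add_functor G' G'') (F : add_functor G G').

Let cmap M N (f : ghom M N) : ghom (F' (F M)) (F' (F N)) := fmap F' (fmap F f).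
Lemma comp_fmap_id M : cmap (ghom_id M) = ghom_id _.
Proof. by rewrite /cmap !fmap_id. Qed.
Lemma comp_fmap_comp L M N (g : ghom M N) (f : ghom L M) :
  cmap (ghom_comp g f) = ghom_comp (cmap g) (cmap f).
Proof. by rewrite /cmap !fmap_comp. Qed.
Lemma comp_fmap_add M N (f g : ghom M N) :
  cmap (ghom_add f g) = ghom_add (cmap f) (cmap g).
Proof. by rewrite /cmap !fmap_add. Qed.
Definition functor_comp : add_functor G G'' :=
  AddFunctor comp_fmap_id comp_fmap_comp comp_fmap_add.
End FunctorComp.

Lemma ghom_ext (k : fieldType) (G : alg_group k) (M N : gmodule G)
    (f g : ghom M N) : f =1 g -> f = g.
Proof.
case: f g => [f fP] [g gP] /= /funext fg.
have {}fg : f = g.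
  case: f g fg {fP gP} => [f [[fA] [fB]]] [g [[gA] [gB]]] /= fg.
  by subst g; congr (GRing.Linear.Pack (GRing.Linear.Class _ _));
     congr (_ _); exact: Prop_irrelevance.
by subst g; congr GHom; exact: Prop_irrelevance.
Qed.

Section RightDerived.
Variables (k : fieldType) (G G' : alg_group k).
Variable F : add_functor G G'.

Lemma fmap_zero (M N : gmodule G) (x : F M) : fmap F (ghom_zero M N) x = 0.
Proof.
have /(congr1 (fun f : ghom (F M) (F N) => f x)) :
    fmap F (ghom_zero M N) =
    ghom_add (fmap F (ghom_zero M N)) (fmap F (ghom_zero M N)).
  by rewrite -fmap_add; congr fmap; apply: ghom_ext => y /=; rewrite addr0.
by move/eqP; rewrite /= -subr_eq0 opprD addrA subrr add0r oppr_eq0 => /eqP.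
Qed.

Lemma fmap_im_le_ker (L M N : gmodule G) (f : ghom L M) (g : ghom M N) :
  exact_at f g ->
  {subset sub_pred (gim (fmap F f)) <= sub_pred (gker (fmap F g))}.
Proof.
move=> fg y /im_predP[x <-]; rewrite inE; apply/eqP.
rewrite -[LHS]/(ghom_comp (fmap F g) (fmap F f) x) -fmap_comp.
rewrite (_ : ghom_comp g f = ghom_zero L N) ?fmap_zero //.
by apply: ghom_ext => z /=; apply/fg; exists z.
Qed.

(** The n-th cohomology of 0 -> F I_0 -> F I_1 -> ... *)
Definition functor_coh (I : nat -> gmodule G)
    (d : forall n, ghom (I n) (I n.+1)) (n : nat) : gmodule G' :=
  if n is m.+1 then gcoh (fmap F (d m)) (fmap F (d m.+1))
  else gcoh (ghom_zero (gzero G') (F (I 0))) (fmap F (d 0)).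

(** R^n_(G,H) F (M), computed on a chosen (G,H)-injective resolution of M.
    Such a resolution always exists, so that the second branch of the
    conditional, needed to have a total function, is never taken. *)
Definition Rder (H : closed_subgroup G) (n : nat) (M : gmodule G) :
    gmodule G' :=
  if pselect (exists r : rel_resolution H M, True) is left e
  then functor_coh (rr_d (sval (cid e))) n else gzero G'.

(** Short exactness with respect to H' of
    0 -> Ker (F d_j) -> F M_j -> Im (F d_j) -> 0 and
    0 -> Im (F d_j) -> Ker (F d_(j+1)) -> H^(j+1) (F M) -> 0. *)
Definition is_split (H : closed_subgroup G) (H' : closed_subgroup G') : Prop :=
  forall (M : int -> gmodule G) (d : forall i : int, ghom (M i) (M (i + 1)))
    (E : forall i, rel_exact_at H (d i) (d (i + 1))) (j : int),
    rel_short_exact H' (sub_incl (gker (fmap F (d j)))) (gim_map (fmap F (d j)))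
    /\
    rel_short_exact H' (sub_le_incl (fmap_im_le_ker (proj1 (E j))))
      (gcoh_proj (fmap F (d j)) (fmap F (d (j + 1)))).

End RightDerived.

Definition is_acyclic (k : fieldType) (G G' : alg_group k)
    (H : closed_subgroup G) (F : add_functor G G') (X : gmodule G) : Prop :=
  forall i : nat, (0 < i)%N -> is_zero (Rder F H i X).

(** Cohomological spectral sequences starting at the second page; the data
    [ss_obj r] and [ss_d r] are irrelevant for r < 2.  Every pair of integers
    is of the form (p + r, q - r + 1), so [ss_next] describes the whole page
    r + 1. *)
Record spectral_seq (k : fieldType) (G : alg_group k) := SpectralSeq {
  ss_obj :> nat -> int -> int -> gmodule G;
  ss_d : forall (r : nat) (p q : int),
    ghom (ss_obj r p q) (ss_obj r (p + r%:Z) (q - r%:Z + 1));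
  ss_dd : forall (r : nat) (p q : int), (2 <= r)%N ->
    forall x, ss_d r (p + r%:Z) (q - r%:Z + 1) (ss_d r p q x) = 0;
  ss_next : forall (r : nat) (p q : int), (2 <= r)%N ->
    giso (ss_obj r.+1 (p + r%:Z) (q - r%:Z + 1))
      (gcoh (ss_d r p q) (ss_d r (p + r%:Z) (q - r%:Z + 1))) }.

(** X is the limit term E_oo^{p,q}: from some page on, the differentials
    from and to the position (p,q) vanish, and the term there is X. *)
Definition is_Einfty (k : fieldType) (G : alg_group k) (E : spectral_seq G)
    (p q : int) (X : gmodule G) : Prop :=
  exists2 r0 : nat, (2 <= r0)%N & forall r : nat, (r0 <= r)%N ->
    [/\ forall x, ss_d E r p q x = 0,
        forall p' q' : int, p' + r%:Z = p -> q' - r%:Z + 1 = q ->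
          forall x, ss_d E r p' q' x = 0 &
        giso (E r p q) X].

(** Convergence E_2^{p,q} => A^{p+q} of a first quadrant spectral sequence:
    each A^n has a filtration
    A^n = Fil n 0 >= Fil n 1 >= ... >= Fil n (n + 1) = 0 by G-submodules with
    E_oo^{p,q} = Fil (p + q) p / Fil (p + q) (p + 1). *)
Definition converges (k : fieldType) (G : alg_group k) (E : spectral_seq G)
    (A : nat -> gmodule G) : Prop :=
  (forall p q : int, p < 0 \/ q < 0 -> is_zero (E 2%N p q)) /\
  exists Fil : forall n, nat -> submod (A n),
    [/\ forall n (x : A n), x \in sub_pred (Fil n 0%N),
        forall n p, {subset sub_pred (Fil n p.+1) <= sub_pred (Fil n p)},
        forall n (x : A n), x \in sub_pred (Fil n n.+1) -> x = 0 &
        forall p q : nat, is_Einfty E p%:Z q%:Z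
          (subquo (Fil (p + q)%N p) (Fil (p + q)%N p.+1))].

(* Main.v *)
(** Let X -> QX -> QQX -> ... be the bar resolution of a module X, where Q is
    induction from H to G after restriction to H.  It is functorial, and since
    relatively exact sequences split over H, each functor F'(Q^(p+1) X) is exact
    on them.  Moreover the bar resolution of a relatively injective module is
    contractible, so the double complex F'(Q^(p+1) I_q), with I a relatively
    injective resolution of X, shows that R^p F'(X) is the cohomology of the
    complex F'(Q^(p+1) X).

    Now let I be a resolution of M and consider the double complex with terms
    F'(Q^(p+1) F(I_q)).  The modules F(I_q) are acyclic and F' is left exact, so
    its total cohomology is that of F'(F(I)).  As F is split, Q^(p+1) and F'
    commute with the formation of the cohomology of F(I), so the second page of
    its filtration by p is R^p F'(R^q F(M)).

    The total complex is the direct sum of all the terms of the double complex,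
    as a single module with a doubly indexed family of submodules F p n; the
    page E_r is given by the closed formula Z_r / B_r for subquotients of this
    module, so that no transport along equalities of degrees is needed. *)

From HB Require Import structures.
From mathcomp Require Import all_boot all_order all_algebra.
From mathcomp Require Import boolp zify.
Require Import Defs.

Set Implicit Arguments.
Unset Strict Implicit.
Unset Printing Implicit Defensive.

Import GRing.Theory.
Local Open Scope ring_scope.

(** * Morphisms and submodules *)

Arguments tmap : simpl never.
Arguments tassoc : simpl never.

Section Morphisms.
Variables (k : fieldType) (G : alg_group k).
Implicit Types K L M N : gmodule G.

(** The usual argument needs a Cartan-Eilenberg resolution of F(I): resolutions of its kernels,
    images and cohomology, chosen compatibly. A functorial resolution supplies all of them at once,
    provided that applying F' to its terms is exact on the short sequences linking these modules. F'
    alone is only left exact. The way out is that Q begins with a restriction to H', so it is a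
    functor of H'-linear maps and turns an H'-linear splitting into a G'-linear one, which every
    additive functor preserves. The splitness of F provides exactly these splittings.

    A second obstacle is that [Rder] uses an arbitrarily chosen resolution. For M this is harmless:
    the choice does not depend on the functor, so F and F' o F share it. For F(I_q) and R^q F(M) the
    choice is unrelated to the rest of the construction. It is compared with the bar resolution by
    balancing a double complex, which replaces the uniqueness of resolutions up to homotopy. *)

Lemma tmap_inj (U V W : lmodType k) (f : {linear U -> V}) :
  (forall x, f x = 0 -> x = 0) -> injective (tmap f (@idfun W)).
Proof.
move=> f0; have [p [s [fp ps]]] := exists_section f.
apply: can_inj (tmap_can (f := f) (g := s) _) => x.
by rewrite [RHS]ps (f0 _ (fp x)) add0r.
Qed.

(** A set-theoretic section of [a] is enough, since two choices differ by an element killed by [b].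
    Maps out of subquotients are built this way. *)
Lemma ghom_factor K M N (a : ghom K M) (b : ghom K N) :
  (forall y, exists x, a x = y) -> (forall x, a x = 0 -> b x = 0) ->
  exists c : ghom M N, forall x, c (a x) = b x.
Proof.
move=> /choice[s sK] ab.
have wd x y : a x = a y -> b x = b y.
  by move=> e; apply/eqP; rewrite -subr_eq0 -linearB ab // linearB e subrr.
have lc : linear (fun y => b (s y)).
  by move=> c x y; rewrite -linearP; apply: wd; rewrite linearP !sK.
have cE x : lin_of lc (a x) = b x by rewrite lin_ofE; apply: wd; rewrite sK.
have cc y : coact N (lin_of lc y) = tmap (lin_of lc) idfun (coact M y).
  rewrite -[y]sK cE !ghom_coact tmap_comp.
  by apply: tmap_ext => // x; rewrite /= cE.
by exists (GHom cc).
Qed.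

(** Compatibility with the coactions is tested after tensoring [a] with k[G]; this stays injective
    because [a] has a linear retraction over the field. *)
Lemma ghom_cofactor K M N (a : ghom N M) (b : ghom K M) :
  (forall x, a x = 0 -> x = 0) -> (forall x, exists y, a y = b x) ->
  exists c : ghom K N, forall x, a (c x) = b x.
Proof.
move=> a0 /choice[c cK].
have aI : injective a by exact: raddf_inj a0.
have lc : linear c by move=> d x y; apply: aI; rewrite linearP !cK linearP.
have cc y : coact N (lin_of lc y) = tmap (lin_of lc) idfun (coact K y).
  apply: (tmap_inj a0); rewrite -ghom_coact tmap_comp lin_ofE cK ghom_coact.
  by apply: tmap_ext => // x; rewrite /= lin_ofE cK.
by exists (GHom cc).
Qed.

Lemma giso_bij M N (f : ghom M N) :
  (forall x, f x = 0 -> x = 0) -> (forall y, exists x, f x = y) -> giso M N.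
Proof.
move=> f0 fs; have [g gK] := ghom_factor (b := ghom_id M) fs f0.
by exists f, g; split=> // y; have [x <-] := fs y; rewrite gK.
Qed.

Lemma giso_sym M N : giso M N -> giso N M.
Proof. by move=> [f [g [fK gK]]]; exists g, f. Qed.

Lemma giso_trans L M N : giso L M -> giso M N -> giso L N.
Proof.
move=> [f [g [fK gK]]] [f' [g' [fK' gK']]].
exists (ghom_comp f' f), (ghom_comp g g').
by split=> x /=; rewrite ?fK' ?fK ?gK ?gK'.
Qed.

Lemma giso_zero M N : giso M N -> is_zero M -> is_zero N.
Proof. by move=> [f [g [_ gK]]] M0 x; rewrite -[x]gK (M0 (g x)) linear0. Qed.

Lemma scale_linear M N (a : k) (f : ghom M N) : linear (fun x => a *: f x).
Proof. by move=> b x y; rewrite linearP scalerDr !scalerA mulrC. Qed.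

Lemma scale_coact M N (a : k) (f : ghom M N) x :
  coact N (lin_of (scale_linear a f) x) =
  tmap (lin_of (scale_linear a f)) idfun (coact M x).
Proof.
rewrite lin_ofE linearZ_LR ghom_coact.
move: (coact M x); apply: tens_fun_ext => [b y z|b y z|u v].
- by rewrite linearP scalerDr !scalerA mulrC.
- by rewrite linearP.
by rewrite !tmap_pure lin_ofE -(bilinZl a (f u) _ (pure_bilin N (coord G))).
Qed.

Definition ghom_scale M N (a : k) (f : ghom M N) : ghom M N :=
  GHom (scale_coact a f).

Lemma ghom_scaleE M N a (f : ghom M N) x : ghom_scale a f x = a *: f x.
Proof. exact: lin_ofE. Qed.

Definition ghom_sub M N (f g : ghom M N) : ghom M N :=
  ghom_add f (ghom_scale (-1) g).

Lemma ghom_subE M N (f g : ghom M N) x : ghom_sub f g x = f x - g x.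
Proof. by rewrite -[X in _ - X]scale1r -scaleNr. Qed.

(** * Images, sums and intersections of submodules *)

Section SubmodOps.
Variables M N : gmodule G.
Implicit Types P Q : submod M.

Definition gimsub (f : ghom M N) P : submod N := gim (ghom_comp f (sub_incl P)).

Lemma gimsubP (f : ghom M N) P y :
  y \in sub_pred (gimsub f P) <-> exists2 x, x \in sub_pred P & f x = y.
Proof.
split=> [/im_predP[[x Px] <-]|[x Px <-]]; first by exists x.
by apply/im_predP; exists (SubSort Px).
Qed.

Definition sum_pred P Q : {pred M} :=
  fun x => `[< exists2 y, y \in sub_pred P & x - y \in sub_pred Q >].

Lemma sum_predP P Q x : x \in sum_pred P Q <->
  exists2 y, y \in sub_pred P & x - y \in sub_pred Q.
Proof. by split=> [/asboolP|/asboolP]. Qed.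

Lemma sum_closed P Q : submod_closed (sum_pred P Q).
Proof.
split=> [|a x y /sum_predP[x' Px Qx] /sum_predP[y' Py Qy]]; apply/sum_predP.
  by exists 0; rewrite ?subr0 rpred0.
exists (a *: x' + y'); first by rewrite rpredD // rpredZ.
by rewrite opprD addrACA -scalerBr rpredD // rpredZ.
Qed.

Lemma sum_stable P Q x : x \in sum_pred P Q ->
  exists2 s : seq (M * coord G), (forall p, p \in s -> p.1 \in sum_pred P Q) &
    coact M x = \sum_(p <- s) pure p.1 p.2.
Proof.
move=> /sum_predP[y Py Qy].
have [s sP sE] := sub_stable Py; have [t tQ tE] := sub_stable Qy.
exists (s ++ t).
  move=> p; rewrite mem_cat => /orP[/sP pP|/tQ pQ]; apply/sum_predP.
    by exists p.1; rewrite ?subrr ?rpred0.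
  by exists 0; rewrite ?subr0 ?rpred0.
by rewrite big_cat -sE -tE -[in LHS](subrKC y x) linearD.
Qed.

Definition gsum P Q : submod M := SubMod (@sum_closed P Q) (@sum_stable P Q).

Lemma gsumP P Q x : x \in sub_pred (gsum P Q) <->
  exists2 y, y \in sub_pred P & x - y \in sub_pred Q.
Proof. exact: sum_predP. Qed.

Lemma gkerP (f : ghom M N) x : x \in sub_pred (gker f) <-> f x = 0.
Proof. by rewrite inE; split=> /eqP. Qed.

End SubmodOps.

(** Built from an image and a preimage, so that stability is inherited; a direct proof would have to
    intersect P (x) k[G] with Q (x) k[G]. *)
Definition gcap M (P Q : submod M) : submod M :=
  gimsub (sub_incl P) (gpreim (sub_incl P) Q).

Lemma gcapP M (P Q : submod M) x :
  x \in sub_pred (gcap P Q) <-> x \in sub_pred P /\ x \in sub_pred Q.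
Proof.
split=> [/gimsubP[[y Py] Qy <-]|[Px Qx]]; first by split.
by apply/gimsubP; exists (SubSort Px).
Qed.

Lemma quo_proj_surj M (P : submod M) y : exists x, quo_proj P x = y.
Proof. by exists (repr y); exact: quo_pi_repr. Qed.

Lemma quo_proj0 M (P : submod M) x : quo_proj P x = 0 <-> x \in sub_pred P.
Proof. exact: quo_pi0. Qed.

Definition subquo_proj M (P Q : submod M) : ghom (sub_gmodule P) (subquo P Q) :=
  quo_proj (gpreim (sub_incl P) Q).

Lemma subquo_surj M (P Q : submod M) y : exists x, subquo_proj P Q x = y.
Proof. exact: quo_proj_surj. Qed.

Lemma subquo_proj0 M (P Q : submod M) x :
  subquo_proj P Q x = 0 <-> sub_val x \in sub_pred Q.
Proof. exact: quo_proj0. Qed.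

Lemma subquo_cls0 M (P Q : submod M) x (Px : x \in sub_pred P) :
  subquo_proj P Q (SubSort Px) = 0 <-> x \in sub_pred Q.
Proof. exact: quo_proj0. Qed.

Lemma subquo_clsP M (P Q : submod M) x y (Px : x \in sub_pred P)
    (Py : y \in sub_pred P) :
  subquo_proj P Q (SubSort Px) = subquo_proj P Q (SubSort Py) <->
  x - y \in sub_pred Q.
Proof.
have -> : x - y = sub_incl P (SubSort Px - SubSort Py) by rewrite linearB.
rewrite -[_ \in _]/(sub_val (SubSort Px - SubSort Py) \in sub_pred Q).
have [pq0 q0p] := subquo_proj0 Q (SubSort Px - SubSort Py).
split=> [e|/q0p]; first by apply: pq0; rewrite linearB e subrr.
by rewrite linearB => /eqP; rewrite subr_eq0 => /eqP.
Qed.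

Lemma giso_subquo M N (P Q : submod M) (f : ghom (sub_gmodule P) N) :
  (forall y, exists x, f x = y) ->
  (forall x, f x = 0 <-> sub_val x \in sub_pred Q) -> giso (subquo P Q) N.
Proof.
move=> fs f0; have [|c cE] := ghom_factor (b := f) (@subquo_surj _ P Q).
  by move=> x /subquo_proj0/f0.
apply: (giso_bij (f := c)) => [x|y].
  by have [z <-] := subquo_surj x; rewrite cE => /f0/subquo_proj0.
by have [x <-] := fs y; exists (subquo_proj P Q x).
Qed.

Lemma subquo_is_zero M (P Q : submod M) :
  {subset sub_pred P <= sub_pred Q} -> is_zero (subquo P Q).
Proof.
move=> PQ x; have [[y Py] <-] := subquo_surj x.
by apply/subquo_proj0; exact: PQ.
Qed.

End Morphisms.

(** * Direct sums *)

Section DirectSumModule.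
Variables (k : fieldType) (I : eqType) (X : I -> lmodType k).

(** Finite support matters: the coactions of infinitely many modules need not combine to a coaction
    on their product. *)
Record dsum := DSum {
  dsum_fun :> forall i, X i;
  dsum_fin : exists s : seq I, forall i, i \notin s -> dsum_fun i = 0 }.

HB.instance Definition _ := gen_eqMixin dsum.
HB.instance Definition _ := gen_choiceMixin dsum.

Lemma dsum_ext (x y : dsum) : (forall i, x i = y i) -> x = y.
Proof.
case: x y => [x xf] [y yf] /= xy.
have {}xy : x = y by exact: functional_extensionality_dep.
by subst y; congr DSum; exact: Prop_irrelevance.
Qed.

Lemma dsum0_fin : exists s : seq I, forall i, i \notin s -> (0 : X i) = 0.
Proof. by exists [::]. Qed.
Definition dsum0 : dsum := DSum dsum0_fin.

Lemma dsum_add_fin (x y : dsum) :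
  exists s : seq I, forall i, i \notin s -> x i + y i = 0.
Proof.
have [s sP] := dsum_fin x; have [t tP] := dsum_fin y.
exists (s ++ t) => i; rewrite mem_cat negb_or => /andP[/sP -> /tP ->].
exact: addr0.
Qed.
Definition dsum_add (x y : dsum) : dsum := DSum (dsum_add_fin x y).

Lemma dsum_scale_fin (a : k) (x : dsum) :
  exists s : seq I, forall i, i \notin s -> a *: x i = 0.
Proof.
have [s sP] := dsum_fin x.
by exists s => i /sP ->; exact: scaler0.
Qed.
Definition dsum_scale (a : k) (x : dsum) : dsum := DSum (dsum_scale_fin a x).

Lemma dsum_addA : associative dsum_add.
Proof. by move=> x y z; apply: dsum_ext => i; exact: addrA. Qed.
Lemma dsum_addC : commutative dsum_add.
Proof. by move=> x y; apply: dsum_ext => i; exact: addrC. Qed.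
Lemma dsum_add0 : left_id dsum0 dsum_add.
Proof. by move=> x; apply: dsum_ext => i; exact: add0r. Qed.
Lemma dsum_addN : left_inverse dsum0 (dsum_scale (-1)) dsum_add.
Proof.
by move=> x; apply: dsum_ext => i /=; rewrite scaleN1r addNr.
Qed.
HB.instance Definition _ :=
  GRing.isZmodule.Build dsum dsum_addA dsum_addC dsum_add0 dsum_addN.

Lemma dsum_scaleA a b x : dsum_scale a (dsum_scale b x) = dsum_scale (a * b) x.
Proof. by apply: dsum_ext => i; exact: scalerA. Qed.
Lemma dsum_scale1 : left_id 1 dsum_scale.
Proof. by move=> x; apply: dsum_ext => i; exact: scale1r. Qed.
Lemma dsum_scaleDr : right_distributive dsum_scale +%R.
Proof. by move=> a x y; apply: dsum_ext => i; exact: scalerDr. Qed.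
Lemma dsum_scaleDl x : {morph dsum_scale^~ x : a b / a + b}.
Proof. by move=> a b; apply: dsum_ext => i; exact: scalerDl. Qed.
HB.instance Definition _ := GRing.Zmodule_isLmodule.Build k dsum
  dsum_scaleA dsum_scale1 dsum_scaleDr dsum_scaleDl.

Lemma dsum_comp_linear i : linear (fun x : dsum => x i).
Proof. by []. Qed.
Definition dsum_comp i : {linear dsum -> X i} := lin_of (dsum_comp_linear i).

Lemma dsum_inj_fin i (x : X i) : exists s : seq I,
  forall j, j \notin s -> dfwith (fun i => 0 : X i) x j = 0.
Proof.
exists [:: i] => j; rewrite inE eq_sym => ij; exact: dfwith_out.
Qed.

Lemma dsum_inj_linear i : linear (fun x : X i => DSum (dsum_inj_fin x)).
Proof.
move=> a x y; apply: dsum_ext => j /=.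
rewrite -[RHS]/(a *: dfwith _ x j + dfwith _ y j).
have [<-|ij] := eqVneq i j; first by rewrite !dfwith_in.
by rewrite !dfwith_out // scaler0 addr0.
Qed.
Definition dsum_inj i : {linear X i -> dsum} := lin_of (@dsum_inj_linear i).

Lemma dsum_inj_in i (x : X i) : dsum_inj i x i = x.
Proof. exact: dfwith_in. Qed.

Lemma dsum_inj_out i j (x : X i) : i != j -> dsum_inj i x j = 0.
Proof. exact: dfwith_out. Qed.

Lemma dsum_comp_sum (J : Type) (s : seq J) (F : J -> dsum) i :
  (\sum_(j <- s) F j) i = \sum_(j <- s) F j i.
Proof. exact: (linear_sum (dsum_comp i)). Qed.

Lemma dsum_supp (x : dsum) :
  exists2 s : seq I, uniq s & forall i, i \notin s -> x i = 0.
Proof.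
have [s sP] := dsum_fin x.
by exists (undup s); rewrite ?undup_uniq // => i; rewrite mem_undup; exact: sP.
Qed.

Lemma dsum_decomp (x : dsum) s : uniq s -> (forall i, i \notin s -> x i = 0) ->
  x = \sum_(i <- s) dsum_inj i (x i).
Proof.
move=> us sP; apply: dsum_ext => j; rewrite dsum_comp_sum.
have [js|js] := boolP (j \in s).
  rewrite (bigD1_seq j) // big1 => [|i ij]; last by rewrite dsum_inj_out.
  exact: esym (etrans (addr0 _) (dsum_inj_in _)).
rewrite sP // big_seq big1 // => i is_; rewrite dsum_inj_out //.
by apply: contraNneq js => <-.
Qed.

Lemma dsum_fun_ext (W : lmodType k) (f g : dsum -> W) : linear f -> linear g ->
  (forall i x, f (dsum_inj i x) = g (dsum_inj i x)) -> forall x, f x = g x.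
Proof.
move=> lf lg fg x; have [s us sP] := dsum_supp x.
rewrite (dsum_decomp us sP) -[LHS]/(lin_of lf _) -[RHS]/(lin_of lg _).
by rewrite !linear_sum; apply: eq_bigr => i _; exact: fg.
Qed.

Section Lift.
Variables (W : lmodType k) (f : forall i, {linear X i -> W}).

Lemma dsum_lift_exists :
  exists g : {linear dsum -> W}, forall i x, g (dsum_inj i x) = f i x.
Proof.
have /choice[S SP] : forall x : dsum, exists s : seq I,
    uniq s /\ forall i, i \notin s -> x i = 0.
  by move=> x; have [s us sP] := dsum_supp x; exists s.
pose g x := \sum_(i <- S x) f i (x i).
have gE (x : dsum) s : uniq s -> (forall i, i \notin s -> x i = 0) ->
    g x = \sum_(i <- s) f i (x i).
  move=> us sP; have [uS SxP] := SP x.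
  (* Two supports of [x] agree once the indices with [x i = 0] are dropped. So [g] does not depend
     on the choice [S], and additivity can be checked on a common support. *)
  have red t : \sum_(i <- t) f i (x i) =
      \sum_(i <- [seq i <- t | x i != 0]) f i (x i).
    rewrite big_filter [RHS]big_mkcond; apply: eq_bigr => i _.
    by case: eqP => // ->; rewrite linear0.
  rewrite /g red [RHS]red; apply/perm_big/uniq_perm; rewrite ?filter_uniq //.
  move=> i; rewrite !mem_filter; have [//|/= xi] := eqVneq (x i) 0.
  apply/idP/idP => _; apply: contraNT xi; first by move=> /sP ->.
  by move=> /SxP ->.
have lg : linear g.
  move=> a x y.
  have [sx uxs sxP] := dsum_supp x; have [sy usy syP] := dsum_supp y.
  pose s := undup (sx ++ sy).
  have us : uniq s by exact: undup_uniq.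
  have xP i : i \notin s -> x i = 0.
    by rewrite mem_undup mem_cat negb_or => /andP[/sxP].
  have yP i : i \notin s -> y i = 0.
    by rewrite mem_undup mem_cat negb_or => /andP[_ /syP].
  rewrite (gE _ s) // ?(gE x s) ?(gE y s) // => [|i si].
    by rewrite scaler_sumr -big_split; apply: eq_bigr => i _ /=; exact: linearP.
  by rewrite -[LHS]/(a *: x i + y i) xP // yP // scaler0 addr0.
exists (lin_of lg) => i x; rewrite lin_ofE (gE _ [:: i]) //.
  by rewrite big_seq1 dsum_inj_in.
by move=> j; rewrite inE eq_sym => ij; rewrite dsum_inj_out.
Qed.

Definition dsum_lift : {linear dsum -> W} := sval (cid dsum_lift_exists).

Lemma dsum_lift_inj i x : dsum_lift (dsum_inj i x) = f i x.
Proof. exact: (svalP (cid dsum_lift_exists)). Qed.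
End Lift.

End DirectSumModule.

Section DirectSum.
Variables (k : fieldType) (G : alg_group k) (I : eqType) (X : I -> gmodule G).

Let T : lmodType k := dsum (fun i => gm_sort (X i)).
Let inj i : {linear X i -> T} := dsum_inj (fun i => gm_sort (X i)) i.

Definition dsum_coact : {linear T -> tens T (coord G)} :=
  dsum_lift (fun i => tmap (inj i) idfun \o coact (X i)).

Lemma dsum_coact_inj i (x : X i) :
  dsum_coact (inj i x) = tmap (inj i) idfun (coact (X i) x).
Proof. exact: dsum_lift_inj. Qed.

Lemma dsum_coactA x : tassoc _ _ _ (tmap dsum_coact idfun (dsum_coact x)) =
  tmap idfun (comul G) (dsum_coact x).
Proof.
move: x; apply: dsum_fun_ext => [a y z|a y z|i x]; rewrite ?linearP //.
rewrite dsum_coact_inj tmap_comp.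
rewrite (@tmap_ext _ _ _ _ _ _ (tmap (inj i) idfun \o coact (X i)) _ idfun) //;
  last exact: dsum_coact_inj.
rewrite -[tmap _ _ _](@tmap_comp _ _ _ _ _ _ _
  (tmap (inj i) idfun) idfun (coact (X i)) idfun).
rewrite tassoc_nat coactA !tmap_comp; apply: tmap_ext => // c /=.
by rewrite tmap_id.
Qed.

Lemma dsum_coact1 x : tlift (fun m a => counit G a *: m) (dsum_coact x) = x.
Proof.
move: x; apply: dsum_fun_ext => [a y z|//|i x].
  by rewrite linearP (tlift_linear (counit_bilin G T)).
rewrite dsum_coact_inj tlift_tmap; last exact: counit_bilin.
rewrite -[in RHS](coact1 x) lin_tlift; last exact: counit_bilin.
by apply: tlift_ext => m a; rewrite linearZ.
Qed.

Definition gdsum : gmodule G := GModule dsum_coactA dsum_coact1.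

Definition gdsum_inj i : ghom (X i) gdsum :=
  @GHom _ _ (X i) gdsum (inj i) (@dsum_coact_inj i).

Lemma dsum_ghom_coact (N : gmodule G) (f : {linear T -> N}) :
  (forall i (x : X i), coact N (f (inj i x)) =
     tmap (f \o inj i) idfun (coact (X i) x)) ->
  forall x : gdsum, coact N (f x) = tmap f idfun (coact gdsum x).
Proof.
move=> fi; apply: dsum_fun_ext => [a y z|a y z|i x]; rewrite ?linearP //.
rewrite fi -[coact gdsum]/dsum_coact dsum_coact_inj tmap_comp.
exact: tmap_ext.
Qed.

Lemma gdsum_proj_coact i (x : gdsum) :
  coact (X i) (dsum_comp _ i x) = tmap (dsum_comp _ i) idfun (coact gdsum x).
Proof.
apply: dsum_ghom_coact x => j x; have [ij|ij] := eqVneq j i.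
  subst j; rewrite -[dsum_comp _ i _]/(inj i x i) dsum_inj_in -[LHS]tmap_id.
  by apply: tmap_ext => // y /=; rewrite -[RHS]/(inj i y i) dsum_inj_in.
rewrite -[dsum_comp _ i _]/(inj j x i) dsum_inj_out // linear0 tmap0 // => y /=.
by rewrite -[LHS]/(inj j y i) dsum_inj_out.
Qed.

Definition gdsum_proj i : ghom gdsum (X i) := GHom (@gdsum_proj_coact i).

Lemma gdsum_ext (x y : gdsum) :
  (forall i, gdsum_proj i x = gdsum_proj i y) -> x = y.
Proof. exact: dsum_ext. Qed.

Lemma gdsum_proj_in i (x : X i) : gdsum_proj i (gdsum_inj i x) = x.
Proof. exact: (dsum_inj_in x). Qed.

Lemma gdsum_proj_out i j (x : X i) :
  i != j -> gdsum_proj j (gdsum_inj i x) = 0.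
Proof. exact: (dsum_inj_out x). Qed.

Lemma gdsum_fun_ext (W : lmodType k) (f g : gdsum -> W) :
  linear f -> linear g ->
  (forall i x, f (gdsum_inj i x) = g (gdsum_inj i x)) -> forall x, f x = g x.
Proof. exact: dsum_fun_ext. Qed.

Lemma gdsum_lift_coact (N : gmodule G) (f : forall i, ghom (X i) N) (x : gdsum) :
  coact N (dsum_lift f x) = tmap (dsum_lift f) idfun (coact gdsum x).
Proof.
apply: dsum_ghom_coact x => i x; rewrite dsum_lift_inj ghom_coact.
by apply: tmap_ext => // y /=; rewrite dsum_lift_inj.
Qed.

Definition gdsum_lift (N : gmodule G) (f : forall i, ghom (X i) N) : ghom gdsum N :=
  GHom (gdsum_lift_coact f).

Lemma gdsum_lift_inj (N : gmodule G) (f : forall i, ghom (X i) N) i x :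
  gdsum_lift f (gdsum_inj i x) = f i x.
Proof. exact: dsum_lift_inj. Qed.

Lemma gdsum_truncate (S : pred I) : exists f : ghom gdsum gdsum,
  forall x i, gdsum_proj i (f x) = if S i then gdsum_proj i x else 0.
Proof.
exists (gdsum_lift (fun i => if S i then gdsum_inj i else ghom_zero _ _)) => x i.
move: x; apply: gdsum_fun_ext => [a y z|a y z|j x].
- by rewrite !linearP.
- by case: (S i); rewrite ?linearP // scaler0 addr0.
rewrite gdsum_lift_inj; have [<-|ji] := eqVneq j i.
  by case: (S j) => //; rewrite linear0.
by rewrite [in RHS]gdsum_proj_out // if_same; case: (S j);
   rewrite ?linear0 ?gdsum_proj_out.
Qed.

(** Taken as the kernel of the truncation to the complement of [S], a G-endomorphism, so that
    stability under the coaction comes from [gker]. *)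
Definition gdsum_supp (S : pred I) : submod gdsum :=
  gker (sval (cid (gdsum_truncate (predC S)))).

Lemma gdsum_suppP (S : pred I) x : x \in sub_pred (gdsum_supp S) <->
  forall i, ~~ S i -> gdsum_proj i x = 0.
Proof.
rewrite /gdsum_supp; move: (sval _) (svalP (cid (gdsum_truncate (predC S)))).
move=> f fE.
split=> [/gkerP fx i Si|Sx]; first by have := fE x i; rewrite fx linear0 /= Si.
by apply/gkerP/gdsum_ext => i; rewrite fE linear0 /=; case: ifP => // /Sx.
Qed.

End DirectSum.

(** * Induced modules *)

Section Reassociation.
Variable k : fieldType.
Implicit Types U V W : lmodType k.

Definition pureL U V (u : U) : {linear V -> tens U V} :=
  lin_of ((pure_bilin U V).2 u).

Lemma pureLE U V (u : U) (v : V) : pureL V u v = pure u v.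
Proof. exact: lin_ofE. Qed.

Lemma tassocV_bilin U V W :
  bilin (fun (u : U) (y : tens V W) => tmap (pureL V u) (@idfun W) y).
Proof.
split=> [y a u u'|u a y y']; last by rewrite linearP.
move: y; apply: tens_fun_ext => [b y z|b y z|v w].
- by rewrite linearP.
- by rewrite !linearP /= !scalerA mulrC addrACA.
rewrite !tmap_pure !pureLE (pure_bilin U V).1; exact: (pure_bilin _ W).1.
Qed.

Definition tassocV U V W : {linear tens U (tens V W) -> tens (tens U V) W} :=
  tliftL (@tassocV_bilin U V W).

Lemma tassocV_pure U V W (u : U) (y : tens V W) :
  tassocV U V W (pure u y) = tmap (pureL V u) idfun y.
Proof. by rewrite /tassocV tliftLE tlift_pure //; exact: tassocV_bilin. Qed.

Lemma tassocK U V W : cancel (tassoc U V W) (tassocV U V W).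
Proof.
apply: tens3_fun_ext => [a y z|//|u v w]; first by rewrite !linearP.
by rewrite tassoc_pure tassocV_pure tmap_pure pureLE.
Qed.

End Reassociation.

(** * Cofree comodules *)

Section Cofree.
Variables (k : fieldType) (G : alg_group k).
Implicit Types (U V : lmodType k) (M N : gmodule G).

Definition teps U : {linear tens U (coord G) -> U} := tliftL (counit_bilin G U).

Lemma teps_pure U (u : U) c : teps U (pure u c) = counit G c *: u.
Proof. by rewrite /teps tliftLE tlift_pure //; exact: counit_bilin. Qed.

Lemma teps_coact M x : teps M (coact M x) = x.
Proof. exact: coact1. Qed.

Lemma teps_tmap U V (f : {linear U -> V}) z :
  teps V (tmap f idfun z) = f (teps U z).
Proof.
move: z; apply: tens_fun_ext => [a y z|a y z|u c]; rewrite ?linearP //.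
by rewrite tmap_pure !teps_pure linearZ.
Qed.

Definition cofree_coact U :
    {linear tens U (coord G) -> tens (tens U (coord G)) (coord G)} :=
  tassocV U (coord G) (coord G) \o tmap idfun (comul G).

Lemma cofree_coactE U z :
  cofree_coact U z = tassocV U _ _ (tmap idfun (comul G) z).
Proof. by []. Qed.

Lemma cofree_coact_pure U (u : U) c :
  cofree_coact U (pure u c) = tmap (pureL (coord G) u) idfun (comul G c).
Proof. by rewrite cofree_coactE tmap_pure tassocV_pure. Qed.

Lemma cofree_coactA U x :
  tassoc _ _ _ (tmap (cofree_coact U) idfun (cofree_coact U x)) =
  tmap idfun (comul G) (cofree_coact U x).
Proof.
move: x; apply: tens_fun_ext => [a y z|a y z|u c]; rewrite ?linearP //.
rewrite cofree_coact_pure tmap_comp.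
rewrite (@tmap_ext _ _ _ _ _ _
  (tmap (pureL (coord G) u) idfun \o comul G) _ idfun) //; last first.
  by move=> d; rewrite /= pureLE; exact: cofree_coact_pure.
rewrite -[tmap _ _ _](@tmap_comp _ _ _ _ _ _ _
  (tmap (pureL (coord G) u) idfun) idfun (comul G) idfun).
rewrite tassoc_nat comulA !tmap_comp; apply: tmap_ext => // d /=.
by rewrite tmap_id.
Qed.

Lemma cofree_coact1 U x :
  tlift (fun m a => counit G a *: m) (cofree_coact U x) = x.
Proof.
rewrite -[LHS]/(teps _ _).
move: x; apply: tens_fun_ext => [a y z|//|u c]; first by rewrite !linearP.
rewrite cofree_coact_pure teps_tmap pureLE; congr pure; exact: mul_counit.
Qed.

(** The module induced from the trivial subgroup: k[G] coacts on itself and [U] is a multiplicity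
    space. *)
Definition cofree U : gmodule G :=
  GModule (@cofree_coactA U) (@cofree_coact1 U).

Lemma cofree_map_coact U V (f : {linear U -> V}) (z : cofree U) :
  coact (cofree V) (tmap f idfun z) =
  tmap (tmap f idfun) idfun (coact (cofree U) z).
Proof.
rewrite -[coact _]/(cofree_coact V) -[coact _]/(cofree_coact U).
move: z; apply: tens_fun_ext => [a y z|a y z|u c]; rewrite ?linearP //.
rewrite tmap_pure !cofree_coact_pure tmap_comp; apply: tmap_ext => // d.
by rewrite -[RHS]/(tmap f idfun (pureL _ u d)) !pureLE tmap_pure.
Qed.

Definition cofree_map U V (f : {linear U -> V}) :
    ghom (cofree U) (cofree V) := GHom (cofree_map_coact f).

Lemma coact_ghom_coact M (x : M) :
  coact (cofree M) (coact M x) = tmap (coact M) idfun (coact M x).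
Proof.
rewrite -[LHS]/(tassocV _ _ _ (tmap idfun (comul G) (coact M x))).
by rewrite -coactA tassocK.
Qed.

Definition coact_ghom M : ghom M (cofree M) :=
  @GHom _ _ M (cofree M) (coact M) (@coact_ghom_coact M).

Lemma counit_lbilin : bilin (fun x y : coord G => counit G x *: y).
Proof.
split=> [y a x x'|x a y y']; first by rewrite linearP scalerDl scalerA.
by rewrite scalerDr !scalerA mulrC.
Qed.

(** This is the left counit axiom: an element is recovered from its coaction by evaluation at the
    identity. Hence a map into an induced module is determined by its evaluation. *)
Lemma tmap_teps U z : tmap (teps U) idfun (cofree_coact U z) = z.
Proof.
move: z; apply: tens_fun_ext => [a y z|//|u c]; first by rewrite !linearP.
rewrite cofree_coact_pure tmap_comp -[in RHS](counit_mul c) -pureLE.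
rewrite -[RHS]/(pureL (coord G) u (tliftL counit_lbilin (comul G c))).
move: (comul G c); apply: tens_fun_ext => [a y z|a y z|d e].
- by rewrite linearP.
- by rewrite !linearP.
rewrite tmap_pure /= pureLE teps_pure tliftLE tlift_pure; last exact: counit_lbilin.
by rewrite linearZ_LR pureLE (bilinZl _ _ _ (pure_bilin _ _)).
Qed.
End Cofree.

Section ResHom.
Variables (k : fieldType) (G : alg_group k) (H : closed_subgroup G).

Lemma res_coact_ghom (M N : gmodule G) (f : ghom M N) x :
  coact (res_gmodule H N) (f x) = tmap f idfun (coact (res_gmodule H M) x).
Proof.
rewrite -[coact (res_gmodule H N)]/(res_coact H N).
rewrite -[coact (res_gmodule H M)]/(res_coact H M).
by rewrite !res_coactE ghom_coact !tmap_comp; apply: tmap_ext.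
Qed.

Definition res_ghom (M N : gmodule G) (f : ghom M N) :
    ghom (res_gmodule H M) (res_gmodule H N) :=
  @GHom _ _ (res_gmodule H M) (res_gmodule H N) f (res_coact_ghom f).

End ResHom.

(** * Induction as a cotensor product, and Frobenius reciprocity *)

Section Induction.
Variables (k : fieldType) (G : alg_group k) (H : closed_subgroup G).
Implicit Types (V W : gmodule H) (M N : gmodule G).

(** The cotensor product of V and k[G] over k[H], that is, the module induced
    from V: the sums of v (x) a with
    sum v_0 (x) v_1 (x) a = sum v (x) a_1|_H (x) a_2. *)
Definition ind_eq V : ghom (cofree G V) (cofree G (tens V (coord H))) :=
  ghom_sub (cofree_map G (coact V))
    (ghom_comp (cofree_map G (tmap idfun (csg_res H))) (coact_ghom (cofree G V))).

Lemma ind_eqP V (z : cofree G V) : z \in sub_pred (gker (ind_eq V)) <->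
  tmap (coact V) idfun z =
  tmap (tmap idfun (csg_res H)) idfun (cofree_coact G V z).
Proof.
split=> [/gkerP|e]; last apply/gkerP; rewrite ghom_subE.
  by move/eqP; rewrite subr_eq0 => /eqP.
by apply/eqP; rewrite subr_eq0; apply/eqP.
Qed.

Definition ind V : gmodule G := sub_gmodule (gker (ind_eq V)).

Definition ind_eps_lin V : {linear res_gmodule H (ind V) -> V} :=
  teps G V \o sub_incl (gker (ind_eq V)).

(** The equation defining the induced module says just this. Apply the counit to its last factor:
    the left side becomes the coaction of the value of [z], the right side the restriction of [z] to
    H, which [tmap_teps] rewrites through the coaction of [z]. *)
Lemma ind_eps_coact V (z : res_gmodule H (ind V)) : coact V (ind_eps_lin V z) =
  tmap (ind_eps_lin V) idfun (coact (res_gmodule H (ind V)) z).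
Proof.
rewrite -[coact (res_gmodule H _)]/(res_coact H (ind V)) res_coactE tmap_comp.
have /ind_eqP zP := valP z.
transitivity (tmap idfun (csg_res H) (sub_val z)).
  rewrite -[LHS]teps_tmap zP teps_tmap; congr (tmap _ _ _).
  exact: (teps_coact (M := cofree G V)).
transitivity (tmap (teps G V) (csg_res H)
    (tmap (sub_incl (gker (ind_eq V))) idfun (coact (ind V) z))).
  rewrite -sub_incl_coact -[in LHS](tmap_teps (sub_val z)) tmap_comp.
  exact: tmap_ext.
by rewrite tmap_comp; exact: tmap_ext.
Qed.

Definition ind_eps V : ghom (res_gmodule H (ind V)) V := GHom (@ind_eps_coact V).

Lemma ind_hat_in M V (f : ghom (res_gmodule H M) V) (x : M) :
  ghom_comp (cofree_map G f) (coact_ghom M) x \in sub_pred (gker (ind_eq V)).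
Proof.
apply/ind_eqP; rewrite -[ghom_comp _ _ x]/(tmap f idfun (coact M x)).
(* Both sides are f (x) res (x) id applied to the twofold coaction of [x]: one by the H-linearity of
   [f], the other by coassociativity. *)
transitivity (tmap (tmap f (csg_res H)) idfun (tmap (coact M) idfun (coact M x))).
  rewrite !tmap_comp; apply: tmap_ext => // y.
  rewrite -[LHS]/(coact V (f y)) ghom_coact.
  rewrite -[coact (res_gmodule H _)]/(res_coact H M) res_coactE tmap_comp.
  exact: tmap_ext.
rewrite -coact_ghom_coact -[cofree_coact G V _]/(coact (cofree G V) _).
rewrite cofree_map_coact tmap_comp; apply: tmap_ext => // y.
rewrite -[RHS]/(tmap idfun (csg_res H) (tmap f idfun y)) tmap_comp.
exact: tmap_ext.
Qed.

(** Frobenius reciprocity: [ind_hat] is the inverse of composition with the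
    evaluation [ind_eps]. *)
Definition ind_hat M V (f : ghom (res_gmodule H M) V) : ghom M (ind V) :=
  sub_codom (ind_hat_in f).

Lemma ind_eps_hat M V (f : ghom (res_gmodule H M) V) x :
  ind_eps V (ind_hat f x) = f x.
Proof.
rewrite -[LHS]/(teps G V (tmap f idfun (coact M x))) teps_tmap.
by rewrite (teps_coact (x : M)).
Qed.

(** The uniqueness half of Frobenius reciprocity. It reduces identities between G-maps into induced
    modules to identities between H-maps. *)
Lemma ind_ext M V (f g : ghom M (ind V)) :
  (forall x, ind_eps V (f x) = ind_eps V (g x)) -> f =1 g.
Proof.
have key (h : ghom M (ind V)) x : sub_val (h x) =
    tmap (ind_eps V \o res_ghom H h) idfun (coact M x).
  rewrite -[LHS]tmap_teps -[cofree_coact G V _]/(coact (cofree G V) _).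
  rewrite -[sub_val _]/(ghom_comp (sub_incl (gker (ind_eq V))) h x).
  by rewrite ghom_coact tmap_comp; apply: tmap_ext.
move=> fg x; apply: val_inj; rewrite [LHS]key [RHS]key.
by apply: tmap_ext => // y; exact: fg.
Qed.

Definition ind_map V W (f : ghom V W) : ghom (ind V) (ind W) :=
  ind_hat (ghom_comp f (ind_eps V)).

Lemma ind_eps_map V W (f : ghom V W) x :
  ind_eps W (ind_map f x) = f (ind_eps V x).
Proof. exact: ind_eps_hat. Qed.

End Induction.

(** * Relative splittings and the bar resolution *)

Section RelativeSplitting.
Variables (k : fieldType) (G : alg_group k) (H : closed_subgroup G).
Implicit Types L M N : gmodule G.

Local Notation res := (res_gmodule H).

(** One degree of an H-linear contracting homotopy. Unlike relative exactness this is an equation,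
    so it passes through additive functors of H-modules. *)
Definition hsplit L M N (f : ghom L M) (g : ghom M N) : Prop :=
  exists (s : ghom (res M) (res L)) (t : ghom (res N) (res M)),
    forall x : M, f (s x) + t (g x) = x.

Lemma hsplit_rel_exact L M N (f : ghom L M) (g : ghom M N) :
  (forall x, g (f x) = 0) -> hsplit f g -> rel_exact_at H f g.
Proof.
move=> gf [s [t st]]; split.
  move=> y; split=> [gy|[x <-]]; last exact: gf.
  by exists (s y); have := st y; rewrite gy linear0 addr0.
(* [e] is an H-linear idempotent with image Ker g, so its kernel is the required complement. *)
pose e : ghom (res M) (res M) := ghom_comp (res_ghom H f) s.
exists (gker e); split=> [x /gkerP gx /gkerP ex|x].
  by rewrite -[x]st gx linear0 addr0.
exists (f (s x)), (t (g x)); split=> //; first exact/gkerP/gf.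
apply/gkerP; have -> : t (g x) = x - f (s x).
  by apply/esym/eqP; rewrite subr_eq addrC st.
rewrite -[LHS]/(f (s (x - f (s x)))).
have := st (f (s x)); rewrite gf linear0 addr0 => fsfs.
have : s (x - f (s x)) = s x - s (f (s x)) by exact: (linearB s).
by move=> ->; rewrite linearB fsfs subrr.
Qed.

Lemma summand_projection M (P : submod M) : is_summand H P ->
  exists (C : submod (res M)) (e : ghom (res M) (res M)),
    [/\ forall x : M, e x \in sub_pred P, forall x : M, x - e x \in sub_pred C,
        forall x : M, x \in sub_pred P -> e x = x &
        forall x : M, x \in sub_pred P -> x \in sub_pred C -> x = 0].
Proof.
move=> [C [PC dec]]; exists C.
have CB (x y : res M) :
    x \in sub_pred C -> y \in sub_pred C -> x - y \in sub_pred C.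
  exact: rpredB.
have CL a (x y : res M) : x \in sub_pred C -> y \in sub_pred C ->
    a *: x + y \in sub_pred C.
  by move=> Cx Cy; rewrite rpredD // rpredZ.
have C0 : (0 : res M) \in sub_pred C by exact: rpred0.
have /choice[e eP] : forall x : M, exists y : M,
    y \in sub_pred P /\ x - y \in sub_pred C.
  move=> x; have [y [z [Py Cz ->]]] := dec x.
  by exists y; rewrite addrC addKr.
have uniq_e (x y : M) : y \in sub_pred P -> x - y \in sub_pred C -> e x = y.
  move=> Py Cy; have [Pe Ce] := eP x; apply/eqP; rewrite -subr_eq0; apply/eqP.
  apply: PC; first exact: rpredB.
  by have := CB _ _ Cy Ce; rewrite opprB addrC addrA subrK.
have le : linear e.
  move=> a x y; have [[Px Cx] [Py Cy]] := (eP x, eP y).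
  apply: uniq_e; first by rewrite rpredD // rpredZ.
  rewrite opprD addrACA -scalerBr.
  exact: CL.
have eid (x : M) : x \in sub_pred P -> e x = x.
  by move=> Px; apply: uniq_e => //; rewrite subrr; exact: C0.
have e0 (x : M) : x \in sub_pred C -> e x = 0.
  by move=> Cx; apply: uniq_e; rewrite ?rpred0 // subr0.
pose el : {linear res M -> res M} := lin_of le.
(* H-linearity of the projection is checked on the two summands: each is stable under the coaction
   of H, and [e] is the identity on one and zero on the other. *)
have onP (x : M) : x \in sub_pred P ->
    tmap el idfun (coact (res M) x) = coact (res M) x.
  move=> /sub_stable[s sP sE].
  have -> : coact (res M) x = \sum_(p <- s) pure p.1 (csg_res H p.2).
    rewrite -[LHS]/(tmap idfun (csg_res H) (coact M x)) sE linear_sum.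
    by apply: eq_bigr => p _; rewrite tmap_pure.
  rewrite [LHS]linear_sum; apply: eq_big_seq => p /sP pP.
  by rewrite tmap_pure; congr pure; exact: eid.
have onC (x : M) : x \in sub_pred C -> tmap el idfun (coact (res M) x) = 0.
  move=> /sub_stable[s sP ->]; rewrite linear_sum big_seq big1 // => p /sP pC.
  rewrite tmap_pure; have -> : el p.1 = 0 by exact: e0.
  by rewrite -(scale0r 0) (bilinZl _ _ _ (pure_bilin _ _)) scale0r.
have ec x : coact (res M) (el x) = tmap el idfun (coact (res M) x).
  have [Px Cx] := eP x.
  have xE : x = (e x : M) + (x - e x) by rewrite subrKC.
  rewrite [in RHS]xE.
  have -> : coact (res M) ((e x : M) + (x - e x)) =
     coact (res M) (e x) + coact (res M) (x - e x).
    exact: (linearD (coact (res M))).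
  by rewrite [RHS]linearD onP // onC // addr0.
by exists (GHom ec); split=> // x; case: (eP x).
Qed.

(** [s] inverts [f] on a complement of Ker f after projection to Ker g, and [t] inverts [g] on a
    complement of Ker g after projection to the image [P] of [g]. In a longer exact sequence [P] is
    the kernel of the next map. *)
Lemma exact_hsplit L M N (f : ghom L M) (g : ghom M N) (P : submod N) :
  exact_at f g -> is_summand H (gker f) -> is_summand H (gker g) ->
  is_summand H P -> (forall y, y \in sub_pred P <-> exists x, g x = y) ->
  hsplit f g.
Proof.
move=> fg /summand_projection[C0 [e0 [e0P e0C _ e00]]].
move=> /summand_projection[C1 [e1 [e1P e1C _ e10]]].
move=> /summand_projection[C2 [e2 [e2P _ e2id _]]] gP.
have [||s sE] := @ghom_cofactor _ _ (res M) (res M) (sub_gmodule C0)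
    (ghom_comp (res_ghom H f) (sub_incl C0)) e1.
- by move=> [x Cx] /gkerP fx; apply: val_inj; exact: e00.
- move=> x; have /gkerP/fg[y yE] := e1P x.
  exists (SubSort (e0C y)); rewrite -[LHS]/(f (y - e0 y)) linearB.
  by have /gkerP -> := e0P y; rewrite subr0.
have [||t tE] := @ghom_cofactor _ _ (res N) (res N) (sub_gmodule C1)
    (ghom_comp (res_ghom H g) (sub_incl C1)) e2.
- by move=> [x Cx] /gkerP gx; apply: val_inj; exact: e10.
- move=> x; have /gP[y yE] := e2P x.
  exists (SubSort (e1C y)); rewrite -[LHS]/(g (y - e1 y)) linearB.
  by have /gkerP -> := e1P y; rewrite subr0.
exists (ghom_comp (sub_incl C0) s), (ghom_comp (sub_incl C1) t) => x.
have -> : f (ghom_comp (sub_incl C0) s x) = e1 x by exact: sE.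
have gt y : g (ghom_comp (sub_incl C1) t y) = e2 y by exact: tE.
set tx := ghom_comp _ _ _; apply/eqP; rewrite -subr_eq0; apply/eqP.
have CB (y z : res M) : y \in sub_pred C1 -> z \in sub_pred C1 ->
    y - z \in sub_pred C1 by exact: rpredB.
(* The difference of the two sides is killed by [g] and lies in the complement [C1] of Ker g. *)
apply: e10.
  apply/gkerP; rewrite !linearB linearD /= /tx gt e2id; last by apply/gP; exists x.
  by have /gkerP -> := e1P x; rewrite add0r subrr.
have -> : e1 x + tx - x = tx - (x - e1 x) :> M by rewrite opprB addrCA addrA.
by apply: CB; [exact: valP|exact: e1C].
Qed.

Lemma summand_all M (P : submod M) :
  (forall x, x \in sub_pred P) -> is_summand H P.
Proof.
move=> PT; exists (gker (ghom_id (res M))); split=> [x _ /gkerP //|x].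
exists x, 0; split; rewrite ?addr0 //; apply/gkerP; exact: linear0.
Qed.

Lemma rel_short_exact_splitting L M N (f : ghom L M) (g : ghom M N) :
  rel_short_exact H f g ->
  exists (r : ghom (res M) (res L)) (s : ghom (res N) (res M)),
    [/\ forall x, r (f x) = x, forall x, g (s x) = x &
        forall x : M, f (r x) + s (g x) = x].
Proof.
move=> [[ex1 k1] [ex2 k2] [ex3 k3]].
have g_surj y : exists x, g x = y.
  exact/(ex3 y).
have [||r [s rs]] := exact_hsplit ex2 k1 k2 (P := gker (ghom_zero N (gzero G))).
- by apply: summand_all => x; exact/gkerP.
- by move=> y; split=> // _; exact/gkerP.
have f0 x : f x = 0 -> x = 0.
  by move=> /ex1[y <-].
have gf x : g (f x) = 0 by apply/ex2; exists x.
exists r, s; split=> // [x|y].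
  apply/eqP; rewrite -subr_eq0; apply/eqP/f0; rewrite linearB.
  have := rs (f x); rewrite gf linear0 addr0 => ->; exact: subrr.
have [x <-] := g_surj y; have /(congr1 g) := rs x.
by rewrite linearD gf add0r.
Qed.

Lemma splitting_rel_short_exact L M N (f : ghom L M) (g : ghom M N)
    (r : ghom (res M) (res L)) (s : ghom (res N) (res M)) :
  (forall x, g (f x) = 0) -> (forall x, r (f x) = x) ->
  (forall x, g (s x) = x) -> (forall x : M, f (r x) + s (g x) = x) ->
  rel_short_exact H f g.
Proof.
move=> gf rf gs fs; split; apply: hsplit_rel_exact => //.
- by move=> x; exact: linear0.
- by exists (ghom_zero _ _), r => x; rewrite rf [LHS]add0r.
- by exists r, s.
- by exists s, (ghom_zero _ _) => x; rewrite gs [LHS]addr0.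
Qed.

End RelativeSplitting.

(** * The bar resolution and its contractions *)

Section BarResolution.
Variables (k : fieldType) (G : alg_group k) (H : closed_subgroup G).
Implicit Types L M N : gmodule G.

Local Notation res := (res_gmodule H).

Fixpoint bar (n : nat) (M : gmodule G) : gmodule G :=
  if n is n'.+1 then ind (res (bar n' M)) else M.

Definition bar_eta M : ghom M (ind (res M)) := ind_hat (ghom_id (res M)).
Definition bar_eps M : ghom (res (ind (res M))) (res M) := ind_eps (res M).

(** [bar_d 0] is the augmentation. *)
Fixpoint bar_d (n : nat) (M : gmodule G) : ghom (bar n M) (bar n.+1 M) :=
  if n is n'.+1 then
    ghom_sub (bar_eta (bar n'.+1 M)) (ind_map (res_ghom H (bar_d n' M)))
  else bar_eta M.

(** The argument is only H-linear: the innermost step restricts to H, so every positive power of Q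
    is functorial in H-maps. Hence the index shift: [bar_map n] acts on [bar n.+1]. *)
Fixpoint bar_map (n : nat) M N (f : ghom (res M) (res N)) :
    ghom (bar n.+1 M) (bar n.+1 N) :=
  if n is n'.+1 then ind_map (res_ghom H (bar_map n' f)) else ind_map f.

Lemma bar_eps_eta M x : bar_eps M (bar_eta M x) = x.
Proof. exact: ind_eps_hat. Qed.

Lemma bar_eta_nat M N (f : ghom M N) x :
  bar_eta N (f x) = ind_map (res_ghom H f) (bar_eta M x).
Proof.
apply: (ind_ext (f := ghom_comp (bar_eta N) f)
  (g := ghom_comp (ind_map (res_ghom H f)) (bar_eta M))) => {}x.
rewrite -[LHS]/(bar_eps _ (bar_eta N (f x))) bar_eps_eta [RHS]ind_eps_map.
by rewrite -[RHS]/(f (bar_eps _ (bar_eta M x))) bar_eps_eta.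
Qed.

Lemma ind_map_comp (U V W : gmodule H) (f : ghom U V) (g : ghom V W)
    (h : ghom U W) : (forall x, g (f x) = h x) ->
  forall x, ind_map g (ind_map f x) = ind_map h x.
Proof.
move=> gf; apply: (ind_ext (f := ghom_comp (ind_map g) (ind_map f))) => x.
by rewrite [RHS]ind_eps_map -gf -2!ind_eps_map.
Qed.

Lemma ind_map_homotopy (U V W : gmodule H) (f : ghom U V) (s : ghom V U)
    (g : ghom V W) (t : ghom W V) : (forall x, f (s x) + t (g x) = x) ->
  forall x, ind_map f (ind_map s x) + ind_map t (ind_map g x) = x.
Proof.
move=> st; apply: (ind_ext
  (f := ghom_add (ghom_comp (ind_map f) (ind_map s))
                 (ghom_comp (ind_map t) (ind_map g)))
  (g := ghom_id _)) => x.
transitivity (ind_eps V (ind_map f (ind_map s x)) +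
  ind_eps V (ind_map t (ind_map g x))); first exact: linearD.
by rewrite !ind_eps_map st.
Qed.

Lemma ind_map_zero (U V : gmodule H) (f : ghom U V) : (forall x, f x = 0) ->
  forall x, ind_map f x = 0.
Proof.
move=> f0; apply: (ind_ext (g := ghom_zero _ _)) => x.
by rewrite ind_eps_map f0 linear0.
Qed.

Lemma ind_map_id (V : gmodule H) (f : ghom V V) : (forall x, f x = x) ->
  forall x, ind_map f x = x.
Proof.
move=> fid; apply: (ind_ext (g := ghom_id _)) => x.
by rewrite ind_eps_map fid.
Qed.

(** Here [f] has to be G-linear, since the innermost term of the differential is built from the unit
    of [M], which is natural for G-maps. *)
Lemma bar_d_nat n M N (f : ghom M N) x :
  bar_d n.+1 N (bar_map n (res_ghom H f) x) =
  bar_map n.+1 (res_ghom H f) (bar_d n.+1 M x).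
Proof.
elim: n x => [|n IHn] x; rewrite -[bar_d _.+1 N]/(ghom_sub _ _)
    -[bar_d _.+1 M]/(ghom_sub _ _) !ghom_subE [RHS]linearB bar_eta_nat;
  congr (_ - _).
  pose h := res_ghom H (ghom_comp (bar_eta N) f).
  rewrite -[LHS]/(ind_map (res_ghom H (bar_eta N)) (ind_map (res_ghom H f) x)).
  rewrite (ind_map_comp (h := h)) //; apply/esym/ind_map_comp => y.
  exact/esym/bar_eta_nat.
pose h := res_ghom H (ghom_comp (bar_d n.+1 N) (bar_map n (res_ghom H f))).
rewrite [LHS](ind_map_comp (h := h)) //; apply/esym/ind_map_comp => y.
exact/esym/IHn.
Qed.

(** Unrolled, the recursion d_(n+1) = eta - Q(d_n) is the usual alternating sum. By naturality of
    eta the composite d_(n+2) d_(n+1) collapses to Q(d_(n+1) d_n), which is zero by induction. *)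
Lemma bar_dd n M x : bar_d n.+1 M (bar_d n M x) = 0.
Proof.
elim: n x => [|n IHn] x.
  by rewrite -[bar_d 1 M]/(ghom_sub _ _) ghom_subE bar_eta_nat subrr.
rewrite -[bar_d n.+2 M]/(ghom_sub _ _) ghom_subE bar_eta_nat -linearB.
rewrite -[bar_d n.+1 M x]/(ghom_sub _ _ x) ghom_subE opprB subrKC.
rewrite (ind_map_comp (h := ghom_zero _ _)); first exact: ind_map_zero.
exact: IHn.
Qed.

Lemma bar_eps_d0 M x : bar_eps M (bar_d 0 M x) = x.
Proof. exact: bar_eps_eta. Qed.

(** Evaluation is the extra codegeneracy of the bar construction. It is only H-linear, so it
    contracts the resolution over H and not over G. *)
Lemma bar_eps_homotopy n M (x : bar n.+1 M) :
  bar_d n M (bar_eps (bar n M) x) + bar_eps (bar n.+1 M) (bar_d n.+1 M x) = x.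
Proof.
rewrite -[bar_d n.+1 M]/(ghom_sub _ _) ghom_subE.
have -> : bar_eps (bar n.+1 M)
    (bar_eta (bar n.+1 M) x - ind_map (res_ghom H (bar_d n M)) x) =
  bar_eps (bar n.+1 M) (bar_eta (bar n.+1 M) x) -
  bar_eps (bar n.+1 M) (ind_map (res_ghom H (bar_d n M)) x).
  exact: (linearB (bar_eps (bar n.+1 M))).
rewrite bar_eps_eta; have -> : bar_eps (bar n.+1 M)
  (ind_map (res_ghom H (bar_d n M)) x) = bar_d n M (bar_eps (bar n M) x).
  exact: ind_eps_map.
exact: subrKC.
Qed.

Lemma bar_d_split n M : hsplit H (bar_d n M) (bar_d n.+1 M).
Proof.
exists (bar_eps (bar n M)), (bar_eps (bar n.+1 M)); exact: bar_eps_homotopy.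
Qed.

Lemma bar_aug_split M : hsplit H (ghom_zero (gzero G) M) (bar_d 0 M).
Proof.
exists (ghom_zero _ _), (bar_eps M) => x.
by rewrite bar_eps_d0 [LHS]add0r.
Qed.

(** Frobenius reciprocity turns the extension problem into one over H, where [d1] has a
    retraction. *)
Lemma ind_injective (V : gmodule H) : rel_injective H (ind V).
Proof.
move=> M1 M2 M3 d1 d2 /rel_short_exact_splitting[r [_ [rd1 _ _]]] f.
exists (ind_hat (ghom_comp (ghom_comp (ind_eps V) (res_ghom H f)) r)).
apply: ghom_ext; apply: ind_ext => x.
rewrite -[ghom_comp _ d1 x]/(ind_hat _ (d1 x)) ind_eps_hat.
by rewrite -[RHS]/(ind_eps V (f (r (d1 x)))) rd1.
Qed.

Lemma bar_aug_exact M : rel_exact_at H (ghom_zero (gzero G) M) (bar_d 0 M).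
Proof.
by apply: hsplit_rel_exact (bar_aug_split M) => x; exact: linear0.
Qed.

Lemma bar_exact n M : rel_exact_at H (bar_d n M) (bar_d n.+1 M).
Proof. exact: hsplit_rel_exact (@bar_dd n M) (bar_d_split n M). Qed.

Definition bar_resolution M : rel_resolution H M :=
  @RelResolution _ _ H M (fun n => bar n.+1 M) (bar_d 0 M)
    (fun n => bar_d n.+1 M)
    (bar_aug_exact M) (bar_exact 0 M) (fun n => bar_exact n.+1 M)
    (fun n => @ind_injective (res (bar n M))).

Lemma injective_retraction M : rel_injective H M ->
  exists r : ghom (ind (res M)) M, forall x, r (bar_eta M x) = x.
Proof.
(* The image of [bar_d 1 M] serves as the cokernel of [bar_eta M]; evaluation restricted to it is
   the H-section. *)
move=> injM; pose g := gim_map (bar_d 1 M).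
have [|r rE] := injM _ _ _ (bar_eta M) g _ (ghom_id M).
  have gd (y : sub_gmodule (gim (bar_d 1 M))) :
      exists2 x, bar_d 1 M x = sub_val y & g x = y.
    case: y => y yI; have /im_predP[x xE] := yI.
    by exists x => //; apply: val_inj.
  pose s := ghom_comp (bar_eps (bar 1 M)) (res_ghom H (sub_incl (gim (bar_d 1 M)))).
  apply: (splitting_rel_short_exact (r := bar_eps M) (s := s)).
  - by move=> x; apply: val_inj; exact: (@bar_dd 0 M x).
  - exact: bar_eps_eta.
  - move=> y; have [x xy _] := gd y; apply: val_inj.
    have e0 : bar_eps (bar 2 M) 0 = 0 by exact: linear0.
    have := @bar_eps_homotopy 1 M (bar_d 1 M x).
    by rewrite (@bar_dd 1 M x) e0 addr0 xy.
  - exact: (@bar_eps_homotopy 0 M).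
by exists r => x; rewrite -[LHS]/(ghom_comp r (bar_eta M) x) -rE.
Qed.

Lemma bar_injective_contraction M : rel_injective H M ->
  exists h : forall n, ghom (bar n.+1 M) (bar n M),
    (forall x, h 0%N (bar_d 0 M x) = x) /\
    forall n (x : bar n.+1 M), bar_d n M (h n x) + h n.+1 (bar_d n.+1 M x) = x.
Proof.
move=> /injective_retraction[r rE].
(* The sign matches the minus sign in the recursion for [bar_d]: the terms with [bar_eta] cancel by
   naturality, and what remains is Q of the homotopy identity one degree lower. *)
pose h := fix h n : ghom (bar n.+1 M) (bar n M) :=
  if n is n'.+1 then ghom_scale (-1) (ind_map (res_ghom H (h n'))) else r.
exists h; split=> // n x.
have hS m y : h m.+1 y = - ind_map (res_ghom H (h m)) y.
  by rewrite -[LHS]/(ghom_scale _ _ y) ghom_scaleE scaleN1r.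
have step m y : bar_d m.+1 M y =
    bar_eta (bar m.+1 M) y - ind_map (res_ghom H (bar_d m M)) y.
  by rewrite -ghom_subE.
rewrite hS step linearB opprB -bar_eta_nat.
elim: n x => [|n IHn] x.
  rewrite subrKC (ind_map_comp (h := ghom_id (res M))).
    exact: ind_map_id.
  exact: rE.
rewrite step addrC addrA subrK hS linearN opprK addrC.
apply: ind_map_homotopy => y.
rewrite -[RHS]IHn -[LHS]/(bar_d n M (h n y) + h n.+1 (bar_d n.+1 M y)).
by rewrite hS step linearB opprB -bar_eta_nat.
Qed.

End BarResolution.

(** * The spectral sequence of a filtered differential module *)

Section InducedMaps.
Variables (k : fieldType) (G : alg_group k).

Lemma subquo_map_exists (M N : gmodule G) (f : ghom M N) (P Q : submod M)
    (P' Q' : submod N) :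
  (forall x, x \in sub_pred P -> f x \in sub_pred P') ->
  (forall x, x \in sub_pred P -> x \in sub_pred Q -> f x \in sub_pred Q') ->
  exists c : ghom (subquo P Q) (subquo P' Q'),
    forall x (Px : x \in sub_pred P) (Pfx : f x \in sub_pred P'),
      c (subquo_proj P Q (SubSort Px)) = subquo_proj P' Q' (SubSort Pfx).
Proof.
move=> PP QQ.
pose g : ghom (sub_gmodule P) (sub_gmodule P') :=
  sub_codom (f := ghom_comp f (sub_incl P)) (fun x => PP _ (valP x)).
have [||c cE] := @ghom_factor _ _ _ _ _ (subquo_proj P Q)
  (ghom_comp (subquo_proj P' Q') g); first exact: subquo_surj.
  by move=> [x Px] /subquo_proj0 Qx; apply/subquo_proj0; exact: QQ.
exists c => x Px Pfx; rewrite cE -[LHS]/(subquo_proj P' Q' (g (SubSort Px))).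
by congr (subquo_proj P' Q' _); exact: val_inj.
Qed.

Definition subquo_map (M N : gmodule G) (f : ghom M N) (P Q : submod M)
    (P' Q' : submod N) PP QQ : ghom (subquo P Q) (subquo P' Q') :=
  sval (cid (@subquo_map_exists M N f P Q P' Q' PP QQ)).

Lemma subquo_mapE (M N : gmodule G) (f : ghom M N) (P Q : submod M)
    (P' Q' : submod N) PP QQ x (Px : x \in sub_pred P)
    (Pfx : f x \in sub_pred P') :
  @subquo_map M N f P Q P' Q' PP QQ (subquo_proj P Q (SubSort Px)) =
  subquo_proj P' Q' (SubSort Pfx).
Proof. exact: (svalP (cid (@subquo_map_exists M N f P Q P' Q' PP QQ))). Qed.

End InducedMaps.

Section FilteredModule.
Variables (k : fieldType) (G : alg_group k) (T : gmodule G) (D : ghom T T).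
Hypothesis DD : forall x, D (D x) = 0.

(** F p n is the p-th step of the filtration in degree n. *)
Variable F : int -> int -> submod T.
Hypothesis F_S : forall p n x, x \in sub_pred (F (p + 1) n) ->
  x \in sub_pred (F p n).
Hypothesis F_neg : forall p n x, p < 0 -> x \in sub_pred (F p n) ->
  x \in sub_pred (F (p + 1) n).
Hypothesis F_big : forall p n x, n < p -> x \in sub_pred (F p n) -> x = 0.

Definition fss_Z (r : nat) (p n : int) : submod T :=
  gcap (F p n) (gpreim D (F (p + r%:Z) (n + 1))).

(** Neither summand is cut down to Z_(r-1) as is customary. [subquo] intersects with Z_r, and if D u
    + y lies in Z_r p, then u and y satisfy those conditions automatically, so the quotient is the
    usual E_r. *)
Definition fss_B (r : nat) (p n : int) : submod T :=
  gsum (gimsub D (F (p - r%:Z + 1) (n - 1))) (F (p + 1) n).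

Lemma fss_ZP r p n x : x \in sub_pred (fss_Z r p n) <->
  x \in sub_pred (F p n) /\ D x \in sub_pred (F (p + r%:Z) (n + 1)).
Proof. exact: gcapP. Qed.

Lemma fss_BP r p n x : x \in sub_pred (fss_B r p n) <->
  exists2 u, u \in sub_pred (F (p - r%:Z + 1) (n - 1)) &
    x - D u \in sub_pred (F (p + 1) n).
Proof.
split=> [/gsumP[_ /gimsubP[u Fu <-] Fx]|[u Fu Fx]]; first by exists u.
by apply/gsumP; exists (D u) => //; apply/gimsubP; exists u.
Qed.

Definition fss_E (r : nat) (p q : int) : gmodule G :=
  subquo (fss_Z r p (p + q)) (fss_B r p (p + q)).

Lemma F_le p p' n x : p <= p' -> x \in sub_pred (F p' n) -> x \in sub_pred (F p n).
Proof.
move=> pp'; have -> : p' = p + `|p' - p|%N%:Z by lia.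
elim: `|p' - p|%N => [|m IHm]; first by rewrite addr0.
by move=> xF; apply/IHm/F_S; have <- : p + m.+1%:Z = p + m%:Z + 1 by lia.
Qed.

(** The target degree comes with an equation because p + r + (q - r + 1) is not convertible to p + q
    + 1. *)
Lemma fss_D_Z r p n n' x : n' = n + 1 -> x \in sub_pred (fss_Z r p n) ->
  D x \in sub_pred (fss_Z r (p + r%:Z) n').
Proof. by move=> -> /fss_ZP[_ Fx]; apply/fss_ZP; rewrite DD rpred0. Qed.

Lemma fss_D_B r p n n' x : n' = n + 1 -> x \in sub_pred (fss_B r p n) ->
  D x \in sub_pred (fss_B r (p + r%:Z) n').
Proof.
move=> -> /fss_BP[u _ Fx]; apply/fss_BP; exists (x - D u).
  by rewrite !addrK.
by rewrite linearB DD subr0 subrr rpred0.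
Qed.

Lemma fss_degree (p q : int) (r : nat) :
  p + r%:Z + (q - r%:Z + 1) = p + q + 1.
Proof. lia. Qed.

Definition fss_d (r : nat) (p q : int) :
    ghom (fss_E r p q) (fss_E r (p + r%:Z) (q - r%:Z + 1)) :=
  subquo_map (fun x => fss_D_Z (fss_degree p q r))
             (fun x _ => fss_D_B (fss_degree p q r)).

Lemma fss_dd r p q x :
  fss_d r (p + r%:Z) (q - r%:Z + 1) (fss_d r p q x) = 0.
Proof.
have [[y Zy] <-] := subquo_surj x.
rewrite (subquo_mapE _ _ _ (fss_D_Z (fss_degree p q r) Zy)).
rewrite (subquo_mapE _ _ _
  (fss_D_Z (fss_degree _ _ r) (fss_D_Z (fss_degree p q r) Zy))).
by apply/subquo_cls0; rewrite DD rpred0.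
Qed.

(** Elements of Z_(r+1) represent classes killed by d_r; the map induced by this inclusion is the
    isomorphism. *)
Lemma fss_next r p q : (0 < r)%N ->
  giso (fss_E r.+1 (p + r%:Z) (q - r%:Z + 1))
       (gcoh (fss_d r p q) (fss_d r (p + r%:Z) (q - r%:Z + 1))).
Proof.
move=> r0; set P := p + r%:Z; set Q := q - r%:Z + 1.
set n := P + Q; have nE : p + q = n - 1 by rewrite /n /P /Q; lia.
have nE' : P + r%:Z + (Q - r%:Z + 1) = n + 1 by rewrite /n; lia.
have ZZ x : x \in sub_pred (fss_Z r.+1 P n) -> x \in sub_pred (fss_Z r P n).
  move=> /fss_ZP[Fx Fdx]; apply/fss_ZP; split=> //.
  by apply: F_le Fdx; lia.
pose z : ghom (sub_gmodule (fss_Z r.+1 P n)) (fss_E r P Q) :=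
  ghom_comp (subquo_proj _ _) (sub_le_incl ZZ).
have zE x (Zx : x \in sub_pred (fss_Z r.+1 P n))
    (Zx' : x \in sub_pred (fss_Z r P n)) :
    z (SubSort Zx) = subquo_proj _ _ (SubSort Zx').
  by congr (subquo_proj _ _ _); exact: val_inj.
have dz x : z x \in sub_pred (gker (fss_d r P Q)).
  case: x => x Zx; apply/gkerP; rewrite (zE _ _ (ZZ _ Zx)).
  rewrite (subquo_mapE _ _ _ (fss_D_Z (fss_degree P Q r) (ZZ _ Zx))).
  apply/subquo_cls0/fss_BP; exists 0; rewrite ?rpred0 // linear0 subr0 nE'.
  by have /fss_ZP[_] := Zx; apply: F_le; lia.
apply: (giso_subquo (f := ghom_comp (subquo_proj _ _) (sub_codom dz))).
  move=> y; have [[e de] <-] := subquo_surj y.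
  have [[x Zx] xe] := subquo_surj e.
  have : fss_d r P Q (subquo_proj _ _ (SubSort Zx)) = 0 by rewrite xe; exact/gkerP.
  rewrite (subquo_mapE _ _ _ (fss_D_Z (fss_degree P Q r) Zx)).
  move=> /subquo_cls0/fss_BP[u]; rewrite nE' !addrK => Fu Fxu.
  (* A vanishing d_r only gives D x = D u modulo the next filtration step, with [u] in F (P + 1);
     subtracting [u] leaves the class in E_r unchanged. *)
  have Zy : x - u \in sub_pred (fss_Z r.+1 P n).
    have /fss_ZP[Fx Fdx] := Zx; apply/fss_ZP; split.
      by rewrite rpredB //; exact: F_S.
    rewrite linearB; apply: F_le Fxu; lia.
  exists (SubSort Zy); congr (subquo_proj _ _ _); apply: val_inj.
  rewrite -[LHS]/(z (SubSort Zy)) -[RHS]/e -xe (zE _ _ (ZZ _ Zy)).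
  apply/subquo_clsP/fss_BP.
  exists 0; rewrite ?rpred0 //.
  by rewrite linear0 subr0 addrAC subrr add0r rpredN.
move=> [x Zx]; split.
  move=> /subquo_proj0/im_predP[e]; have [[w Zw] <-] := subquo_surj e.
  have Zdw : D w \in sub_pred (fss_Z r P n).
    exact: (fss_D_Z (fss_degree p q r) Zw).
  rewrite (subquo_mapE _ _ _ Zdw) -[RHS]/(z (SubSort Zx)) (zE _ _ (ZZ _ Zx)).
  move=> /esym/subquo_clsP/fss_BP[u Fu] Fxu; apply/fss_BP; exists (w + u).
    rewrite rpredD //.
      by have /fss_ZP[+ _] := Zw; rewrite nE; apply: F_le; rewrite /P; lia.
    by apply: F_le Fu; lia.
  by rewrite linearD opprD addrA.
move=> /fss_BP[u Fu Fxu].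
(* The primitive [u] already lies in Z_r, because D u differs from [x] by an element of F (P +
   1). *)
have Zu : u \in sub_pred (fss_Z r p (p + q)).
  apply/fss_ZP; rewrite nE subrK; split.
    by apply: F_le Fu; rewrite /P; lia.
  have -> : D u = x - (x - D u) by rewrite subKr.
  by rewrite rpredB //; [have /fss_ZP[] := Zx|exact: F_S].
apply/subquo_proj0/im_predP; exists (subquo_proj _ _ (SubSort Zu)).
have Zdu : D u \in sub_pred (fss_Z r P n).
  exact: (fss_D_Z (fss_degree p q r) Zu).
rewrite (subquo_mapE _ _ _ Zdu) -[RHS]/(z (SubSort Zx)) (zE _ _ (ZZ _ Zx)).
apply/esym/subquo_clsP/fss_BP; by exists 0; rewrite ?rpred0 // linear0 subr0.
Qed.

Definition filtered_ss : spectral_seq G :=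
  @SpectralSeq _ _ fss_E fss_d (fun r p q _ => @fss_dd r p q)
    (fun r p q r2 => fss_next p q (ltnW r2)).

Lemma fss_E_zero r p q : p < 0 \/ q < 0 -> is_zero (fss_E r p q).
Proof.
move=> pq; apply: subquo_is_zero => x /fss_ZP[Fx _]; apply/fss_BP.
exists 0; rewrite ?rpred0 // linear0 subr0.
case: pq => [p0|q0]; first exact: F_neg.
by rewrite (F_big _ Fx) ?rpred0 //; lia.
Qed.

Definition fss_cocycles (n : int) : submod T := gcap (F 0 n) (gker D).

Lemma fss_cocyclesP n x : x \in sub_pred (fss_cocycles n) <->
  x \in sub_pred (F 0 n) /\ D x = 0.
Proof.
split=> [/gcapP[Fx /gkerP Dx]|[Fx Dx]]; first by split.
by apply/gcapP; split=> //; exact/gkerP.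
Qed.

(** * Convergence to the cohomology *)

Section Limit.
Variables (A : nat -> gmodule G)
  (a : forall n : nat, ghom (sub_gmodule (fss_cocycles n%:Z)) (A n)).
Hypothesis a_surj : forall n y, exists x, a n x = y.
Hypothesis a_ker : forall n x, a n x = 0 <->
  exists2 u, u \in sub_pred (F 0 (n%:Z - 1)) & D u = sub_val x.

Definition fss_fil (n p : nat) : submod (A n) :=
  gimsub (a n) (gpreim (sub_incl (fss_cocycles n%:Z)) (F p%:Z n%:Z)).

Lemma fss_filP n p y : y \in sub_pred (fss_fil n p) <->
  exists2 x, sub_val x \in sub_pred (F p%:Z n%:Z) & a n x = y.
Proof. exact: gimsubP. Qed.

(** The bound forces p + r > n + 1, so that Z_r consists of cocycles by [F_big], and p - r + 1 <= 0,
    so that B_r contains all coboundaries of degree n. *)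
Lemma fss_Einfty_iso (r p q : nat) : (p + q + 2 <= r)%N ->
  giso (fss_E r p%:Z q%:Z)
       (subquo (fss_fil (p + q) p) (fss_fil (p + q) p.+1)).
Proof.
move=> rpq; set n := (p + q)%N.
have Zc x : x \in sub_pred (fss_Z r p%:Z n%:Z) ->
    x \in sub_pred (fss_cocycles n%:Z).
  move=> /fss_ZP[Fx Fdx]; apply/fss_cocyclesP; split.
    by apply: F_le Fx; lia.
  by apply: F_big Fdx; rewrite /n; lia.
pose c := ghom_comp (a n) (sub_le_incl Zc).
have cE x Zx : c (SubSort Zx) = a n (SubSort (Zc x Zx)).
  by congr (a n _); exact: val_inj.
have cF x : c x \in sub_pred (fss_fil n p).
  case: x => x Zx; rewrite cE; apply/fss_filP; exists (SubSort (Zc x Zx)) => //.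
  by have /fss_ZP[] := Zx.
apply: (giso_subquo (f := ghom_comp (subquo_proj _ _) (sub_codom cF))).
  move=> y; have [[z zF] <-] := subquo_surj y.
  have /fss_filP[[x xc] /= Fx xz] := zF.
  have Zx : x \in sub_pred (fss_Z r p%:Z n%:Z).
    have /fss_cocyclesP[_ Dx] := xc.
    by apply/fss_ZP; rewrite Dx rpred0.
  exists (SubSort Zx); congr (subquo_proj _ _ _); apply: val_inj.
  rewrite -[LHS]/(c (SubSort Zx)) cE -[RHS]/z -xz.
  by congr (a n _); exact: val_inj.
move=> [x Zx].
rewrite -[ghom_comp _ _ _]/(subquo_proj _ _ (SubSort (cF (SubSort Zx)))).
split=> [/subquo_cls0/fss_filP[x' Fx']|/fss_BP[u Fu Fxu]].
  rewrite cE => /eqP; rewrite eq_sym -subr_eq0 -linearB => /eqP/a_ker[u Fu uE].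
  apply/fss_BP; exists u; first by apply: F_le Fu; lia.
  have -> : D u = x - sub_val x' by rewrite uE; exact: (linearB (sub_incl _)).
  by rewrite subKr; apply: F_le Fx'; lia.
have xuc : x - D u \in sub_pred (fss_cocycles n%:Z).
  apply/fss_cocyclesP; split; first by apply: F_le Fxu; lia.
  have /fss_cocyclesP[_ Dx] := Zc _ Zx.
  by rewrite linearB DD subr0.
apply/subquo_cls0/fss_filP; exists (SubSort xuc).
  by apply: F_le Fxu; lia.
rewrite cE; apply/eqP; rewrite -subr_eq0 -linearB; apply/eqP/a_ker.
have uF : u \in sub_pred (F 0 (n%:Z - 1)).
  (* Below step 0 the filtration is constant, so [u] is moved up to F 0 by repeated use of
     [F_neg]. *)
  have : p%:Z - r%:Z + 1 <= 0 by lia.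
  move: (p%:Z - r%:Z + 1) Fu => s Fu s0.
  have -> : 0 = s + `|s|%N%:Z by lia.
  have : `|s|%N%:Z <= - s by lia.
  elim: `|s|%N => [|m IHm] ms; first by rewrite addr0.
  have -> : s + m.+1%:Z = s + m%:Z + 1 by lia.
  by apply: F_neg (IHm _); lia.
exists (- u); first by rewrite rpredN.
rewrite linearN -[RHS]/(sub_incl _ (_ - _)) linearB -[RHS]/(x - D u - x).
by rewrite addrAC subrr add0r.
Qed.

Lemma fss_converges : converges filtered_ss A.
Proof.
split; first exact: fss_E_zero.
exists fss_fil; split.
- move=> n y; have [x <-] := a_surj y; apply/fss_filP; exists x => //.
  by have /fss_cocyclesP[] := valP x.
- move=> n p y /fss_filP[x Fx <-]; apply/fss_filP; exists x => //.
  by apply: F_le Fx; lia.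
- move=> n y /fss_filP[x Fx <-]; have -> : x = 0.
    by apply: val_inj; apply: F_big Fx; lia.
  exact: linear0.
move=> p q; exists (p + q + 2)%N; first by rewrite leq_addl.
move=> r rpq; split; last exact: fss_Einfty_iso.
  move=> x; have [[y Zy] <-] := subquo_surj x.
  rewrite [LHS](subquo_mapE _ _ _ (fss_D_Z (fss_degree p%:Z q%:Z r) Zy)).
  have /fss_ZP[_ FDy] := Zy.
  by apply/subquo_cls0; rewrite (F_big _ FDy) ?rpred0 //; lia.
move=> p' q' pp' _ x; have -> : x = 0; last exact: linear0.
by apply: fss_E_zero; left; lia.
Qed.

End Limit.

Lemma filtered_ss_converges (A : nat -> gmodule G) :
  (forall n : nat, giso (subquo (fss_cocycles n%:Z)
                                (gimsub D (F 0 (n%:Z - 1)))) (A n)) ->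
  converges filtered_ss A.
Proof.
move=> isoA.
have aP (n : nat) : exists a : ghom (sub_gmodule (fss_cocycles n%:Z)) (A n),
    (forall y, exists x, a x = y) /\
    forall x, a x = 0 <->
      exists2 u, u \in sub_pred (F 0 (n%:Z - 1)) & D u = sub_val x.
  have [f [g [fK gK]]] := isoA n.
  exists (ghom_comp f (subquo_proj _ _)); split=> [y|x].
    by have [x xE] := subquo_surj (g y); exists x; rewrite -[RHS]gK -xE.
  split=> [|/gimsubP/subquo_proj0 x0]; last first.
    by rewrite -[LHS]/(f (subquo_proj _ _ x)) x0 linear0.
  move=> /(congr1 g); rewrite [LHS]fK linear0 => /subquo_proj0/gimsubP; exact.
apply: (fss_converges (a := fun n => sval (cid (aP n)))) => n.
  exact: (svalP (cid (aP n))).1.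
exact: (svalP (cid (aP n))).2.
Qed.

End FilteredModule.

(** * Double complexes *)

Section Cohomology.
Variables (k : fieldType) (G : alg_group k).

Definition coh (A : nat -> gmodule G) (d : forall n, ghom (A n) (A n.+1))
    (n : nat) : gmodule G :=
  if n is m.+1 then gcoh (d m) (d m.+1)
  else gcoh (ghom_zero (gzero G) (A 0)) (d 0).

Definition cobound (A : nat -> gmodule G) (d : forall n, ghom (A n) (A n.+1))
    (n : nat) : A n -> Prop :=
  if n is m.+1 then fun y => exists x, d m x = y else fun y => y = 0.

Section Coh.
Variables (A : nat -> gmodule G) (d : forall n, ghom (A n) (A n.+1)).

Definition coh_proj n : ghom (sub_gmodule (gker (d n))) (coh d n) :=
  match n with
  | 0 => gcoh_proj (ghom_zero (gzero G) (A 0)) (d 0)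
  | m.+1 => gcoh_proj (d m) (d m.+1)
  end.

Lemma coh_proj_surj n y : exists x, coh_proj n x = y.
Proof. by case: n y => [|n] y; exact: subquo_surj. Qed.

Lemma coh_proj0 n x : coh_proj n x = 0 <-> cobound d (sub_val x).
Proof.
case: n x => [|n] x; split.
- by move=> /subquo_proj0/im_predP[y <-].
- by move=> /= x0; apply/subquo_proj0/im_predP; exists 0.
- by move=> /subquo_proj0/im_predP.
- by move=> x0; apply/subquo_proj0/im_predP.
Qed.

Lemma giso_coh N n (f : ghom (sub_gmodule (gker (d n))) N) :
  (forall y, exists x, f x = y) ->
  (forall x, f x = 0 <-> cobound d (sub_val x)) -> giso (coh d n) N.
Proof.
move=> fs f0; have [|c cE] := ghom_factor (b := f) (@coh_proj_surj n).
  by move=> x /coh_proj0/f0.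
apply: (giso_bij (f := c)) => [x|y].
  by have [z <-] := coh_proj_surj x; rewrite cE => /f0/coh_proj0.
by have [x <-] := fs y; exists (coh_proj n x).
Qed.

Lemma coh_is_zero n :
  (forall x, d n x = 0 -> cobound d x) <-> is_zero (coh d n).
Proof.
split=> [dx y|H0 x dx].
  have [[x Zx] <-] := coh_proj_surj y.
  by apply/coh_proj0; exact/dx/gkerP.
have Zx : x \in sub_pred (gker (d n)) by exact/gkerP.
by have /coh_proj0 := H0 (coh_proj n (SubSort Zx)).
Qed.

End Coh.
End Cohomology.

(** * The total complex *)

Section DoubleComplex.
Variables (k : fieldType) (G : alg_group k) (X : nat -> nat -> gmodule G).
Variables (h : forall p q, ghom (X p q) (X p.+1 q))
          (v : forall p q, ghom (X p q) (X p q.+1)).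

Let X' (i : nat * nat) : gmodule G := X i.1 i.2.

Definition tot : gmodule G := gdsum X'.
Definition tot_inj p q : ghom (X p q) tot := gdsum_inj X' (p, q).
Definition tot_proj p q : ghom tot (X p q) := gdsum_proj X' (p, q).

Definition tot_h : ghom tot tot :=
  gdsum_lift (fun i : nat * nat => ghom_comp (tot_inj i.1.+1 i.2) (h i.1 i.2)).
Definition tot_v : ghom tot tot :=
  gdsum_lift (fun i : nat * nat => ghom_comp (tot_inj i.1 i.2.+1) (v i.1 i.2)).
Definition tot_d : ghom tot tot := ghom_add tot_h tot_v.

Lemma tot_ext (x y : tot) :
  (forall p q, tot_proj p q x = tot_proj p q y) -> x = y.
Proof. by move=> xy; apply: gdsum_ext => -[p q]; exact: xy. Qed.

Lemma tot_fun_ext (W : lmodType k) (f g : tot -> W) : linear f -> linear g ->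
  (forall p q x, f (tot_inj p q x) = g (tot_inj p q x)) ->
  forall x, f x = g x.
Proof. by move=> lf lg fg; apply: gdsum_fun_ext => // -[p q] x; exact: fg. Qed.

Lemma tot_proj_in p q x : tot_proj p q (tot_inj p q x) = x.
Proof. exact: (@gdsum_proj_in _ _ _ X' (p, q) x). Qed.

Lemma tot_proj_out p q p' q' x :
  (p, q) != (p', q') -> tot_proj p' q' (tot_inj p q x) = 0.
Proof. exact: (@gdsum_proj_out _ _ _ X' (p, q) (p', q') x). Qed.

Lemma tot_h_inj p q x : tot_h (tot_inj p q x) = tot_inj p.+1 q (h p q x).
Proof. exact: (@gdsum_lift_inj _ _ _ X' _ _ (p, q) x). Qed.

Lemma tot_v_inj p q x : tot_v (tot_inj p q x) = tot_inj p q.+1 (v p q x).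
Proof. exact: (@gdsum_lift_inj _ _ _ X' _ _ (p, q) x). Qed.

Lemma tot_dE x : tot_d x = tot_h x + tot_v x.
Proof. by []. Qed.

Lemma tot_h0 q x : tot_proj 0 q (tot_h x) = 0.
Proof.
move: x; apply: tot_fun_ext => [a y z|a y z|p q' x]; rewrite ?linearP //.
  by rewrite scaler0 addr0.
by rewrite tot_h_inj tot_proj_out.
Qed.

Lemma tot_hS p q x : tot_proj p.+1 q (tot_h x) = h p q (tot_proj p q x).
Proof.
move: x; apply: tot_fun_ext => [a y z|a y z|p' q' x]; rewrite ?linearP //.
rewrite tot_h_inj; have [[<- <-]|ne] := eqVneq (p', q') (p, q).
  by rewrite !tot_proj_in.
by rewrite (tot_proj_out _ ne) linear0 tot_proj_out.
Qed.

Lemma tot_v0 p x : tot_proj p 0 (tot_v x) = 0.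
Proof.
move: x; apply: tot_fun_ext => [a y z|a y z|p' q x]; rewrite ?linearP //.
  by rewrite scaler0 addr0.
by rewrite tot_v_inj tot_proj_out // xpair_eqE andbF.
Qed.

Lemma tot_vS p q x : tot_proj p q.+1 (tot_v x) = v p q (tot_proj p q x).
Proof.
move: x; apply: tot_fun_ext => [a y z|a y z|p' q' x]; rewrite ?linearP //.
rewrite tot_v_inj; have [[<- <-]|ne] := eqVneq (p', q') (p, q).
  by rewrite !tot_proj_in.
by rewrite (tot_proj_out _ ne) linear0 tot_proj_out.
Qed.

(** The degree is part of the support condition because [tot] holds all degrees at once. For p <= 0
    the condition on columns is empty, whence [tot_fil_neg]. *)
Definition tot_fil (p n : int) : submod tot :=
  gdsum_supp X' (fun i => (p <= i.1%:Z) && ((i.1 + i.2)%N%:Z == n)).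

Lemma tot_filP p n x : x \in sub_pred (tot_fil p n) <->
  forall p' q', ~~ ((p <= p'%:Z) && ((p' + q')%N%:Z == n)) ->
  tot_proj p' q' x = 0.
Proof.
split=> [/gdsum_suppP xS p' q' pq|xS]; first exact: (xS (p', q')).
by apply/gdsum_suppP => -[p' q']; exact: xS.
Qed.

Lemma tot_inj_fil p q x (p' n : int) : p' <= p%:Z -> (p + q)%N%:Z = n ->
  tot_inj p q x \in sub_pred (tot_fil p' n).
Proof.
move=> pp' <-; apply/tot_filP => a b ab; rewrite tot_proj_out //.
by apply: contraNneq ab => -[<- <-]; rewrite pp' eqxx.
Qed.

Hypothesis hh : forall p q x, h p.+1 q (h p q x) = 0.
Hypothesis vv : forall p q x, v p q.+1 (v p q x) = 0.
Hypothesis hv : forall p q x, h p q.+1 (v p q x) + v p.+1 q (h p q x) = 0.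

Lemma tot_dd x : tot_d (tot_d x) = 0.
Proof.
move: x; apply: tot_fun_ext => [a y z|a y z|p q x].
- by rewrite !linearP.
- by rewrite scaler0 addr0.
rewrite !tot_dE tot_h_inj tot_v_inj !linearD !tot_h_inj !tot_v_inj.
rewrite hh vv !linear0 add0r addr0 -linearD -[RHS](linear0 (tot_inj p.+1 q.+1)).
by rewrite hv.
Qed.

Lemma tot_fil_d p n x : x \in sub_pred (tot_fil p n) ->
  tot_d x \in sub_pred (tot_fil p (n + 1)).
Proof.
move=> /tot_filP xF; apply/tot_filP => a b ab.
rewrite tot_dE linearD -[RHS]addr0; congr (_ + _).
  by case: a ab => [|a] ab; rewrite ?tot_h0 // tot_hS xF ?linear0 //; lia.
by case: b ab => [|b] ab; rewrite ?tot_v0 // tot_vS xF ?linear0 //; lia.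
Qed.

Lemma tot_fil_le p p' n x : p <= p' -> x \in sub_pred (tot_fil p' n) ->
  x \in sub_pred (tot_fil p n).
Proof.
move=> pp' /tot_filP xF; apply/tot_filP => a b ab; apply: xF.
by apply: contra ab => /andP[? ->]; rewrite andbT; lia.
Qed.

Lemma tot_fil_S p n x :
  x \in sub_pred (tot_fil (p + 1) n) -> x \in sub_pred (tot_fil p n).
Proof. by apply: tot_fil_le; lia. Qed.

Lemma tot_fil_neg p n x : p < 0 -> x \in sub_pred (tot_fil p n) ->
  x \in sub_pred (tot_fil (p + 1) n).
Proof.
move=> p0 /tot_filP xF; apply/tot_filP => a b ab; apply: xF.
by apply: contra ab => /andP[_ ->]; rewrite andbT; lia.
Qed.

Lemma tot_fil_big p n x : n < p -> x \in sub_pred (tot_fil p n) -> x = 0.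
Proof.
move=> np /tot_filP xF; apply: tot_ext => a b; rewrite linear0; apply: xF; lia.
Qed.

(** * Double complexes with exact augmented rows *)

Section Edge.
Variables (A : nat -> gmodule G) (dA : forall q, ghom (A q) (A q.+1)).
Variable a : forall q, ghom (A q) (X 0 q).
Hypothesis a_inj : forall q x, a q x = 0 -> x = 0.
Hypothesis a_ker : forall q x, h 0 q x = 0 <-> exists y, a q y = x.
Hypothesis a_nat : forall q x, a q.+1 (dA q x) = v 0 q (a q x).
Hypothesis h_exact : forall p q x, h p.+1 q x = 0 -> exists y, h p q y = x.

Lemma tot_v_col p x :
  (forall q, tot_proj p q x = 0) -> forall q, tot_proj p q (tot_v x) = 0.
Proof. by move=> x0 [|q]; rewrite ?tot_v0 // tot_vS x0 linear0. Qed.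

(** Induction on the last nonzero column: exactness of the row gives a preimage of its entry, and
    subtracting the total differential of that preimage moves the entry one column to the left. *)
Lemma tot_push_step (n m : nat) x : x \in sub_pred (tot_fil 0 n%:Z) ->
  (forall p q, (m < p)%N -> tot_proj p q x = 0) ->
  (forall p q, tot_proj p.+1 q (tot_d x) = 0) ->
  exists2 y, y \in sub_pred (tot_fil 0 (n%:Z - 1)) &
    forall p q, tot_proj p.+1 q (x - tot_d y) = 0.
Proof.
elim: m x => [|m IHm] x Fx xm dx.
  by exists 0; rewrite ?rpred0 // => p q; rewrite linear0 subr0 xm.
(* If n <= m, column m + 1 has no position of degree n, except that truncated subtraction would
   invent one. *)
have [nm|mn] := leqP n m.
  apply: IHm => // p q mp; have [->|pm] := eqVneq p m.+1; last by apply: xm; lia.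
  by have /tot_filP := Fx; apply; lia.
set q := (n - m.+1)%N; pose t := tot_proj m.+1 q x.
(* The entry of [tot_d x] at (m + 2, q) is only [h t], since column m + 2 of [x] is empty. *)
have ht : h m.+1 q t = 0.
  have := dx m.+1 q; rewrite tot_dE linearD tot_hS tot_v_col ?addr0 //.
  by move=> b; apply: xm.
have [y0 y0t] := h_exact ht.
have Fy0 : tot_inj m q y0 \in sub_pred (tot_fil 0 (n%:Z - 1)).
  by apply: tot_inj_fil; rewrite // /q; lia.
have [|p b mp|p b|y1 Fy1 xy1] := IHm (x - tot_d (tot_inj m q y0)).
- by rewrite rpredB // -(subrK 1 n%:Z); exact: tot_fil_d.
- have -> : tot_d (tot_inj m q y0) = tot_inj m.+1 q t + tot_inj m q.+1 (v m q y0).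
    by rewrite tot_dE tot_h_inj tot_v_inj y0t.
  rewrite linearB [X in _ - X]linearD [X in _ - (_ + X)]tot_proj_out; last first.
    by rewrite xpair_eqE negb_and; lia.
  rewrite addr0.
  have [e|ne] := eqVneq (m.+1, q) (p, b).
    by case: e => <- <-; rewrite tot_proj_in subrr.
  rewrite tot_proj_out // subr0; have [pm|pm] := eqVneq p m.+1.
    have /tot_filP := Fx; apply; rewrite pm in ne *.
    by move: ne; rewrite xpair_eqE /q; lia.
  by apply: xm; lia.
- by rewrite linearB tot_dd subr0.
exists (tot_inj m q y0 + y1); first by rewrite rpredD.
by move=> p b; rewrite [tot_d _]linearD opprD addrA.
Qed.

(** The differential of [x] may survive in column 0: surjectivity of the edge map applies this to
    cocycles, injectivity to a primitive of an edge element. *)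
Lemma tot_push (n : nat) x : x \in sub_pred (tot_fil 0 n%:Z) ->
  (forall p q, tot_proj p.+1 q (tot_d x) = 0) ->
  exists2 y, y \in sub_pred (tot_fil 0 (n%:Z - 1)) &
    exists w, x - tot_d y = tot_inj 0 n (a n w).
Proof.
move=> Fx dx; have [|y Fy xy] := @tot_push_step n n x Fx _ dx.
  by move=> p q np; have /tot_filP := Fx; apply; lia.
exists y => //; set z := x - tot_d y.
have Fz : z \in sub_pred (tot_fil 0 n%:Z).
  by rewrite rpredB // -(subrK 1 n%:Z); exact: tot_fil_d.
have zE : z = tot_inj 0 n (tot_proj 0 n z).
  apply: tot_ext => -[|p] q; last by rewrite xy tot_proj_out.
  have [->|qn] := eqVneq q n; first by rewrite tot_proj_in.
  rewrite tot_proj_out; last by rewrite xpair_eqE eq_sym.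
  by have /tot_filP := Fz; apply; rewrite add0n; lia.
have : h 0 n (tot_proj 0 n z) = 0.
  have : tot_proj 1 n (tot_d z) = 0 by rewrite linearB tot_dd subr0.
  by rewrite tot_dE linearD tot_hS tot_v_col ?addr0.
by move=> /a_ker[w wE]; exists w; rewrite wE -zE.
Qed.

Definition tot_cocycles (n : int) : submod tot := fss_cocycles tot_d tot_fil n.
Definition tot_cobounds (n : int) : submod tot :=
  gimsub tot_d (tot_fil 0 (n - 1)).
Definition tot_coh (n : int) : gmodule G :=
  subquo (tot_cocycles n) (tot_cobounds n).

Lemma edge_inj_d n w :
  tot_d (tot_inj 0 n (a n w)) = tot_inj 0 n.+1 (a n.+1 (dA n w)).
Proof.
rewrite tot_dE tot_h_inj tot_v_inj a_nat.
have -> : h 0 n (a n w) = 0 by apply/a_ker; exists w.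
by rewrite linear0 add0r.
Qed.

Lemma edge_iso (n : nat) : giso (coh dA n) (tot_coh n%:Z).
Proof.
have aI q : injective (a q) by exact: raddf_inj (@a_inj q).
have injI q x y : tot_inj 0 q x = tot_inj 0 q y -> x = y.
  by move=> /(congr1 (tot_proj 0 q)); rewrite !tot_proj_in.
pose e : ghom (sub_gmodule (gker (dA n))) tot :=
  ghom_comp (ghom_comp (tot_inj 0 n) (a n)) (sub_incl _).
have eZ x : e x \in sub_pred (tot_cocycles n%:Z).
  case: x => x Zx; have /gkerP dx := Zx; apply/fss_cocyclesP; split.
    exact: tot_inj_fil.
  by rewrite [LHS]edge_inj_d dx !linear0.
apply: (giso_coh (f := ghom_comp (subquo_proj _ _) (sub_codom eZ))).
  move=> y; have [[z zZ] <-] := subquo_surj y.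
  have /fss_cocyclesP[Fz dz] := zZ.
  have [|u Fu [w zuw]] := tot_push Fz; first by move=> p q; rewrite dz linear0.
  have Zw : w \in sub_pred (gker (dA n)).
    have := edge_inj_d w; rewrite -zuw linearB dz tot_dd subr0 => /esym e0.
    by apply/gkerP/(@a_inj n.+1); apply: injI; rewrite e0 linear0.
  exists (SubSort Zw); apply/subquo_clsP/gimsubP; exists (- u).
    by rewrite rpredN.
  by rewrite linearN -[e _]/(tot_inj 0 n (a n w)) -zuw addrAC subrr add0r.
move=> [x Zx].
rewrite -[ghom_comp _ _ _]/(subquo_proj _ _ (SubSort (eZ (SubSort Zx)))).
rewrite -[sub_val _]/x; split=> [/subquo_cls0/gimsubP[u Fu]|xB].
  rewrite -[e _]/(tot_inj 0 n (a n x)) => due.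
  case: n x {e eZ Zx} Fu due => [|n] x Fu due.
    rewrite (tot_fil_big _ Fu) // linear0 in due.
    by apply/(@a_inj 0)/injI; rewrite -due linear0.
  rewrite -addn1 PoszD addrK in Fu.
  have [|y Fy [w uyw]] := tot_push Fu.
    by move=> p q; rewrite due tot_proj_out.
  exists w; apply/aI/injI; rewrite -due -edge_inj_d -uyw.
  by rewrite linearB tot_dd subr0.
apply/subquo_cls0/gimsubP; rewrite -[e _]/(tot_inj 0 n (a n x)).
case: n x {e eZ Zx} xB => [|n] x xB.
  have -> : x = 0 by [].
  by exists 0; rewrite ?rpred0 // !linear0.
have [w <-] := xB; exists (tot_inj 0 n (a n w)); last exact: edge_inj_d.
by apply: tot_inj_fil => //; lia.
Qed.

End Edge.
End DoubleComplex.

(** * Exchange of rows and columns *)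

Section Swap.
Variables (k : fieldType) (G : alg_group k).

Lemma giso_subquo_iso (M N : gmodule G) (f : ghom M N) (g : ghom N M)
    (P Q : submod M) (P' Q' : submod N) :
  cancel f g -> cancel g f ->
  (forall x, x \in sub_pred P <-> f x \in sub_pred P') ->
  (forall x, x \in sub_pred Q <-> f x \in sub_pred Q') ->
  giso (subquo P Q) (subquo P' Q').
Proof.
move=> fK gK PP QQ.
have fP (x : sub_gmodule P) : ghom_comp f (sub_incl P) x \in sub_pred P'.
  by case: x => x Px; exact/PP.
apply: (giso_subquo (f := ghom_comp (subquo_proj P' Q') (sub_codom fP))).
  move=> y; have [[z zP] <-] := subquo_surj y.
  have gP : g z \in sub_pred P by apply/PP; rewrite gK.
  exists (SubSort gP); congr (subquo_proj _ _ _); apply: val_inj; exact: gK.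
move=> [x Px]; split=> [/subquo_proj0/QQ //|/QQ Qx].
exact/subquo_proj0.
Qed.

Variables (X : nat -> nat -> gmodule G).

Definition tot_swap : ghom (tot X) (tot (fun p q => X q p)) :=
  gdsum_lift (fun i : nat * nat => tot_inj (fun p q => X q p) i.2 i.1).

Lemma tot_swap_inj p q x :
  tot_swap (tot_inj X p q x) = tot_inj (fun p q => X q p) q p x.
Proof. exact: (@gdsum_lift_inj _ _ _ (fun i => X i.1 i.2) _ _ (p, q) x). Qed.

Lemma tot_swap_proj p q x :
  tot_proj (fun p q => X q p) q p (tot_swap x) = tot_proj X p q x.
Proof.
move: x; apply: tot_fun_ext => [a y z|a y z|p' q' x]; rewrite ?linearP //.
rewrite tot_swap_inj; have [[<- <-]|ne] := eqVneq (p', q') (p, q).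
  by rewrite !tot_proj_in.
rewrite !tot_proj_out //; apply: contraNneq ne => -[-> ->] //.
Qed.

End Swap.

(** * Balancing a double complex with two exact augmentations *)

Section Balance.
Variables (k : fieldType) (G : alg_group k) (X : nat -> nat -> gmodule G).
Variables (h : forall p q, ghom (X p q) (X p.+1 q))
          (v : forall p q, ghom (X p q) (X p q.+1)).

Let Xt p q := X q p.
Let vt p q : ghom (Xt p q) (Xt p q.+1) := h q p.
Let ht p q : ghom (Xt p q) (Xt p.+1 q) := v q p.

Lemma tot_swapK : cancel (tot_swap X) (tot_swap Xt).
Proof. by move=> x; apply: tot_ext => p q; rewrite !tot_swap_proj. Qed.

Lemma tot_swapVK : cancel (tot_swap Xt) (tot_swap X).
Proof. by move=> x; apply: tot_ext => p q; rewrite !tot_swap_proj. Qed.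

Lemma tot_swap_d x : tot_swap X (tot_d h v x) = tot_d ht vt (tot_swap X x).
Proof.
move: x; apply: tot_fun_ext => [a y z|a y z|p q x]; rewrite ?linearP //.
rewrite tot_dE tot_h_inj tot_v_inj linearD !tot_swap_inj tot_dE.
by rewrite tot_h_inj tot_v_inj addrC.
Qed.

Lemma tot_swap_fil n x : x \in sub_pred (tot_fil X 0 n) <->
  tot_swap X x \in sub_pred (tot_fil Xt 0 n).
Proof.
split=> /tot_filP xF; apply/tot_filP => p q pq.
  by rewrite tot_swap_proj xF // addnC.
by rewrite -tot_swap_proj xF // addnC.
Qed.

Lemma tot_coh_swap n : giso (tot_coh h v n) (tot_coh ht vt n).
Proof.
apply: (giso_subquo_iso tot_swapK tot_swapVK) => x; split.
- move=> /fss_cocyclesP[Fx dx]; apply/fss_cocyclesP; split.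
    exact/tot_swap_fil.
  by rewrite -tot_swap_d dx linear0.
- move=> /fss_cocyclesP[Fx dx]; apply/fss_cocyclesP; split.
    exact/tot_swap_fil.
  apply: (can_inj tot_swapK); by rewrite tot_swap_d dx linear0.
- move=> /gimsubP[u Fu <-]; apply/gimsubP; exists (tot_swap X u).
    exact/tot_swap_fil.
  by rewrite tot_swap_d.
move=> /gimsubP[u Fu du]; apply/gimsubP; exists (tot_swap Xt u).
  by apply/tot_swap_fil; rewrite tot_swapVK.
by apply: (can_inj tot_swapK); rewrite tot_swap_d tot_swapVK.
Qed.

Hypothesis hh : forall p q x, h p.+1 q (h p q x) = 0.
Hypothesis vv : forall p q x, v p q.+1 (v p q x) = 0.
Hypothesis hv : forall p q x, h p q.+1 (v p q x) + v p.+1 q (h p q x) = 0.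

Variables (A : nat -> gmodule G) (dA : forall q, ghom (A q) (A q.+1)).
Variable a : forall q, ghom (A q) (X 0 q).
Hypothesis a_inj : forall q x, a q x = 0 -> x = 0.
Hypothesis a_ker : forall q x, h 0 q x = 0 <-> exists y, a q y = x.
Hypothesis a_nat : forall q x, a q.+1 (dA q x) = v 0 q (a q x).
Hypothesis h_exact : forall p q x, h p.+1 q x = 0 -> exists y, h p q y = x.

Variables (B : nat -> gmodule G) (dB : forall p, ghom (B p) (B p.+1)).
Variable b : forall p, ghom (B p) (X p 0).
Hypothesis b_inj : forall p x, b p x = 0 -> x = 0.
Hypothesis b_ker : forall p x, v p 0 x = 0 <-> exists y, b p y = x.
Hypothesis b_nat : forall p x, b p.+1 (dB p x) = h p 0 (b p x).
Hypothesis v_exact : forall p q x, v p q.+1 x = 0 -> exists y, v p q y = x.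

Lemma double_complex_balance n : giso (coh dA n) (coh dB n).
Proof.
apply: giso_trans (edge_iso hh vv hv a_inj a_ker a_nat h_exact n) _.
apply: giso_trans (tot_coh_swap n) (giso_sym _).
apply: (@edge_iso _ _ Xt ht vt _ _ _ _ _ b) => // [p q x|p q x|p q x|p q x].
- exact: vv.
- exact: hh.
- by rewrite addrC; exact: hv.
- exact: v_exact.
Qed.

End Balance.

(** * Derived functors by the bar resolution *)

Section FunctorLemmas.
Variables (k : fieldType) (G G' : alg_group k) (F : add_functor G G').
Implicit Types L M N : gmodule G.

Lemma fmap_ext M N (f g : ghom M N) : f =1 g -> fmap F f =1 fmap F g.
Proof. by move=> /ghom_ext ->. Qed.

Lemma fmap_compE L M N (f : ghom L M) (g : ghom M N) x :
  fmap F g (fmap F f x) = fmap F (ghom_comp g f) x.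
Proof. by rewrite fmap_comp. Qed.

Lemma fmap_comp0 L M N (f : ghom L M) (g : ghom M N) :
  (forall x, g (f x) = 0) -> forall x, fmap F g (fmap F f x) = 0.
Proof.
move=> gf x; rewrite fmap_compE -[RHS](fmap_zero N x).
by apply: fmap_ext => y; exact: gf.
Qed.

Lemma fmap_square L M M' N (f : ghom L M) (g : ghom M N) (f' : ghom L M')
    (g' : ghom M' N) : (forall x, g (f x) = g' (f' x)) ->
  forall x, fmap F g (fmap F f x) = fmap F g' (fmap F f' x).
Proof. by move=> e x; rewrite !fmap_compE; apply: fmap_ext. Qed.

Lemma fmap_cancel M N (f : ghom M N) (g : ghom N M) :
  cancel f g -> cancel (fmap F f) (fmap F g).
Proof.
move=> fK x; rewrite fmap_compE -[RHS](_ : fmap F (ghom_id M) x = x).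
  by apply: fmap_ext.
by rewrite fmap_id.
Qed.

Lemma fmap_homotopy L M N (f : ghom L M) (s : ghom M L) (g : ghom M N)
    (t : ghom N M) : (forall x, f (s x) + t (g x) = x) ->
  forall x, fmap F f (fmap F s x) + fmap F t (fmap F g x) = x.
Proof.
move=> st x; rewrite !fmap_compE.
rewrite -[LHS]/(ghom_add (fmap F _) (fmap F _) x) -fmap_add.
rewrite -[RHS](_ : fmap F (ghom_id M) x = x); first exact: fmap_ext.
by rewrite fmap_id.
Qed.

End FunctorLemmas.

(** * An additive functor applied to the bar resolution *)

Section BarFunctor.
Variables (k : fieldType) (G G' : alg_group k) (H : closed_subgroup G).
Variable F : add_functor G G'.
Implicit Types L M N : gmodule G.

Local Notation res := (res_gmodule H).

Lemma bar_map_homotopy p L M N (f : ghom (res L) (res M))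
    (s : ghom (res M) (res L)) (g : ghom (res M) (res N))
    (t : ghom (res N) (res M)) : (forall x, f (s x) + t (g x) = x) ->
  forall x, bar_map p f (bar_map p s x) + bar_map p t (bar_map p g x) = x.
Proof.
by move=> st; elim: p => [|p IHp]; apply: ind_map_homotopy.
Qed.

Lemma bar_map_comp0 p L M N (f : ghom (res L) (res M)) (g : ghom (res M) (res N)) :
  (forall x, g (f x) = 0) -> forall x, bar_map p g (bar_map p f x) = 0.
Proof.
move=> gf; elim: p => [|p IHp] x.
  rewrite [LHS](ind_map_comp (h := ghom_zero _ _)) //; exact: ind_map_zero.
rewrite [LHS](ind_map_comp (h := ghom_zero _ _)) //; exact: ind_map_zero.
Qed.

Lemma bar_map_cancel p M N (f : ghom (res M) (res N)) (g : ghom (res N) (res M)) :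
  cancel f g -> cancel (bar_map p f) (bar_map p g).
Proof.
move=> fK; elim: p => [|p IHp] x.
  rewrite [LHS](ind_map_comp (h := ghom_id _)) //; exact: ind_map_id.
rewrite [LHS](ind_map_comp (h := ghom_id _)) //; exact: ind_map_id.
Qed.

Lemma bar_map_comp p L M N (f : ghom (res L) (res M)) (g : ghom (res M) (res N))
    (h : ghom (res L) (res N)) : (forall x, g (f x) = h x) ->
  forall x, bar_map p g (bar_map p f x) = bar_map p h x.
Proof. by move=> gf; elim: p => [|p IHp]; apply: ind_map_comp. Qed.

(** [barF p] is exact on (G,H)-exact sequences, and the right derived functors
    of F at M are the cohomology of barF 0 M -> barF 1 M -> ... *)
Definition barF (p : nat) M : gmodule G' := F (bar H p.+1 M).
Definition barF_d (p : nat) M : ghom (barF p M) (barF p.+1 M) :=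
  fmap F (bar_d H p.+1 M).
Definition barF_map (p : nat) M N (f : ghom M N) : ghom (barF p M) (barF p N) :=
  fmap F (bar_map p (res_ghom H f)).

Lemma barF_dd p M x : barF_d p.+1 M (barF_d p M x) = 0.
Proof. by apply: fmap_comp0; exact: bar_dd. Qed.

Lemma barF_d_nat p M N (f : ghom M N) x :
  barF_d p N (barF_map p f x) = barF_map p.+1 f (barF_d p M x).
Proof. by apply: fmap_square; exact: bar_d_nat. Qed.

Lemma barF_comp0 p L M N (f : ghom L M) (g : ghom M N) :
  (forall x, g (f x) = 0) -> forall x, barF_map p g (barF_map p f x) = 0.
Proof. by move=> gf; apply/fmap_comp0/bar_map_comp0. Qed.

Lemma barF_comp p L M N (f : ghom L M) (g : ghom M N) (h : ghom L N) :
  (forall x, g (f x) = h x) ->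
  forall x, barF_map p g (barF_map p f x) = barF_map p h x.
Proof.
move=> gf x; rewrite [LHS]fmap_compE; apply: fmap_ext => y.
exact: (bar_map_comp (f := res_ghom H f) (g := res_ghom H g)).
Qed.

Lemma barF_exact p L M N (f : ghom L M) (g : ghom M N) :
  (forall x, g (f x) = 0) -> hsplit H f g ->
  exact_at (barF_map p f) (barF_map p g).
Proof.
move=> gf [s [t st]] y; split=> [gy|[x <-]]; last exact: barF_comp0.
exists (fmap F (bar_map p s) y).
have := fmap_homotopy (F := F) (bar_map_homotopy (p := p)
    (f := res_ghom H f) (g := res_ghom H g) st) y.
have -> : fmap F (bar_map p (res_ghom H g)) y = 0 by exact: gy.
by rewrite linear0 addr0.
Qed.

Lemma barF_mono p M N (f : ghom M N) (r : ghom (res N) (res M)) :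
  (forall x, r (f x) = x) -> forall x, barF_map p f x = 0 -> x = 0.
Proof.
move=> rf x fx.
rewrite -(fmap_cancel (F := F) (bar_map_cancel (p := p) (f := res_ghom H f) rf) x).
by rewrite [fmap F _ x]fx linear0.
Qed.

Lemma barF_epi p M N (g : ghom M N) (s : ghom (res N) (res M)) :
  (forall x, g (s x) = x) -> forall y, exists x, barF_map p g x = y.
Proof.
move=> gs y; exists (fmap F (bar_map p s) y).
exact: (fmap_cancel (F := F) (bar_map_cancel (p := p) (g := res_ghom H g) gs)).
Qed.

Section BarDouble.
Variables (C : nat -> gmodule G) (dC : forall q, ghom (C q) (C q.+1)).
Hypothesis dCdC : forall q x, dC q.+1 (dC q x) = 0.

Definition bar_dbl (p q : nat) : gmodule G' := barF p (C q).
Definition bar_dbl_h p q : ghom (bar_dbl p q) (bar_dbl p.+1 q) := barF_d p (C q).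
(** The sign makes the squares anticommute, as [tot_dd] requires; being invertible, it leaves
    kernels and images unchanged. *)
Definition bar_dbl_v p q : ghom (bar_dbl p q) (bar_dbl p q.+1) :=
  ghom_scale ((-1) ^+ p) (barF_map p (dC q)).

Lemma bar_dbl_vE p q x :
  bar_dbl_v p q x = (-1) ^+ p *: barF_map p (dC q) x.
Proof. exact: ghom_scaleE. Qed.

Lemma bar_dbl_v_eq0 p q x :
  bar_dbl_v p q x = 0 <-> barF_map p (dC q) x = 0.
Proof.
rewrite bar_dbl_vE; split=> [/eqP|->]; last by rewrite scaler0.
by rewrite scaler_eq0 signr_eq0 => /eqP.
Qed.

Lemma bar_dbl_hh p q x : bar_dbl_h p.+1 q (bar_dbl_h p q x) = 0.
Proof. exact: barF_dd. Qed.

Lemma bar_dbl_vv p q x : bar_dbl_v p q.+1 (bar_dbl_v p q x) = 0.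
Proof.
by apply/bar_dbl_v_eq0; rewrite bar_dbl_vE linearZ_LR barF_comp0 ?scaler0.
Qed.

Lemma bar_dbl_hv p q x :
  bar_dbl_h p q.+1 (bar_dbl_v p q x) + bar_dbl_v p.+1 q (bar_dbl_h p q x) = 0.
Proof.
rewrite !bar_dbl_vE linearZ_LR [bar_dbl_h _ _ _]barF_d_nat exprS mulN1r scaleNr.
exact: subrr.
Qed.

Lemma bar_dbl_v_im p q y :
  (exists x, bar_dbl_v p q x = y) <-> (exists x, barF_map p (dC q) x = y).
Proof.
split=> [[x]|[x <-]].
  by rewrite bar_dbl_vE -linearZ_LR => <-; exists ((-1) ^+ p *: x).
exists ((-1) ^+ p *: x); rewrite bar_dbl_vE linearZ_LR scalerA.
by rewrite -exprMn mulrNN mulr1 expr1n scale1r.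
Qed.

End BarDouble.

Lemma resolution_aug_mono M (r : rel_resolution H M) :
  exists t : ghom (res (rr_obj r 0)) (res M), forall x, t (rr_aug r x) = x.
Proof.
have [e0 s0] := rr_exact0 r; have [e1 s1] := rr_exact_M r.
have [||s [t st]] := exact_hsplit e1 _ s1 s0.
- by apply: summand_all => x; exact/gkerP.
- by move=> y; split=> [/gkerP/e0|/e0 ?]; [|exact/gkerP].
by exists t => x; rewrite -[RHS]st [RHS]add0r.
Qed.

Lemma resolution_aug_split M (r : rel_resolution H M) :
  hsplit H (rr_aug r) (rr_d r 0).
Proof.
have [e0 s0] := rr_exact0 r; have [e1 s1] := rr_exact_M r.
have [e2 s2] := rr_exactS r 0.
apply: (exact_hsplit e0 s1 s0 s2) => y.
by split=> [/gkerP/e2|/e2 ?]; [|exact/gkerP].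
Qed.

Lemma resolution_split M (r : rel_resolution H M) n :
  hsplit H (rr_d r n) (rr_d r n.+1).
Proof.
have [e1 s1] := rr_exactS r n; have [e2 s2] := rr_exactS r n.+1.
have s0 : is_summand H (gker (rr_d r n)).
  by case: n {e1 s1 e2 s2} => [|n]; [case: (rr_exact0 r)|case: (rr_exactS r n)].
apply: (exact_hsplit e1 s0 s1 s2) => y.
by split=> [/gkerP/e2|/e2 ?]; [|exact/gkerP].
Qed.

Lemma resolution_dd M (r : rel_resolution H M) n x :
  rr_d r n.+1 (rr_d r n x) = 0.
Proof. by have [e _] := rr_exactS r n; apply/e; exists x. Qed.

Lemma resolution_d_aug M (r : rel_resolution H M) x :
  rr_d r 0 (rr_aug r x) = 0.
Proof. by have [e _] := rr_exact0 r; apply/e; exists x. Qed.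

(** The two augmentations of the double complex F (bar p (I q)), where I is a
    (G,H)-injective resolution of M, are the complexes F I and barF M. *)
Lemma functor_coh_bar M (r : rel_resolution H M) n :
  giso (functor_coh F (rr_d r) n) (coh (fun p => barF_d p M) n).
Proof.
pose C := rr_obj r; pose dC := rr_d r.
have dd := @resolution_dd M r.
have con q := bar_injective_contraction (@rr_inj _ _ _ _ r q).
have -> : functor_coh F (rr_d r) n = coh (fun q => fmap F (rr_d r q)) n.
  by case: n.
apply: (@double_complex_balance _ _ _ _ _ (@bar_dbl_hh C) (bar_dbl_vv dd)
  (bar_dbl_hv dC) _ _ (fun q => fmap F (bar_d H 0 (C q))) _ _ _ _
  _ _ (fun p => barF_map p (rr_aug r))).
(* Rows: the contraction of the bar resolution of I_q is G-linear, hence survives under F. *)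
- move=> q x; have [h [h0 _]] := con q.
  by move=> e; rewrite -(fmap_cancel (F := F) h0 x) e linear0.
- move=> q x; have [h [_ hS]] := con q.
  split=> [dx|[y <-]]; last by apply: fmap_comp0; exact: bar_dd.
  have := fmap_homotopy (F := F) (hS 0%N) x.
  have -> : fmap F (bar_d H 1 (C q)) x = 0 by exact: dx.
  by rewrite linear0 addr0; exists (fmap F (h 0%N) x).
- move=> q x; rewrite bar_dbl_vE scale1r; apply: fmap_square.
  exact: bar_eta_nat.
- move=> p q x dx; have [h [_ hS]] := con q.
  have := fmap_homotopy (F := F) (hS p.+1) x.
  have -> : fmap F (bar_d H p.+2 (C q)) x = 0 by exact: dx.
  by rewrite linear0 addr0; exists (fmap F (h p.+1) x).
(* Columns: the resolution splits over H, and [barF p] respects such splittings. *)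
- move=> p x; have [t tE] := resolution_aug_mono r; exact: (barF_mono tE).
- move=> p x; rewrite bar_dbl_v_eq0.
  exact: (barF_exact (@resolution_d_aug M r) (resolution_aug_split r)).
- by move=> p x; apply: esym; exact: barF_d_nat.
move=> p q x /bar_dbl_v_eq0.
move=> /(barF_exact (dd q) (resolution_split r q))/bar_dbl_v_im[y yE].
by exists y.
Qed.

(** The choice in [Rder] involves only H and [M], so one resolution serves all functors; the bar
    resolution shows that there is one to choose. *)
Lemma Rder_functor_coh M : exists r : rel_resolution H M,
  forall n (G2 : alg_group k) (F2 : add_functor G G2),
    Rder F2 H n M = functor_coh F2 (rr_d r) n.
Proof.
rewrite /Rder; case: pselect => [e|[]]; last by exists (bar_resolution H M).
by exists (sval (cid e)).
Qed.

Lemma Rder_bar n M : giso (Rder F H n M) (coh (fun p => barF_d p M) n).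
Proof.
by have [r ->] := Rder_functor_coh M; exact: functor_coh_bar.
Qed.

End BarFunctor.

(** * The second page of the column filtration *)

Section SecondPage.
Variables (k : fieldType) (G : alg_group k) (X : nat -> nat -> gmodule G).
Variables (h : forall p q, ghom (X p q) (X p.+1 q))
          (v : forall p q, ghom (X p q) (X p q.+1)).

Variables (Z W : nat -> nat -> gmodule G).
Variables (i : forall p q, ghom (Z p q) (X p q))
          (c : forall p q, ghom (Z p q) (W p q))
          (hZ : forall p q, ghom (Z p q) (Z p.+1 q))
          (hW : forall p q, ghom (W p q) (W p.+1 q)).
Hypothesis i_inj : forall p q x, i p q x = 0 -> x = 0.
Hypothesis i_ker : forall p q x, v p q x = 0 <-> exists z, i p q z = x.
Hypothesis c_surj : forall p q y, exists z, c p q z = y.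
Hypothesis c_ker : forall p q z,
  c p q z = 0 <-> cobound (fun q => v p q) (i p q z).
Hypothesis i_nat : forall p q z, i p.+1 q (hZ p q z) = h p q (i p q z).
Hypothesis c_nat : forall p q z, c p.+1 q (hZ p q z) = hW p q (c p q z).

Lemma cobound_tot_v p q x : cobound (fun q => v p q) (n := q) x <->
  exists u, tot_proj X p q (tot_v v u) = x.
Proof.
case: q x => [|q] x; split=> [|[u <-]].
- move=> x0; exists 0; rewrite tot_v0; exact: esym.
- by rewrite tot_v0.
- move=> [y <-]; exists (tot_inj X p q y).
  by rewrite tot_vS tot_proj_in.
- by exists (tot_proj X p q u); rewrite tot_vS.
Qed.

Lemma tot_h_fil p q n u : u \in sub_pred (tot_fil X p%:Z n) ->
  tot_proj X p q (tot_h h u) = 0.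
Proof.
move=> /tot_filP Fu; case: p Fu => [|p] Fu; first exact: tot_h0.
by rewrite tot_hS Fu ?linear0 //; lia.
Qed.

Lemma tot_fil_proj p q u : u \in sub_pred (tot_fil X p%:Z (p + q)%N%:Z) ->
  tot_proj X p q u = 0 -> u \in sub_pred (tot_fil X (p%:Z + 1) (p + q)%N%:Z).
Proof.
move=> /tot_filP Fu u0; apply/tot_filP => a b ab.
have [e|ne] := eqVneq (a, b) (p, q); first by case: e => -> ->.
by apply: Fu; move: ne; rewrite xpair_eqE; lia.
Qed.

Let D := tot_d h v.
Let F := tot_fil X.

Lemma cobound_tot_d p q y : cobound (fun q => v p q) (n := q) y ->
  exists2 t, t \in sub_pred (F p%:Z ((p + q)%N%:Z - 1)) &
    tot_proj X p q (D t) = y.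
Proof.
case: q y => [|q] y => [y0|[u <-]].
  by exists 0; rewrite ?rpred0 // !linear0; apply: esym.
exists (tot_inj X p q u); first by apply: tot_inj_fil; lia.
rewrite /D tot_dE tot_h_inj tot_v_inj linearD tot_proj_in tot_proj_out ?add0r //.
by rewrite xpair_eqE; lia.
Qed.

(** [Z] and [W] are abstract models of vertical cocycles and vertical cohomology. An element x of
    Z_2 has v x_(p,q) = 0 and h x_(p,q) = - v x_(p+1,q-1), so the class of x_(p,q) in [W] is a
    cocycle for [hW]; this class is the isomorphism. *)
Lemma second_page (p q : nat) :
  giso (fss_E D F 2 p%:Z q%:Z) (coh (fun p => hW p q) p).
Proof.
set n := (p + q)%N; rewrite /fss_E -[p%:Z + q%:Z]/(n%:Z).
have iI a b : injective (i a b) by exact: raddf_inj (@i_inj a b).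
have lift x : x \in sub_pred (fss_Z D F 2 p%:Z n%:Z) ->
    exists z, i p q z = tot_proj X p q x.
  move=> /fss_ZP[Fx /tot_filP Fdx]; apply/i_ker.
  have : tot_proj X p q.+1 (D x) = 0 by apply: Fdx; lia.
  by rewrite tot_dE linearD (tot_h_fil _ Fx) add0r tot_vS.
have [||c2 c2E] := @ghom_cofactor _ _ _ _ _ (i p q)
  (ghom_comp (tot_proj X p q) (sub_incl (fss_Z D F 2 p%:Z n%:Z))).
- exact: i_inj.
- by move=> [x Zx]; exact: lift.
have c3 x : ghom_comp (c p q) c2 x \in sub_pred (gker (hW p q)).
  apply/gkerP; rewrite -[LHS]/(hW p q (c p q (c2 x))) -c_nat.
  apply/c_ker; rewrite i_nat c2E -[ghom_comp _ _ x]/(tot_proj X p q (sub_val x)).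
  case: x => x Zx /=; have /fss_ZP[Fx /tot_filP Fdx] := Zx.
  have : tot_proj X p.+1 q (D x) = 0 by apply: Fdx; lia.
  rewrite tot_dE linearD tot_hS => /eqP; rewrite addr_eq0 => /eqP ->.
  by apply/cobound_tot_v; exists (- x); rewrite !linearN.
have d_i a b z : D (tot_inj X a b (i a b z)) = tot_inj X a.+1 b (h a b (i a b z)).
  rewrite /D tot_dE tot_h_inj tot_v_inj.
  have -> : v a b (i a b z) = 0 by apply/i_ker; exists z.
  by rewrite linear0 addr0.
apply: (giso_subquo (f := ghom_comp (coh_proj (fun p => hW p q) p) (sub_codom c3))).
  move=> y; have [[w0 Kw] <-] := coh_proj_surj y.
  have [z zw] := c_surj w0; have /gkerP dw := Kw.
  have : c p.+1 q (hZ p q z) = 0 by rewrite c_nat zw.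
  move=> /c_ker; rewrite i_nat => hB.
  (* [t] cancels the vertical coboundary h z in column p + 1, which puts the differential of z - t
     into step p + 2. *)
  have [t Ft dt] : exists2 t, t \in sub_pred (F (p%:Z + 1) n%:Z) &
      tot_inj X p.+1 q (h p q (i p q z)) - D t \in
        sub_pred (F (p%:Z + 2) (n%:Z + 1)).
    have [t Ft dt] := cobound_tot_d hB.
    exists t.
      have -> : n%:Z = (p.+1 + q)%N%:Z - 1 by rewrite /n; lia.
      by have -> : p%:Z + 1 = p.+1%:Z by lia.
    have -> : p%:Z + 2 = p.+1%:Z + 1 by lia.
    have -> : n%:Z + 1 = (p.+1 + q)%N%:Z by rewrite /n; lia.
    apply: tot_fil_proj; last by rewrite linearB tot_proj_in dt subrr.
    rewrite rpredB //; first exact: tot_inj_fil.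
    by rewrite -(subrK 1 (p.+1 + q)%N%:Z); exact: tot_fil_d.
  have Zx : tot_inj X p q (i p q z) - t \in sub_pred (fss_Z D F 2 p%:Z n%:Z).
    apply/fss_ZP; split; last by rewrite linearB d_i.
    by rewrite rpredB //; [exact: tot_inj_fil|apply: tot_fil_le Ft; lia].
  exists (SubSort Zx); congr (coh_proj _ _ _); apply: val_inj.
  rewrite -[LHS]/(c p q (c2 (SubSort Zx))) -[RHS]/w0 -zw; congr (c p q _).
  apply: iI; rewrite c2E -[LHS]/(tot_proj X p q (_ - _)) linearB tot_proj_in.
  by have /tot_filP -> := Ft; rewrite ?subr0 //; lia.
move=> [x Zx]; set z := c2 (SubSort Zx); have /fss_ZP[Fx Fdx] := Zx.
have zE : i p q z = tot_proj X p q x by exact: c2E.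
rewrite -[ghom_comp _ _ _]/(coh_proj _ _ (SubSort (c3 (SubSort Zx)))).
rewrite -[sub_val _]/x; split=> [/coh_proj0|/fss_BP[u Fu Fxu]].
  rewrite -[sub_val _]/(c p q z); clearbody z => cz.
  (* First subtract a lift of the [hW]-primitive in column p - 1, so that the leading entry becomes
     a vertical coboundary; [t] below then removes it. For p = 0 nothing is to be subtracted. *)
  have [s Fs [Fxs [z0 cz0 z0E]]] : exists2 s,
      s \in sub_pred (F (p%:Z - 2 + 1) (n%:Z - 1)) &
      x - D s \in sub_pred (F p%:Z n%:Z) /\
      exists2 z0, c p q z0 = 0 & i p q z0 = tot_proj X p q (x - D s).
    move: @n z zE cz Fx {Zx Fdx c3 c2 c2E lift}; case: p => [|a] n z zE cz Fx.
      exists 0; first exact: rpred0.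
      by rewrite linear0 subr0; split=> //; exists z.
    have [w ww] := cz; have [z' zw'] := c_surj w.
    exists (tot_inj X a q (i a q z')); first by apply: tot_inj_fil; lia.
    rewrite d_i; split; first by rewrite rpredB //; exact: tot_inj_fil.
    exists (z - hZ a q z'); first by rewrite linearB c_nat zw' ww subrr.
    by rewrite linearB i_nat zE linearB tot_proj_in.
  have [t Ft tE] : exists2 t, t \in sub_pred (F p%:Z (n%:Z - 1)) &
      tot_proj X p q (D t) = i p q z0.
    exact/cobound_tot_d/c_ker.
  apply/fss_BP; exists (s + t).
    by rewrite rpredD //; apply: tot_fil_le Ft; lia.
  rewrite [D _]linearD opprD addrA; apply: tot_fil_proj.
    by rewrite rpredB // -(subrK 1 n%:Z); exact: tot_fil_d.
  by rewrite linearB tE -z0E subrr.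
apply/coh_proj0; rewrite -[sub_val _]/(c p q z); clearbody z.
have : tot_proj X p q (x - D u) = 0 by have /tot_filP := Fxu; apply; lia.
rewrite linearB -zE => /eqP; rewrite subr_eq0 => /eqP zu.
move: @n z zE Fx zu Fu Fxu {Zx Fdx c3 c2 c2E lift}.
case: p => [|a] n z zE Fx; rewrite /D tot_dE linearD.
  rewrite tot_h0 add0r => zu _ _; apply/c_ker/cobound_tot_v.
  by exists u.
rewrite tot_hS => zu Fu Fxu.
have Fau : u \in sub_pred (F a%:Z (n%:Z - 1)) by apply: tot_fil_le Fu; lia.
(* The entry of [u] in column p - 1 is a vertical cocycle, because neither [x] nor [x - D u] has an
   entry in that column. *)
have [z' z'E] : exists z', i a q z' = tot_proj X a q u.
  apply/i_ker; have : tot_proj X a q.+1 (x - D u) = 0.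
    by have /tot_filP := Fxu; apply; lia.
  rewrite linearB; have /tot_filP -> := Fx; last by lia.
  rewrite sub0r => /eqP; rewrite oppr_eq0 /D tot_dE linearD => /eqP.
  by rewrite (tot_h_fil _ Fau) add0r tot_vS.
exists (c a q z'); rewrite -c_nat; apply/eqP; rewrite eq_sym -subr_eq0 -linearB.
apply/eqP/c_ker/cobound_tot_v; exists u.
by rewrite linearB i_nat z'E zu addrAC subrr add0r.
Qed.

End SecondPage.

(** * The Grothendieck spectral sequence *)

Section IntegerSequence.
Variables (k : fieldType) (G : alg_group k) (H : closed_subgroup G).
Variables (M : gmodule G) (r : rel_resolution H M).

(** ... -> 0 -> M -> I_0 -> I_1 -> ..., with I_0 in degree 0. *)
Definition iseq (i : int) : gmodule G :=
  match i with
  | Posz n => rr_obj r n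
  | Negz 0 => M
  | Negz _.+1 => gzero G
  end.

Lemma posz_succ n m : Posz n + 1 = Posz m -> n.+1 = m.
Proof. by lia. Qed.

(** The target is a variable with an equation, since [Posz n + 1] is not convertible to
    [Posz n.+1]. *)
Definition iseq_d (i j : int) : i + 1 = j -> ghom (iseq i) (iseq j) :=
  match i, j return i + 1 = j -> ghom (iseq i) (iseq j) with
  | Posz n, Posz m => fun e =>
      ecast m (ghom (rr_obj r n) (rr_obj r m)) (posz_succ e) (rr_d r n)
  | Negz 0, Posz 0 => fun _ => rr_aug r
  | i, j => fun _ => ghom_zero (iseq i) (iseq j)
  end.

Lemma iseq_dE n (e : Posz n + 1 = Posz n.+1) : iseq_d e = rr_d r n.
Proof. by rewrite /iseq_d (eq_irrelevance (posz_succ e) erefl). Qed.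

Lemma gzeroE (x : gzero G) : x = 0.
Proof. exact: thinmx0. Qed.

Lemma rel_exact_gzero L N (f : ghom L (gzero G)) (g : ghom (gzero G) N) :
  rel_exact_at H f g.
Proof.
split; last by apply: summand_all => x; apply/gkerP; rewrite (gzeroE x) linear0.
move=> y; rewrite (gzeroE y); split=> [_|_]; last exact: linear0.
by exists 0; exact: linear0.
Qed.

Lemma iseq_exact i j l (e : i + 1 = j) (e' : j + 1 = l) :
  rel_exact_at H (iseq_d e) (iseq_d e').
Proof.
case: i j l e e' => [n|[|[|n]]] [m|[|m]] [l|[|l]] e e'; try by exfalso; lia.
- have ? : m = n.+1 by lia.
  have ? : l = n.+2 by lia.
  by subst; rewrite !iseq_dE; exact: rr_exactS.
- have ? : m = 0%N by lia.
  have ? : l = 1%N by lia.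
  by subst; rewrite !iseq_dE; exact: rr_exact0.
- have ? : l = 0%N by lia.
  by subst; exact: rr_exact_M.
all: try exact: rel_exact_gzero.
Qed.

(** Brings what [is_split] says at the indices i + 1 and i + 1 + 1 back to the resolution; [P]
    abstracts the targets, whose types depend on these indices. *)
Lemma iseq_dP2 n j l (e : Posz n + 1 = j) (e' : j + 1 = l)
    (P : forall N N' : gmodule G, ghom (rr_obj r n) N -> ghom N N' -> Prop) :
  P _ _ (iseq_d e) (iseq_d e') -> P _ _ (rr_d r n) (rr_d r n.+1).
Proof.
case: j l e e' => [m|m] [l|l] e e'; try by exfalso; lia.
have ? : m = n.+1 by lia.
have ? : l = n.+2 by lia.
by subst; rewrite !iseq_dE.
Qed.

Section Split.
Variables (G' : alg_group k) (H' : closed_subgroup G') (F : add_functor G G').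
Hypothesis F_split : is_split F H H'.

Lemma split_ker q : rel_short_exact H'
  (sub_incl (gker (fmap F (rr_d r q)))) (gim_map (fmap F (rr_d r q))).
Proof.
have [s _] := F_split (fun i => iseq_exact (erefl (i + 1)) (erefl _)) (Posz q).
exact: (iseq_dP2 (e := erefl _) (e' := erefl _)
  (P := fun N N' f g => rel_short_exact H' (sub_incl (gker (fmap F f)))
                                           (gim_map (fmap F f))) s).
Qed.

Lemma split_coh q (le : {subset sub_pred (gim (fmap F (rr_d r q))) <=
                             sub_pred (gker (fmap F (rr_d r q.+1)))}) :
  rel_short_exact H' (sub_le_incl le)
    (gcoh_proj (fmap F (rr_d r q)) (fmap F (rr_d r q.+1))).
Proof.
have [_] := F_split (fun i => iseq_exact (erefl (i + 1)) (erefl _)) (Posz q).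
move: (fmap_im_le_ker _) => le' s.
move: le; apply: (iseq_dP2 (e := erefl _) (e' := erefl _)
  (P := fun N N' f g => forall le : {subset sub_pred (gim (fmap F f)) <=
                                           sub_pred (gker (fmap F g))},
     rel_short_exact H' (sub_le_incl le) (gcoh_proj (fmap F f) (fmap F g)))) => le.
by rewrite (Prop_irrelevance le le'); exact: s.
Qed.

End Split.
End IntegerSequence.

(** * The double complex of bar resolutions of F(I) *)

Section Grothendieck.
Variables (k : fieldType) (G G' G'' : alg_group k).
Variables (H : closed_subgroup G) (H' : closed_subgroup G').
Variables (F : add_functor G G') (F' : add_functor G' G'').
Hypothesis F'_lex : left_exact F'.
Hypothesis F_inj : forall I : gmodule G,
  rel_injective H I -> is_acyclic H' F' (F I).
Hypothesis F_split : is_split F H H'.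
Variables (M : gmodule G) (r : rel_resolution H M).

Let C q : gmodule G' := F (rr_obj r q).
Let dC q : ghom (C q) (C q.+1) := fmap F (rr_d r q).

Lemma barF_short_exact p (L N K : gmodule G') (f : ghom L N) (g : ghom N K) :
  rel_short_exact H' f g ->
  [/\ forall x, barF_map H' F' p f x = 0 -> x = 0,
      exact_at (barF_map H' F' p f) (barF_map H' F' p g) &
      forall y, exists x, barF_map H' F' p g x = y].
Proof.
move=> fg; have [_ [e _] _] := fg.
have gf x : g (f x) = 0 by apply/e; exists x.
have [s [t [sf gt st]]] := rel_short_exact_splitting fg.
split; [exact: barF_mono sf | | exact: barF_epi gt].
by apply: barF_exact => //; exists s, t.
Qed.

Lemma dCdC q x : dC q.+1 (dC q x) = 0.
Proof. by apply: fmap_comp0; exact: resolution_dd. Qed.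

Let Z q : gmodule G' := sub_gmodule (gker (dC q)).
Let hq q : gmodule G' := coh dC q.
Let incl q : ghom (Z q) (C q) := sub_incl (gker (dC q)).
Let cls q : ghom (Z q) (hq q) := coh_proj dC q.

Lemma im_le_ker q :
  {subset sub_pred (gim (dC q)) <= sub_pred (gker (dC q.+1))}.
Proof. by move=> _ /im_predP[x <-]; apply/gkerP; exact: dCdC. Qed.

Local Notation Phi p := (barF_map H' F' p).

Lemma barF_dC p q x : Phi p (dC q) x = Phi p (incl q.+1)
  (Phi p (sub_le_incl (@im_le_ker q)) (Phi p (gim_map (dC q)) x)).
Proof.
pose f := ghom_comp (sub_le_incl (@im_le_ker q)) (gim_map (dC q)).
by rewrite (barF_comp (h := f)) // (barF_comp (h := dC q)).
Qed.

Lemma incl_mono p q z : Phi p (incl q) z = 0 -> z = 0.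
Proof. by have [m _ _] := barF_short_exact p (split_ker r F_split q); exact: m. Qed.

Lemma incl_inj p q : injective (Phi p (incl q)).
Proof. exact: raddf_inj (@incl_mono p q). Qed.

(** The differential factors through its image and the next kernel. The two inclusions split over
    H', hence remain injective, and the kernel of the remaining surjection is known from the first
    sequence of splitness. *)
Lemma dC_ker p q x :
  Phi p (dC q) x = 0 <-> exists z, Phi p (incl q) z = x.
Proof.
have [_ e _] := barF_short_exact p (split_ker r F_split q).
have [m _ _] := barF_short_exact p (split_coh F_split (@im_le_ker q)).
split=> [dx|[z <-]].
  by apply/e/m/(@incl_mono p q.+1); rewrite -[LHS]barF_dC.
by rewrite barF_comp0 // => -[y Zy]; exact/gkerP.
Qed.

(** Degree 0 is separate: there [coh] has no incoming differential, whereas splitness for the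
    augmented sequence concerns the quotient by the image of F(M). *)
Lemma coh0_inverse : exists g : ghom (hq 0) (Z 0),
  cancel (cls 0) g /\ cancel g (cls 0).
Proof.
have [||g gE] := @ghom_factor _ _ _ _ _ (cls 0) (ghom_id (Z 0)).
- exact: coh_proj_surj.
- by move=> x /coh_proj0 /= x0; exact: val_inj.
by exists g; split=> // y; have [x <-] := @coh_proj_surj _ _ _ dC 0 y; rewrite gE.
Qed.

Lemma cls_epi p q y : exists z, Phi p (cls q) z = y.
Proof.
case: q y => [|q] y.
  have [g [_ gK]] := coh0_inverse.
  exact: (barF_epi (s := res_ghom H' g) gK).
by have [_ _ e] := barF_short_exact p (split_coh F_split (@im_le_ker q)); exact: e.
Qed.

Lemma cls_ker p q z : Phi p (cls q) z = 0 <->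
  cobound (fun q => bar_dbl_v H' F' dC p q) (Phi p (incl q) z).
Proof.
case: q z => [|q] z.
  have [g [gK _]] := coh0_inverse.
  split=> [cz|/incl_mono ->]; last exact: linear0.
  have -> : z = 0 by exact: (barF_mono (r := res_ghom H' g) gK cz).
  exact: linear0.
have [_ e _] := barF_short_exact p (split_coh F_split (@im_le_ker q)).
have [_ _ b] := barF_short_exact p (split_ker r F_split q).
split=> [cz|/bar_dbl_v_im[x]].
  have /e[y <-] : Phi p (gcoh_proj (dC q) (dC q.+1)) z = 0 by exact: cz.
  have [x <-] := b y; apply/bar_dbl_v_im; exists x; exact: barF_dC.
by rewrite barF_dC => /incl_inj <-; apply/e; exists (Phi p (gim_map (dC q)) x).
Qed.

Let h p q := bar_dbl_h H' F' C p q.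
Let v p q := bar_dbl_v H' F' dC p q.

Lemma page2 p q : giso (fss_E (tot_d h v) (tot_fil (bar_dbl H' F' C)) 2 p%:Z q%:Z)
  (Rder F' H' p (hq q)).
Proof.
apply: giso_trans (giso_sym (Rder_bar H' F' p (hq q))).
apply: (@second_page _ _ _ h v (fun p q => barF H' F' p (Z q))
  (fun p q => barF H' F' p (hq q)) (fun p q => Phi p (incl q))
  (fun p q => Phi p (cls q)) (fun p q => barF_d H' F' p (Z q))
  (fun p q => barF_d H' F' p (hq q))).
- exact: incl_mono.
- by move=> a b x; rewrite bar_dbl_v_eq0; exact: dC_ker.
- exact: cls_epi.
- exact: cls_ker.
- by move=> a b z; apply: esym; exact: barF_d_nat.
by move=> a b z; apply: esym; exact: barF_d_nat.
Qed.

Lemma limit_coh n : giso (coh (fun q => fmap F' (dC q)) n) (tot_coh h v n%:Z).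
Proof.
(* Left exactness of F' settles the beginning of each row; further on, exactness is the acyclicity
   of F(I_q), read on the bar resolution. *)
have lex q := F'_lex (bar_aug_exact H' (C q)).1 (bar_exact H' 0 (C q)).1.
apply: (@edge_iso _ _ _ h v _ _ _ _ _ (fun q => fmap F' (bar_d H' 0 (C q)))).
- exact: bar_dbl_hh.
- exact: (bar_dbl_vv dCdC).
- exact: bar_dbl_hv.
- move=> q x; have [e0 _] := lex q.
  by move=> /e0[y <-]; rewrite (gzeroE y) linear0.
- by move=> q; have [_ e1] := lex q; exact: e1.
- move=> q x; rewrite /v bar_dbl_vE scale1r; apply: fmap_square.
  exact: bar_eta_nat.
move=> p q x dx.
have := giso_zero (Rder_bar H' F' p.+1 (C q))
  (F_inj (@rr_inj _ _ _ _ r q) (ltn0Sn p)).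
by move=> /coh_is_zero/(_ _ dx).
Qed.

End Grothendieck.

Theorem theorem5p1p1 (k : closedFieldType) (G G' G'' : alg_group k)
    (H : closed_subgroup G) (H' : closed_subgroup G')
    (F : add_functor G G') (F' : add_functor G' G'')
    (F_lex : left_exact F) (F'_lex : left_exact F')
    (F_inj : forall I : gmodule G, rel_injective H I -> is_acyclic H' F' (F I))
    (F_split : is_split F H H') (M : gmodule G) :
  exists E : spectral_seq G'',
    (forall i j : nat,
       giso (E 2%N i%:Z j%:Z) (Rder F' H' i (Rder F H j M))) /\
    converges E (fun n : nat => Rder (functor_comp F' F) H n M).
Proof.
(* The same [r] computes the derived functors of F and of the composite at [M]. *)
have [r rE] := Rder_functor_coh H M.
pose C q := F (rr_obj r q); pose dC q : ghom (C q) (C q.+1) := fmap F (rr_d r q).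
have dd := @dCdC _ _ _ H F M r.
exists (filtered_ss
  (tot_dd (bar_dbl_hh (H := H') (F := F') (C := C))
          (bar_dbl_vv (H := H') (F := F') dd)
          (bar_dbl_hv (H := H') (F := F') dC))
  (@tot_fil_S _ _ (bar_dbl H' F' C))).
split=> [i j|].
  rewrite rE; have -> : functor_coh F (rr_d r) j = coh dC j by case: j.
  exact: page2.
apply: filtered_ss_converges => [p n x|p n x|n].
- exact: tot_fil_neg.
- exact: tot_fil_big.
rewrite rE; have -> : functor_coh (functor_comp F' F) (rr_d r) n =
  coh (fun q => fmap F' (dC q)) n by case: n.
exact/giso_sym/limit_coh.
Qed.
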